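(* Let $p_1(x)=a_mx^m+a_{m-1}x^{m-1}+\cdots+a_0$ and $p_2(x)=b_nx^n+b_{n-1}x^{n-1}+\cdots+b_0$ be nonconstant polynomials with integer coefficients, with $a_m\neq0$, $b_n\ne 0$ and $m\ne n$. Define the polynomial Toeplitz link function $$L_{PT}(i,j)=\begin{cases}p_1(i)-p_2(j) & i\le j\\ -p_2(i)+p_1(j) & i>j\end{cases}$$ and the polynomial Hankel link function $$L_{PH}(i,j)=\begin{cases}p_1(i)+p_2(j) & i\le j\\ p_2(i)+p_1(j) & i>j.\end{cases}$$ Let $L$ be either of these link functions and let $A_N=(a_{L(i,j)})_{1\le i,j\le N}$ be the associated random real symmetric matrices. Then, as $N\to\infty$, the empirical spectral measures $\mu_{A_N}$ converge in probability and almost surely to the semicircle distribution, and this holds universally (independently of the distribution $p$ of the entries).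
   Context: Let $p$ be a probability distribution on $\mathbb{R}$ with mean $0$, variance $1$ and all higher moments finite, and let $\{a_i: i\in\mathbb{Z}\}$ be i.i.d. random variables with distribution $p$ (the input sequence, common to all $N$; not to be confused with the coefficients of $p_1$). Given a symmetric link function $L$ with integer values, $A_N$ is the $N\times N$ matrix whose $(i,j)$ entry is the input variable with index $L(i,j)$. With $\lambda_1(A_N)\le\dots\le\lambda_N(A_N)$ its eigenvalues, the empirical spectral measure is $\mu_{A_N}=\frac1N\sum_{i=1}^N\delta_{\lambda_i(A_N)/\sqrt N}$, with $k$-th moment $M_k(A_N)=\frac{1}{N^{k/2+1}}\sum_{i=1}^N\lambda_i(A_N)^k$. Convergence of $\mu_{A_N}$ in probability (respectively almost surely) to a distribution uniquely determined by its moments $M_k$ means: for each $k$, $M_k(A_N)\to M_k$ in probability (respectively almost surely). The semicircle distribution has density $\frac{1}{2\pi}\sqrt{4-x^2}$ on $[-2,2]$; its odd moments are $0$ and its $2k$-th moment is $\frac{1}{k+1}\binom{2k}{k}$. *)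

(* Defs.v *)
From HB Require Import structures.
From mathcomp Require Import all_boot all_order all_algebra.
From mathcomp Require Import complex.
From mathcomp Require Import all_classical all_reals all_analysis.
From mathcomp Require Import measurable_realfun.
From mathcomp Require Import spectral sesquilinear lra.

Set Implicit Arguments.
Unset Strict Implicit.
Unset Printing Implicit Defensive.

Import Order.TTheory GRing.Theory Num.Theory.
Import numFieldNormedType.Exports.

Local Open Scope classical_set_scope.
Local Open Scope ring_scope.

(* Indices of link functions are 1-based: only L i j with 1 <= i, j <= N matters. *)
Definition link_PT (p1 p2 : {poly int}) (i j : nat) : int :=
  if (i <= j)%N then p1.[i%:Z] - p2.[j%:Z] else - p2.[i%:Z] + p1.[j%:Z].

Definition link_PH (p1 p2 : {poly int}) (i j : nat) : int :=
  if (i <= j)%N then p1.[i%:Z] + p2.[j%:Z] else p2.[i%:Z] + p1.[j%:Z].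

(* The ordinals i, j are 0-based, hence the successors. *)
Definition link_matrix (K : Type) (x : int -> K) (L : nat -> nat -> int) (N : nat)
    : 'M[K]_N :=
  \matrix_(i < N, j < N) x (L i.+1 j.+1).

Lemma link_PT_sym p1 p2 i j : link_PT p1 p2 i j = link_PT p1 p2 j i.
Proof. by rewrite /link_PT; case: ltngtP => // [_|_|->//]; rewrite addrC. Qed.

Lemma link_PH_sym p1 p2 i j : link_PH p1 p2 i j = link_PH p1 p2 j i.
Proof. by rewrite /link_PH; case: ltngtP => // [_|_|->//]; rewrite addrC. Qed.

Lemma trmx_link_matrix (K : Type) (x : int -> K) (L : nat -> nat -> int) N :
  (forall i j, L i j = L j i) -> (link_matrix x L N)^T = link_matrix x L N.
Proof. by move=> symL; apply/matrixP => i j; rewrite !mxE symL. Qed.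

Section probability.
Context d (T : measurableType d) (R : realType) (P : probability T R).

Definition mutually_independent (I : eqType) d' (T' : measurableType d')
    (X : I -> {RV P >-> T'}) : Prop :=
  forall (s : seq I) (B : I -> set T'), uniq s ->
    (forall i, measurable (B i)) ->
    P (\big[setI/setT]_(i <- s) (X i @^-1` B i)) =
    (\prod_(i <- s) P (X i @^-1` B i))%E.

Definition iid (I : eqType) d' (T' : measurableType d')
    (X : I -> {RV P >-> T'}) (p : probability T' R) : Prop :=
  mutually_independent X /\
  forall i (B : set T'), measurable B -> distribution P (X i) B = p B.

End probability.

Definition standard_law (R : realType) (p : probability R R) : Prop :=
  [/\ forall k : nat, p.-integrable setT (fun x : R => (x ^+ k)%:E),
      ('E_p[(fun x : R => x)] = 0)%E &
      ('V_p[(fun x : R => x)] = 1)%E].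

(* [eigenvalues A] lists the eigenvalues of A with multiplicity in
   nondecreasing order; [eigenvaluesP] shows that such a list exists for every
   real symmetric A, so the default [::] of [xget] is never used there. *)
Definition eigenvalues (R : realType) (N : nat) (A : 'M[R]_N) : seq R :=
  xget [::] [set s | sorted <=%R s /\ char_poly A = \prod_(x <- s) ('X - x%:P)].

Lemma char_poly_conj (F : fieldType) (n : nat) (Q D : 'M[F]_n) :
  Q \in unitmx -> char_poly (invmx Q *m D *m Q) = char_poly D.
Proof.
move=> uQ; pose Z := map_mx (@polyC F) Q; pose Z' := map_mx (@polyC F) (invmx Q).
have Z'Z : Z' *m Z = 1%:M by rewrite -map_mxM mulVmx// map_mx1.
rewrite /char_poly.
have -> : char_poly_mx (invmx Q *m D *m Q) = Z' *m char_poly_mx D *m Z.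
  rewrite /char_poly_mx mulmxBr mulmxBl -!map_mxM; congr (_ - _).
  by rewrite scalar_mxC -mulmxA Z'Z mulmx1.
by rewrite !det_mulmx mulrAC -det_mulmx Z'Z det1 mul1r.
Qed.

Lemma eigenvaluesP (R : realType) (N : nat) (A : 'M[R]_N) : A^T = A ->
  [/\ sorted <=%R (eigenvalues A),
      char_poly A = \prod_(x <- eigenvalues A) ('X - x%:P) &
      size (eigenvalues A) = N].
Proof.
move=> symA.
suff [s sP] : exists s : seq R,
    sorted <=%R s /\ char_poly A = \prod_(x <- s) ('X - x%:P).
  have [srt chA] : [set s | sorted <=%R s /\
      char_poly A = \prod_(x <- s) ('X - x%:P)] (eigenvalues A).
    exact: (@xgetI _ _ _ s).
  split => //; apply: succn_inj.
  by rewrite -(size_char_poly A) chA size_prod_XsubC.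
pose B : 'M[R[i]]_N := map_mx (real_complex R) A.
have Bherm : B \is hermsymmx.
  apply: realsym_hermsym.
    apply/is_hermitianmxP; rewrite expr0 scale1r map_mx_id//.
    by apply/matrixP => i j; rewrite !mxE -[in LHS]symA mxE.
  by apply/mxOverP => i j; rewrite mxE; apply/complex_realP; exists (A i j).
have /orthomx_spectralP BE := hermitian_normalmx Bherm.
have /mxOverP realD := hermitian_spectral_diag_real Bherm.
pose t := [seq complex.Re (spectral_diag B ord0 j) | j <- enum 'I_N].
exists (sort <=%R t); split; first exact/sort_sorted/le_total.
rewrite (perm_big t) ?perm_sort//= /t big_map big_enum/=.
apply: (@map_poly_inj _ _ (real_complex R)).
rewrite map_char_poly -/B BE char_poly_conj ?spectral_unit//.
rewrite char_poly_trig ?diag_mx_is_trig// rmorph_prod; apply: eq_bigr => j _.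
by rewrite !mxE eqxx mulr1n rmorphB/= map_polyX map_polyC/= -BE RRe_real.
Qed.

Definition empirical_spectral_measure (R : realType) (N : nat) (A : 'M[R]_N)
    : {measure set (measurableTypeR R) -> \bar R} :=
  mscale (N%:R^-1 : R)%:nng
    (msum (fun i => \d_((eigenvalues A)`_i / Num.sqrt N%:R : measurableTypeR R))
          N).

Section semicircle.
Context (R : realType).

Definition semicircle_pdf (x : R) : R :=
  if -2 <= x <= 2 then (2 * pi)^-1 * Num.sqrt (4 - x ^+ 2) else 0.

Lemma semicircle_pdf_ge0 x : 0 <= semicircle_pdf x.
Proof.
rewrite /semicircle_pdf; case: ifP => // _.
by rewrite mulr_ge0 ?sqrtr_ge0// invr_ge0 mulr_ge0// pi_ge0.
Qed.

Lemma measurable_semicircle_pdf : measurable_fun setT semicircle_pdf.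
Proof.
have -> : semicircle_pdf = fun x => (2 * pi)^-1 * Num.sqrt (4 - x ^+ 2).
  apply/funext => x; rewrite /semicircle_pdf; case: ifPn => //.
  rewrite -ler_norml -ltNge => x2; rewrite [X in _ * X]ler0_sqrtr ?mulr0//.
  by rewrite subr_le0 -real_normK ?num_real//; nra.
apply: continuous_measurable_fun => x; apply: cvgM; first exact: cvg_cst.
apply: (@continuous_comp _ _ _ (fun x : R => 4 - x ^+ 2) Num.sqrt).
  by apply: cvgB; [exact: cvg_cst|exact: exprn_continuous].
exact: sqrt_continuous.
Qed.

Definition semicircle (A : set (measurableTypeR R)) : \bar R :=
  (\int[lebesgue_measure]_(x in A) (semicircle_pdf x)%:E)%E.

Let semicircle0 : semicircle set0 = 0%E.
Proof. exact: integral_set0. Qed.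

Let semicircle_ge0 A : (0 <= semicircle A)%E.
Proof. by apply: integral_ge0 => x _; rewrite lee_fin semicircle_pdf_ge0. Qed.

Let semicircle_sigma_additive : semi_sigma_additive semicircle.
Proof.
move=> F mF tF mUF; rewrite /semicircle ge0_integral_bigcup//=.
- by apply: is_cvg_ereal_nneg_natsum => n _; exact: semicircle_ge0.
- apply/measurable_EFinP; apply: measurable_funS measurable_semicircle_pdf => //.
- by move=> x _; rewrite lee_fin semicircle_pdf_ge0.
Qed.

HB.instance Definition _ := isMeasure.Build _ _ _ semicircle
  semicircle0 semicircle_ge0 semicircle_sigma_additive.

End semicircle.

Definition moment (R : realType)
    (mu : {measure set (measurableTypeR R) -> \bar R}) (k : nat) : R :=
  \int[mu]_x (x ^+ k).

Lemma moment_empirical (R : realType) (N : nat) (A : 'M[R]_N) (k : nat) :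
  moment (empirical_spectral_measure A) k =
  (N%:R * Num.sqrt N%:R ^+ k)^-1 * \sum_(i < N) (eigenvalues A)`_i ^+ k.
Proof.
pose y (i : nat) : R := (eigenvalues A)`_i / Num.sqrt N%:R.
have mk : measurable_fun setT (fun x : measurableTypeR R => (x ^+ k)%:E).
  by apply/measurable_EFinP; exact: exprn_measurable.
have I (f : measurableTypeR R -> \bar R) : (forall x, 0 <= f x)%E ->
    measurable_fun setT f ->
    (\int[empirical_spectral_measure A]_x f x =
     N%:R^-1%:E * \sum_(i < N) f (y i))%E.
  move=> f0 mf; rewrite ge0_integral_mscale//= ge0_integral_measure_sum//.
  congr (_ * _)%E; apply: eq_bigr => i _.
  by rewrite integral_dirac// diracT mul1e.
rewrite /moment /Rintegral integralE !I//=; last 2 first.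
- exact: measurable_funeneg.
- exact: measurable_funepos.
under eq_bigr do rewrite funeposE -EFin_max.
under [X in (_ - _ * X)%E]eq_bigr do rewrite funenegE -EFinN -EFin_max.
rewrite !sumEFin -!EFinM -EFinB/= -mulrBr -sumrB invfM -mulrA; congr (_ * _).
rewrite mulr_sumr; apply: eq_bigr => i _.
rewrite -exprVn mulrC -exprMn -/(y i).
by rewrite !maxEle oppr_le0; case: ltgtP => // [h|h|->]; lra.
Qed.

(* For random measures mu_N and a law nu determined by its moments, convergence
   of mu_N to nu means convergence of every moment. *)
Section convergence.
Context d (T : measurableType d) (R : realType) (P : probability T R).
Variable mu : nat -> T -> {measure set (measurableTypeR R) -> \bar R}.
Variable nu : {measure set (measurableTypeR R) -> \bar R}.

Definition cvg_moments_in_probability : Prop :=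
  forall (k : nat) (e : R), 0 < e ->
    P [set w | e <= `|moment (mu N w) k - moment nu k|] @[N --> \oo] --> 0%E.

Definition cvg_moments_almost_surely : Prop :=
  forall k : nat,
    {ae P, forall w, moment (mu N w) k @[N --> \oo] --> moment nu k}.

End convergence.

(* Main.v *)
Require Import Defs.
From mathcomp Require Import all_boot all_order all_algebra.
From mathcomp Require Import complex qpoly spectral.
From mathcomp Require Import all_classical all_reals all_analysis.
From mathcomp Require Import measurable_realfun.
From mathcomp Require Import zify ring lra.

(** The proof is by moments. Up to a sign of [p2] absorbed in a polynomial [g],
    both links are [f (min i j) + g (max i j)] with [f] and [g] of different
    degrees ([link_ordered]). The index [L i j] is regarded as the colour of the
    pair [i, j]. The expected trace of the k-th power of the matrix is a sum over
    closed walks of length k; independence gives each walk the product, over the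
    colours it meets, of the moments of the law, the order being the multiplicity
    of the colour ([trace_pow_expectation]). As the law is centred, a walk that
    meets a colour exactly once contributes 0; as its variance is 1, a walk that
    meets each of its colours exactly twice contributes 1. The law enters only in
    error terms, so universality is a matter of counting walks.

    Three features of the colouring matter ([sparse_colouring]): a colour occurs
    at most D times in a row; it occurs at most l times in all, with l of order
    N^(1-e) for some e > 0; and at most l N forks join two pairs of equal colour
    at a common vertex. They come from the different degrees. If n is the larger
    degree, an equation [f x + g y = c] confines the value of the dominant
    polynomial to a window of radius O(N^(n-1)), and Lagrange interpolation shows
    that an integer polynomial of degree n takes values in such a window at
    O(N^(1-1/n)) arguments only ([card_near]). A fork centred at y with its ends
    on opposite sides of y gives such an equation for one of its ends, by the
    dominance of the same polynomial; ends on the same side would be two arguments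
    where f or g takes one value, and these are bounded ([collision_bound]).

    A walk whose colours are paired is counted by reading it edge by edge: a new
    colour costs a factor N, a known one at most D. Consider its last edge and the
    edge paired with it. Either they are one edge traversed in both directions,
    and the walk splits there into two closed walks; or the count falls short of
    the maximal order by a factor l / N ([unfolded_coverable]). With m_k the
    normalised mean moments this reads
    m_(k+2) = sum over t <= k of m_t m_(k-t), up to o(1) ([closed_sum_rec]),
    the recursion of the Catalan numbers, which the moments of the semicircle law
    satisfy as well ([moment_semicircle_rec]). The product of two traces is a sum
    over pairs of closed walks, and only pairs that share a colour contribute to
    the covariance, which is therefore small: this decouples the two walks of a
    split, and bounds the variance of a normalised moment by O(N^(-1-e))
    ([closed_sum_cov], [mean_product_variance]). The bound tends to 0, which gives
    convergence in probability ([random_moment_prob]), and is summable, which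
    gives almost sure convergence ([random_moment_ae]). *)

Set Implicit Arguments.
Unset Strict Implicit.
Unset Printing Implicit Defensive.

Import Order.TTheory GRing.Theory Num.Theory.
Import numFieldNormedType.Exports.

(** * Counting the labellings of a graph with coloured edges *)

Section Counting.
Variables (V : finType) (C : eqType) (col : V -> V -> C).
Implicit Types (F G : (nat -> V) -> Prop) (U W : seq nat) (f g : nat -> V).

(** Families of labellings are predicates on functions of all of [nat], so their
    number on the finite set [U] of positions is bounded by the length of a list
    that contains all their restrictions. *)
Definition coverable F U (b : nat) : Prop :=
  exists2 s : seq (seq V), (size s <= b)%N & forall f, F f -> map f U \in s.

Lemma coverable_leq F U b b' : (b <= b')%N -> coverable F U b -> coverable F U b'.
Proof. by move=> bb' [s sb sF]; exists s => //; apply: leq_trans bb'. Qed.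

Lemma coverable_imp F G U b :
  (forall f, F f -> G f) -> coverable G U b -> coverable F U b.
Proof. by move=> FG [s sb sG]; exists s => // f /FG/sG. Qed.

Lemma coverable0 F U b : (forall f, ~ F f) -> coverable F U b.
Proof. by move=> F0; exists [::] => // f /F0. Qed.

Lemma coverable_inhabited F U b :
  ((0 < #|V|)%N -> coverable F U b) -> coverable F U b.
Proof.
have [/card0_eq V0 _|V0 H] := posnP #|V|; last exact: H.
by apply: coverable0 => f; have := V0 (f 0%N); rewrite inE.
Qed.

Lemma coverable_or F G U b b' :
  coverable F U b -> coverable G U b' ->
  coverable (fun f => F f \/ G f) U (b + b').
Proof.
move=> [s sb sF] [s' sb' sG]; exists (s ++ s'); first by rewrite size_cat leq_add.
by move=> f [/sF|/sG] h; rewrite mem_cat h ?orbT.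
Qed.

Lemma coverable_sub F U W b :
  {subset W <= U} -> coverable F U b -> coverable F W b.
Proof.
move=> WU [s sb sF]; case: (pickP (fun _ : V => true)) => [d _|V0]; last first.
  by exists [::] => // f; have := V0 (f 0%N).
exists [seq [seq nth d u (index j U) | j <- W] | u <- s]; first by rewrite size_map.
move=> f /sF fs; apply/mapP; exists (map f U) => //.
apply/eq_in_map => j /WU jU; rewrite (nth_map 0) ?index_mem//.
by rewrite nth_index.
Qed.

(** Dependent product rule: the choices on [W] are counted with those on [U]
    already made. *)
Lemma coverable_cat F U W b b' :
  coverable F U b ->
  (forall g, F g -> coverable (fun f => F f /\ map f U = map g U) W b') ->
  coverable F (U ++ W) (b * b').
Proof.
move=> [s sb sF] FW.
have /choice[t tP] : forall u : seq V, exists t : seq (seq V),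
    (size t <= b')%N /\ forall f, F f -> map f U = u -> map f W \in t.
  move=> u; have [[g [Fg gu]]|nog] := pselect (exists g, F g /\ map g U = u).
    have [t tb' tF] := FW _ Fg; exists t; split=> // f Ff fu.
    by apply: tF; rewrite gu.
  exists [::]; split=> // f Ff fu; exfalso; apply: nog; by exists f.
exists [seq u ++ v | u <- s, v <- t u].
  rewrite size_allpairs_dep; apply: (@leq_trans (\sum_(u <- s) b')).
    rewrite sumnE big_map; apply: leq_sum => u _; exact: (tP u).1.
  by rewrite big_const_seq count_predT iter_addn_0 mulnC leq_mul2r sb orbT.
move=> f Ff; rewrite map_cat; apply: allpairs_f_dep; first exact: sF.
exact: (tP _).2.
Qed.

Lemma coverable_shift F G U b m :
  (forall f, F f -> G (fun i => f (m + i))) ->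
  coverable G U b -> coverable F [seq m + i | i <- U] b.
Proof.
by move=> FG [s sb sG]; exists s => // f /FG/sG; rewrite -map_comp.
Qed.

Lemma coverable1 F a : coverable F [:: a] #|V|.
Proof.
exists [seq [:: x] | x <- enum V]; first by rewrite size_map -cardE.
by move=> f _; apply/mapP; exists (f a); rewrite ?mem_enum.
Qed.

Lemma coverable2 F a b : coverable F [:: a; b] (#|V| * #|V|).
Proof.
apply: (@coverable_cat F [:: a] [:: b]); first exact: coverable1.
by move=> g _; exact: coverable1.
Qed.

(** Two positions and a label. Equal labels announce equal colours, whereas
    different labels are not required to have different colours. *)
Definition edge := (nat * nat * nat)%type.
Implicit Types (E : seq edge) (e : edge).

Definition ecol f e : C := col (f e.1.1) (f e.1.2).

Definition fits E f : Prop :=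
  forall e e', e \in E -> e' \in E -> e.2 = e'.2 -> ecol f e = ecol f e'.

Definition inside U : pred edge := fun e => (e.1.1 \in U) && (e.1.2 \in U).

(** [U] is the list of positions read so far; a label is read together with the
    first of its edges to have both ends in [U]. *)
Definition nlabels E U : nat := size (undup [seq e.2 | e <- E & inside U e]).

Lemma inside_sub U W e : {subset U <= W} -> inside U e -> inside W e.
Proof. by move=> UW /andP[/UW a /UW b]; apply/andP. Qed.

Lemma nlabels_sub E E' U W :
  {subset E <= E'} -> {subset U <= W} -> (nlabels E U <= nlabels E' W)%N.
Proof.
move=> EE' UW; apply: uniq_leq_size; first exact: undup_uniq.
move=> l; rewrite !mem_undup => /mapP[e]; rewrite mem_filter => /andP[eU eE] ->.
by apply/map_f; rewrite mem_filter (inside_sub UW eU) EE'.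
Qed.

Lemma nlabels_lt E E' U W e :
  {subset E <= E'} -> {subset U <= W} -> e \in E' -> inside W e ->
  e.2 \notin [seq e'.2 | e' <- E & inside U e'] ->
  (nlabels E U < nlabels E' W)%N.
Proof.
move=> EE' UW eE eW eN.
rewrite /nlabels -[X in (X < _)%N]/(size _) -[(_ < _)%N]/(size (e.2 :: _) <= _)%N.
apply: uniq_leq_size; first by rewrite /= mem_undup eN undup_uniq.
move=> l; rewrite inE !mem_undup => /orP[/eqP->|/mapP[e']].
  by apply/map_f; rewrite mem_filter eW.
rewrite mem_filter => /andP[eU' eE'] ->.
by apply/map_f; rewrite mem_filter (inside_sub UW eU') EE'.
Qed.

Lemma nlabels_le E U : (nlabels E U <= size (undup [seq e.2 | e <- E]))%N.
Proof.
apply: uniq_leq_size; first exact: undup_uniq.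
move=> l; rewrite !mem_undup => /mapP[e]; rewrite mem_filter => /andP[_ eE] ->.
exact/map_f.
Qed.

Variable D : nat.
Hypothesis D_gt0 : (0 < D)%N.
Hypothesis col_sym : forall x y, col x y = col y x.
Hypothesis row_bound : forall x c, (#|[pred y | col x y == c]| <= D)%N.

(** The common form of the counts below, one factor [#|V|] for each label read
    and a power of [D] for everything else. The remaining factor [X] records a
    saving when it is the size [l] of a level set, a debt when it contains
    [#|V|]. *)
Definition budget F E U X := coverable F U (X * D ^ size U * #|V| ^ nlabels E U).

(** An edge that leaves [U] keeps the budget. If its label has been read, its
    colour is known and its far end is one of [D] vertices of a row; otherwise the
    far end is free, but the number of labels read grows by one. *)
Lemma budget_step F E U X e :
  (forall f, F f -> fits E f) -> e \in E -> (e.1.1 \in U) || (e.1.2 \in U) ->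
  budget F E U X -> budget F E (U ++ [:: e.1.1; e.1.2]) X.
Proof.
move=> FE eE touch bU.
have sU : {subset U <= U ++ [:: e.1.1; e.1.2]} by move=> i iU; rewrite mem_cat iU.
apply: coverable_inhabited => V1.
have szU : D ^ size (U ++ [:: e.1.1; e.1.2]) = D ^ size U * D * D.
  by rewrite size_cat/= addn2 !expnSr.
case: (boolP (e.2 \in [seq e'.2 | e' <- E & inside U e'])) => known.
  suff : coverable F (U ++ [:: e.1.1; e.1.2]) (X * D ^ size U * #|V| ^ nlabels E U * D).
    apply: coverable_leq; rewrite szU -!mulnA leq_mul2l; apply/orP; right.
    rewrite leq_mul2l; apply/orP; right.
    rewrite mulnC leq_mul2l -[X in (X <= _)%N]mul1n; apply/orP; right.
    by apply: leq_mul => //; rewrite leq_pexp2l// nlabels_sub.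
  apply: coverable_cat => // g Fg.
  move/mapP: known => [e']; rewrite mem_filter => /andP[/andP[i1 i2] e'E] ee'.
  have colE f : F f /\ map f U = map g U -> ecol f e = ecol g e'.
    move=> [Ff /eq_in_map fg]; rewrite (FE _ Ff e e')//.
    by rewrite /ecol fg// fg.
  case/orP: touch => [t1|t2].
    exists [seq [:: g e.1.1; y] | y <- enum [pred y | col (g e.1.1) y == ecol g e']].
      by rewrite size_map -cardE; apply: row_bound.
    move=> f fF; have := colE _ fF; move: fF => [_ /eq_in_map fg] fe.
    apply/mapP; exists (f e.1.2); last by rewrite /= (fg _ t1).
    by rewrite mem_enum inE -(fg _ t1) -fe.
  exists [seq [:: y; g e.1.2] | y <- enum [pred y | col (g e.1.2) y == ecol g e']].
    by rewrite size_map -cardE; apply: row_bound.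
  move=> f fF; have := colE _ fF; move: fF => [_ /eq_in_map fg] fe.
  apply/mapP; exists (f e.1.1); last by rewrite /= (fg _ t2).
  by rewrite mem_enum inE -(fg _ t2) -fe col_sym.
suff : coverable F (U ++ [:: e.1.1; e.1.2]) (X * D ^ size U * #|V| ^ nlabels E U * #|V|).
  apply: coverable_leq; rewrite szU -!mulnA leq_mul2l; apply/orP; right.
  rewrite leq_mul2l; apply/orP; right.
  rewrite -expnSr mulnA; apply: leq_trans (leq_pmull _ _); last by rewrite muln_gt0 D_gt0.
  rewrite leq_pexp2l//; apply: (nlabels_lt (e := e)) => //.
  by rewrite /inside !mem_cat !inE !eqxx !orbT.
apply: coverable_cat => // g Fg.
case/orP: touch => [t1|t2].
  exists [seq [:: g e.1.1; y] | y <- enum V]; first by rewrite size_map -cardE.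
  move=> f [_ /eq_in_map fg]; apply/mapP; exists (f e.1.2); first by rewrite mem_enum.
  by rewrite /= (fg _ t1).
exists [seq [:: y; g e.1.2] | y <- enum V]; first by rewrite size_map -cardE.
move=> f [_ /eq_in_map fg]; apply/mapP; exists (f e.1.1).
  by rewrite mem_enum.
by rewrite /= (fg e.1.2).
Qed.

(** Positions are listed with repetitions, each step adding both ends of its
    edge; hence the exact length. *)
Definition grows U U' m (W : seq nat) :=
  [/\ {subset U <= U'}, size U' = (size U + 2 * m)%N & {subset W <= U'}].

Lemma budget_right F E U X a m :
  (forall f, F f -> fits E f) ->
  (forall i, (i < m)%N -> exists k, (a + i, (a + i).+1, k) \in E) ->
  a \in U -> budget F E U X ->
  exists U', grows U U' m (iota a m.+1) /\ budget F E U' X.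
Proof.
move=> FE; elim: m => [|m IH] hE aU bU.
  exists U; split=> //; split; rewrite ?muln0 ?addn0//.
  by move=> i; rewrite inE => /eqP ->.
have [|U' [[UU' szU' U'i] bU']] := IH _ aU bU.
  by move=> i im; apply: hE; rewrite ltnS ltnW.
have [k kE] := hE m (ltnSn m).
have am : (a + m)%N \in U' by apply: U'i; rewrite mem_iota; lia.
exists (U' ++ [:: (a + m)%N; (a + m).+1]); split; last first.
  by apply: (budget_step (e := (a + m, (a + m).+1, k)%N)) => //=; rewrite am.
split.
- by move=> i /UU' iU'; rewrite mem_cat iU'.
- by rewrite size_cat szU'/=; lia.
- move=> i; rewrite mem_iota mem_cat !inE => ai.
  case: (ltnP i (a + m).+1) => im; last by apply/orP; right; lia.
  by rewrite U'i// mem_iota; lia.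
Qed.

Lemma budget_left F E U X a m :
  (forall f, F f -> fits E f) ->
  (forall i, (i < m)%N -> exists k, (a + i, (a + i).+1, k) \in E) ->
  (a + m)%N \in U -> budget F E U X ->
  exists U', grows U U' m (iota a m.+1) /\ budget F E U' X.
Proof.
move=> FE; elim: m a => [|m IH] a hE aU bU.
  exists U; split=> //; split; rewrite ?muln0 ?addn0//.
  by move=> i; rewrite inE => /eqP ->; rewrite -[a]addn0.
have [||U' [[UU' szU' U'i] bU']] := IH a.+1 _ _ bU; [ |by rewrite addSnnS|].
  by move=> i im; have [k kE] := hE i.+1 im; exists k; rewrite addSnnS.
have [k kE] := hE 0 isT; rewrite addn0 in kE.
have am : a.+1 \in U' by apply: U'i; rewrite mem_iota; lia.
exists (U' ++ [:: a; a.+1]); split; last first.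
  by apply: (budget_step (e := (a, a.+1, k)%N)) => //=; rewrite am orbT.
split.
- by move=> i /UU' iU'; rewrite mem_cat iU'.
- by rewrite size_cat szU'/=; lia.
- move=> i; rewrite mem_iota mem_cat !inE => ai.
  case: (ltnP a i) => im; last by apply/orP; right; lia.
  by rewrite U'i// mem_iota; lia.
Qed.

(** The saving behind [crossing_coverable] and [linked_coverable]. A label [k] is disregarded while [U] is explored,
    and then one of its edges turns out to have both ends in [U]: its colour is
    determined, although the budget allows a free vertex for the label. This pays
    for one factor [#|V|]. *)
Lemma budget_close F E U X k e :
  e \in E -> e.2 = k -> inside U e ->
  budget F [seq e' <- E | e'.2 != k] U (X * #|V|) -> budget F E U X.
Proof.
move=> eE ek eU; apply: coverable_leq.
case: (posnP #|V|) => [->|V0]; first by rewrite muln0 !mul0n.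
rewrite (mulnAC X) -(mulnA (X * _)) -expnS leq_mul2l leq_pexp2l ?orbT//.
apply: (nlabels_lt (e := e)) => //.
  by move=> ?; rewrite mem_filter => /andP[].
rewrite -filter_predI; apply/negP => /mapP[e']; rewrite mem_filter /= ek.
by move=> /andP[/andP[_ /eqP ne] _] /esym.
Qed.

Variable l : nat.
Hypothesis level_bound :
  forall c, (#|[pred z : V * V | col z.1 z.2 == c]| <= l)%N.

Lemma coverable_level F E U b e e' :
  (forall f, F f -> fits E f) -> e \in E -> e' \in E -> e.2 = e'.2 ->
  inside U e -> coverable F U b -> coverable F (U ++ [:: e'.1.1; e'.1.2]) (b * l).
Proof.
move=> FE eE e'E ee' /andP[e1 e2] bU; apply: coverable_cat => // g Fg.
exists [seq [:: z.1; z.2] | z <- enum [pred z : V * V | col z.1 z.2 == ecol g e]].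
  by rewrite size_map -cardE; apply: level_bound.
move=> f [Ff /eq_in_map fg]; apply/mapP; exists (f e'.1.1, f e'.1.2) => //.
rewrite mem_enum inE /= -[col _ _]/(ecol f e') -(FE _ Ff e e')// /ecol.
by rewrite !fg.
Qed.

(** An edge not attached to [U] whose colour is known: its two ends come from one
    level set. *)
Lemma budget_level F E U X e e' :
  (forall f, F f -> fits E f) -> e \in E -> e' \in E -> e.2 = e'.2 ->
  inside U e -> budget F E U X -> budget F E (U ++ [:: e'.1.1; e'.1.2]) (X * l).
Proof.
move=> FE eE e'E ee' eU bU.
apply: coverable_inhabited => V1.
apply: coverable_leq (coverable_level FE eE e'E ee' eU bU).
rewrite mulnAC (mulnAC X) leq_mul// ?leq_mul// leq_pexp2l//.
  by rewrite size_cat leq_addr.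
by apply: nlabels_sub => // i iU; rewrite mem_cat iU.
Qed.

End Counting.

(** * Counting walks by the pattern of their colours *)

Section Words.
Variable T : eqType.
Implicit Types (w : seq T).

Lemma sum_count_undup w : (\sum_(x <- undup w) count_mem x w)%N = size w.
Proof.
rewrite -(perm_size (perm_count_undup w)) size_flatten sumnE /shape -map_comp big_map.
by apply: eq_bigr => x _; rewrite /= size_nseq.
Qed.

Definition repeats w := forall x, x \in w -> (2 <= count_mem x w)%N.
Definition paired w := forall x, x \in w -> count_mem x w = 2.

Lemma paired_size w : paired w -> (2 * size (undup w) = size w)%N.
Proof.
move=> pw; rewrite -[RHS]sum_count_undup -sum1_size big_distrr/=.
by rewrite [LHS]big_seq [RHS]big_seq; apply: eq_bigr => x; rewrite mem_undup => /pw ->.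
Qed.

Lemma repeats_size w : repeats w -> ~ paired w -> (2 * size (undup w) < size w)%N.
Proof.
move=> rw /existsNP[x /not_implyP[xw cx]].
rewrite -[X in (_ < X)%N]sum_count_undup -sum1_size big_distrr/=.
have xu : x \in undup w by rewrite mem_undup.
rewrite !(perm_big _ (perm_to_rem xu))/= !big_cons.
rewrite -addSn leq_add//; first by have := rw _ xw; lia.
rewrite [X in (X <= _)%N]big_seq [X in (_ <= X)%N]big_seq; apply: leq_sum => y.
by move=> /mem_rem; rewrite mem_undup => /rw.
Qed.

End Words.

Definition add_norm := (addSn, addnS, addn0, addnA).

Section PathCounting.
Variables (V : finType) (C : eqType) (col : V -> V -> C).
Implicit Types (F G : (nat -> V) -> Prop) (U : seq nat) (f g : nat -> V) (w : seq nat).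

Definition path_edges m w : seq edge :=
  [seq (m + i, (m + i).+1, nth 0 w i)%N | i <- iota 0 (size w)].

Lemma path_edges_labels m w : [seq e.2 | e <- path_edges m w] = w.
Proof. by rewrite -map_comp -[RHS](mkseq_nth 0). Qed.

Lemma mem_path_edges m w i : (i < size w)%N ->
  (m + i, (m + i).+1, nth 0 w i)%N \in path_edges m w.
Proof. by move=> iw; apply/mapP; exists i; rewrite ?mem_iota. Qed.

Lemma fits_sub E E' f : {subset E <= E'} -> fits col E' f -> fits col E f.
Proof. by move=> EE fE e e' /EE eE /EE; exact: fE. Qed.

Lemma fits_shift E m f :
  fits col [seq (m + e.1.1, m + e.1.2, e.2)%N | e <- E] f ->
  fits col E (fun i => f (m + i)%N).
Proof.
move=> fE e e' eE e'E ee'.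
pose h (e : edge) : edge := (m + e.1.1, m + e.1.2, e.2)%N.
exact: fE (h e) (h e') (map_f h eE) (map_f h e'E) ee'.
Qed.

Lemma path_edges_shift m m' w :
  path_edges (m + m') w = [seq (m + e.1.1, m + e.1.2, e.2)%N | e <- path_edges m' w].
Proof. by rewrite -map_comp; apply: eq_map => i /=; rewrite addnS !addnA. Qed.

Lemma path_edges_cat m w w' :
  path_edges m (w ++ w') = path_edges m w ++ path_edges (m + size w) w'.
Proof.
rewrite /path_edges size_cat iotaD map_cat add0n; congr (_ ++ _).
  by apply/eq_in_map => i; rewrite mem_iota => /andP[_ iw]; rewrite nth_cat iw.
rewrite -[size w in LHS]addn0 iotaDl -map_comp; apply: eq_map => i /=.
by rewrite nth_cat ltnNge leq_addr/= addKn addnA.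
Qed.

Variable D : nat.
Hypothesis D_gt0 : (0 < D)%N.
Hypothesis col_sym : forall x y, col x y = col y x.
Hypothesis row_bound : forall x c, (#|[pred y | col x y == c]| <= D)%N.
Local Notation budget := (budget D).

(** Whatever was chosen before the exploration started may be charged to the
    labels already visible in [U]. *)
Lemma budget_start F E U X k :
  (k <= nlabels E U)%N -> coverable F U (X * #|V| ^ k) -> budget F E U X.
Proof.
move=> kU FU; apply: coverable_inhabited => V0.
apply: coverable_leq FU; apply: leq_mul; first by rewrite leq_pmulr// expn_gt0 D_gt0.
by rewrite leq_pexp2l.
Qed.

Lemma budget_path_right F E U X a w :
  (forall f, F f -> fits col E f) -> {subset path_edges a w <= E} ->
  a \in U -> budget F E U X ->
  exists U', grows U U' (size w) (iota a (size w).+1) /\ budget F E U' X.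
Proof.
move=> FE wE aU bU; apply: budget_right => // i iw.
by exists (nth 0 w i); apply: wE; exact: mem_path_edges.
Qed.

Lemma budget_path_left F E U X a w :
  (forall f, F f -> fits col E f) -> {subset path_edges a w <= E} ->
  (a + size w)%N \in U -> budget F E U X ->
  exists U', grows U U' (size w) (iota a (size w).+1) /\ budget F E U' X.
Proof.
move=> FE wE aU bU; apply: budget_left => // i iw.
by exists (nth 0 w i); apply: wE; exact: mem_path_edges.
Qed.

Lemma budget_coverable F E U X W n r :
  {subset W <= U} -> (size U <= n)%N ->
  (size (undup [seq e.2 | e <- E]) <= r)%N ->
  budget F E U X -> coverable F W (X * D ^ n * #|V| ^ r).
Proof.
move=> WU Un Er bU; apply: coverable_sub WU _.
apply: coverable_inhabited => V0.
apply: coverable_leq bU; apply: leq_mul; first by rewrite leq_mul// leq_pexp2l.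
by rewrite leq_pexp2l//; apply: leq_trans (nlabels_le _ _) Er.
Qed.

(** The first vertex and one vertex for each label; as no label is single and
    they are not all double, there are at most [(size w - 1) / 2] labels. *)
Lemma unpaired_coverable w : repeats w -> ~ paired w ->
  coverable (fits col (path_edges 0 w)) (iota 0 (size w).+1)
    (D ^ (2 * size w).+2 * #|V| ^ uphalf (size w)).
Proof.
move=> rw /(repeats_size rw) sw.
have b0 : budget (fits col (path_edges 0 w)) (path_edges 0 w) [:: 0] #|V|.
  by apply: (@budget_start _ _ _ _ 0) => //; rewrite muln1; exact: coverable1.
have [U [[_ sU iU] bU]] := budget_path_right (fun f h => h) (fun e h => h)
   (mem_head 0 [::]) b0.
apply: (@coverable_leq _ _ _ (#|V| * D ^ (2 * size w).+2 * #|V| ^ size (undup w))).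
    rewrite mulnAC mulnC leq_mul2l -expnS; apply/orP; right.
  case: (posnP #|V|) => [->|V0]; first by rewrite exp0n.
  by apply: leq_pexp2l => //; rewrite ltnNge leq_uphalf_double -ltnNge -mul2n.
apply: budget_coverable bU => //; first by rewrite sU/=; lia.
by rewrite path_edges_labels.
Qed.

Lemma path_edges_infix w a w' w1 w3 : w = w1 ++ w' ++ w3 -> a = size w1 ->
  {subset path_edges a w' <= path_edges 0 w}.
Proof.
by move=> -> -> e; rewrite !path_edges_cat !mem_cat => ->; rewrite orbT.
Qed.

Lemma path_edges_filter E a u s : s \notin u -> {subset path_edges a u <= E} ->
  {subset path_edges a u <= [seq e <- E | e.2 != s]}.
Proof.
move=> su uE e eu; rewrite mem_filter uE// andbT.
have : e.2 \in u by rewrite -[u](path_edges_labels a); exact: map_f.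
by apply: contraTneq => ->.
Qed.

Variable l : nat.
Hypothesis level_bound :
  forall c, (#|[pred z : V * V | col z.1 z.2 == c]| <= l)%N.

(** The edge [s] is the only one of its label between two edges [c]. Choose the
    second edge [c] freely and the first one in its level set; the segment between them
    is read from both ends towards the edge [s], whose label is disregarded
    meanwhile. At the end both ends of [s] are known, and [budget_close] pays for
    the surplus vertex of the free choice. *)
Lemma crossing_coverable w1 w2 w3 c s :
  c != s -> count_mem s w2 = 1 -> let w := w1 ++ c :: w2 ++ c :: w3 in
  coverable (fits col (path_edges 0 w)) (iota 0 (size w).+1)
    (l * D ^ (2 * size w).+2 * #|V| ^ size (undup w)).
Proof.
move=> cs s1.
have sw2 : s \in w2 by rewrite -has_pred1 has_count s1.
have {sw2}[u1 [u2 w2E]] : exists u1 u2 : seq nat, w2 = u1 ++ s :: u2.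
  by case/splitPr: sw2 => u1 u2; exists u1, u2.
move: s1; rewrite {w2}w2E => s1 w.
have {}s1 : (count_mem s u1 + (1 + count_mem s u2) = 1)%N.
  by rewrite -[RHS]s1 count_cat/= eqxx.
have su1 : s \notin u1 by rewrite -has_pred1 has_count; lia.
have su2 : s \notin u2 by rewrite -has_pred1 has_count; lia.
pose t := size w1; pose a := (t.+1 + size u1)%N; pose t2 := (a.+1 + size u2)%N.
pose E := path_edges 0 w; pose E' := [seq e <- E | e.2 != s].
have c1E : (t, t.+1, c) \in E.
  apply: (@path_edges_infix w t [:: c] w1) => //.
  by rewrite /path_edges/= addn0 mem_head.
have c2E : (t2, t2.+1, c) \in E.
  apply: (@path_edges_infix w t2 [:: c] (w1 ++ c :: u1 ++ s :: u2) w3) => //.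
  - by rewrite /w !(=^~ catA, cat_cons, cat0s).
  - by rewrite /t2 /a /t; do 4 rewrite ?size_cat /=; rewrite ?add_norm.
  - by rewrite /path_edges/= addn0 mem_head.
have sE : (a, a.+1, s) \in E.
  apply: (@path_edges_infix w a [:: s] (w1 ++ c :: u1) (u2 ++ c :: w3)) => //.
  - by rewrite /w !(=^~ catA, cat_cons, cat0s).
  - by rewrite /t2 /a /t; do 4 rewrite ?size_cat /=; rewrite ?add_norm.
  - by rewrite /path_edges/= addn0 mem_head.
have u1E : {subset path_edges t.+1 u1 <= E'}.
  apply: path_edges_filter => //.
  apply: (@path_edges_infix w _ u1 (w1 ++ [:: c]) (s :: u2 ++ c :: w3)) => //.
  - by rewrite /w !(=^~ catA, cat_cons, cat0s).
  - by rewrite /t2 /a /t; do 4 rewrite ?size_cat /=; rewrite ?add_norm.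
have u2E : {subset path_edges a.+1 u2 <= E'}.
  apply: path_edges_filter => //.
  apply: (@path_edges_infix w _ u2 (w1 ++ c :: u1 ++ [:: s]) (c :: w3)) => //.
  - by rewrite /w !(=^~ catA, cat_cons, cat0s).
  - by rewrite /t2 /a /t; do 4 rewrite ?size_cat /=; rewrite ?add_norm.
have w1E : {subset path_edges 0 w1 <= E} by apply: (@path_edges_infix w _ w1 [::]).
have w3E : {subset path_edges t2.+1 w3 <= E}.
  apply: (@path_edges_infix w _ w3 (w1 ++ c :: u1 ++ s :: u2 ++ [:: c]) [::]) => //.
  - by rewrite /w cats0 !(=^~ catA, cat_cons, cat0s).
  - by rewrite /t2 /a /t; do 4 rewrite ?size_cat /=; rewrite ?add_norm.
pose F := fits col E.
have FE f : F f -> fits col E f by [].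
have FE' f : F f -> fits col E' f.
  by apply: fits_sub => e; rewrite mem_filter => /andP[].
have b1 : budget F E' [:: t2; t2.+1; t; t.+1] (l * #|V|).
  apply: (@budget_start _ _ _ _ 1).
    have : {subset [:: (t, t.+1, c)] <= E'}.
      by move=> e; rewrite inE => /eqP ->; rewrite mem_filter c1E andbT.
    move=> /nlabels_sub sub1.
    have := sub1 [:: t2; t2.+1; t; t.+1] _ (fun _ h => h).
    by rewrite /nlabels/= /inside !inE !eqxx !orbT.
  rewrite expn1 -mulnA mulnC.
  apply: (@coverable_level _ _ _ _ level_bound F E [:: t2; t2.+1] _
     (t2, t2.+1, c) (t, t.+1, c)) => //.
    by rewrite /inside !inE !eqxx orbT.
  exact: coverable2.
have [|U2 [[U12 sU2 iU2] b2]] := budget_path_right FE' u1E _ b1.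
  by rewrite !inE eqxx !orbT.
have [|U3 [[U23 sU3 iU3] b3]] := budget_path_left FE' u2E _ b2.
  by apply: U12; rewrite mem_head.
have {}b3 : budget F E U3 l.
  apply: (budget_close (e := (a, a.+1, s)) sE) b3 => //.
  apply/andP; split=> /=; last exact/iU3/mem_head.
  by apply/U23/iU2; rewrite mem_iota /a; lia.
have [|U4 [[U34 sU4 iU4] b4]] := budget_path_left FE w1E _ b3.
  by apply/U23/U12; rewrite !inE eqxx !orbT.
have [|U5 [[U45 sU5 iU5] b5]] := budget_path_right FE w3E _ b4.
  by apply/U34/U23/U12; rewrite !inE eqxx !orbT.
have sw : size w = (t2 + size w3).+1.
  by rewrite /w !size_cat/= !size_cat/= /t2 /a /t !(addSn, addnS) ?addnA.
apply: budget_coverable b5; last by rewrite path_edges_labels.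
  move=> i; rewrite mem_iota sw => /andP[_ it].
  case: (leqP i t) => [it1|ti]; first by apply/U45/iU4; rewrite mem_iota; lia.
  case: (leqP i a) => [ia|ai].
    by apply/U45/U34/U23/iU2; rewrite mem_iota; lia.
  case: (leqP i t2) => [it2|t2i]; last by apply/iU5; rewrite mem_iota; lia.
  by apply/U45/U34/iU3; rewrite mem_iota; lia.
by rewrite sU5 sU4 sU3 sU2 sw /t2 /a /t /=; lia.
Qed.

(** Once the first walk is read, an edge of the second one that carries the shared
    label costs a level set, and the second walk is read from there in both
    directions. *)
Lemma linked_extend F w1 w2 x U X : x \in w1 -> x \in w2 ->
  let E := path_edges 0 w1 ++ path_edges (size w1).+1 w2 in
  (forall f, F f -> fits col E f) ->
  {subset iota 0 (size w1).+1 <= U} -> (size U <= (2 * size w1).+2)%N ->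
  budget F E U X ->
  coverable F (iota 0 (size w1 + size w2).+2)
    (X * l * D ^ (2 * (size w1 + size w2)).+4 * #|V| ^ size (undup (w1 ++ w2))).
Proof.
move=> xw1 xw2 E FE wU sU bU.
have w1E : {subset path_edges 0 w1 <= E} by move=> e h; rewrite mem_cat h.
have w2E : {subset path_edges (size w1).+1 w2 <= E}.
  by move=> e h; rewrite mem_cat h orbT.
have LE : [seq e.2 | e <- E] = w1 ++ w2 by rewrite map_cat !path_edges_labels.
have [v1 [v2 vE]] : exists v1 v2 : seq nat, w2 = v1 ++ x :: v2.
  by case/splitPr: xw2 => v1 v2; exists v1, v2.
pose i := index x w1; pose b := ((size w1).+1 + size v1)%N.
have iw1 : (i < size w1)%N by rewrite index_mem.
have e1E : (i, i.+1, x) \in E.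
  by apply: w1E; have := mem_path_edges 0 iw1; rewrite nth_index.
have e2E : (b, b.+1, x) \in E.
  apply: w2E; rewrite vE path_edges_cat mem_cat; apply/orP; right.
  by rewrite /path_edges/= addn0 mem_head.
have b1 : budget F E (U ++ [:: b; b.+1]) (X * l).
  apply: (budget_level D_gt0 level_bound (e := (i, i.+1, x)) (e' := (b, b.+1, x))) => //.
  by apply/andP; split; apply: wU; rewrite mem_iota/=; lia.
have v1E : {subset path_edges (size w1).+1 v1 <= E}.
  by move=> e h; apply: w2E; rewrite vE path_edges_cat mem_cat h.
have v2E : {subset path_edges b.+1 v2 <= E}.
  move=> e h; apply: w2E; rewrite vE -cat1s !path_edges_cat !mem_cat.
  by rewrite -addnA addn1 addnS h !orbT.
have [|U1 [[U01 sU1 iU1] b1']] := budget_path_left FE v1E _ b1.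
  by rewrite mem_cat mem_head orbT.
have [|U2 [[U12 sU2 iU2] b2]] := budget_path_right FE v2E _ b1'.
  by apply/U01; rewrite mem_cat !inE eqxx !orbT.
apply: budget_coverable b2; last by rewrite LE.
- have -> : size w2 = (size v1 + size v2).+1 by rewrite vE size_cat/= addnS.
  move=> k; rewrite mem_iota => /andP[_ kn].
  case: (leqP k (size w1)) => kw.
    by apply/U12/U01; rewrite mem_cat wU// mem_iota.
  case: (leqP k b) => kb; first by apply/U12/iU1; rewrite mem_iota; lia.
  by apply/iU2; rewrite mem_iota; lia.
- rewrite sU2 sU1 size_cat vE size_cat/=; lia.
Qed.

(** Two closed walks sharing a label. If all labels are double, the shared one
    occurs once in the first walk, and reading that closed walk from its base
    point towards this edge on both sides saves the factor of the base point.
    Otherwise there are fewer labels than half the total length, which makes up for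
    that factor. *)
Lemma linked_coverable w1 w2 x : repeats (w1 ++ w2) -> x \in w1 -> x \in w2 ->
  coverable (fun f => fits col (path_edges 0 w1 ++ path_edges (size w1).+1 w2) f /\
       f 0 = f (size w1))
    (iota 0 (size w1 + size w2).+2)
    (l * D ^ (2 * (size w1 + size w2)).+4 * #|V| ^ uphalf (size w1 + size w2)).
Proof.
move=> rw xw1 xw2; pose E := path_edges 0 w1 ++ path_edges (size w1).+1 w2.
set F : (nat -> V) -> Prop := (fun f => _).
have FE f : F f -> fits col E f by case.
have w1E : {subset path_edges 0 w1 <= E} by move=> e h; rewrite mem_cat h.
have [pw|npw] := pselect (paired (w1 ++ w2)).
  have cx : count_mem x w1 = 1.
    have := pw x; rewrite mem_cat xw1 => /(_ isT); rewrite count_cat.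
    by move: xw1 xw2; rewrite -!has_pred1 !has_count; lia.
  have [u1 [u2 uE]] : exists u1 u2 : seq nat, w1 = u1 ++ x :: u2.
    by case/splitPr: xw1 => u1 u2; exists u1, u2.
  have sw1 : size w1 = (size u1).+1 + size u2 by rewrite uE size_cat/= addSnnS.
  have cu : (count_mem x u1 + (1 + count_mem x u2) = 1)%N.
    by rewrite -[RHS]cx uE count_cat/= eqxx.
  have su1 : x \notin u1 by rewrite -has_pred1 has_count; lia.
  have su2 : x \notin u2 by rewrite -has_pred1 has_count; lia.
  have xE : (size u1, (size u1).+1, x) \in E.
    apply: w1E; rewrite uE path_edges_cat mem_cat; apply/orP; right.
    by rewrite /path_edges/= addn0 mem_head.
  have u1E : {subset path_edges 0 u1 <= [seq e <- E | e.2 != x]}.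
    apply: path_edges_filter => // e h; apply: w1E.
    by rewrite uE path_edges_cat mem_cat h.
  have u2E : {subset path_edges (size u1).+1 u2 <= [seq e <- E | e.2 != x]}.
    apply: path_edges_filter => // e h; apply: w1E.
    by rewrite uE -cat1s !path_edges_cat !mem_cat add0n addn1 h !orbT.
  have FE' f : F f -> fits col [seq e <- E | e.2 != x] f.
    by move=> /FE; apply: fits_sub => e; rewrite mem_filter => /andP[].
  have b0 : budget F [seq e <- E | e.2 != x] [:: 0; size w1] #|V|.
    apply: (budget_start (k := 0)) => //; rewrite muln1.
    exists [seq [:: y; y] | y <- enum V]; first by rewrite size_map -cardE.
    by move=> f [_ e]; apply/mapP; exists (f 0); rewrite ?mem_enum//= -e.
  have [|U1 [[U01 sU1 iU1] b1]] := budget_path_right FE' u1E _ b0.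
    by rewrite mem_head.
  have [|U2 [[U12 sU2 iU2] b2]] := budget_path_left FE' u2E _ b1.
    by apply/U01; rewrite !inE -sw1 eqxx !orbT.
  have {}b2 : budget F E U2 1.
    apply: (budget_close (e := (size u1, (size u1).+1, x)) xE) => //; last first.
      by rewrite mul1n; exact: b2.
    apply/andP; split=> /=; first by apply/U12/iU1; rewrite mem_iota; lia.
    by apply/iU2; rewrite mem_head.
  have -> : uphalf (size w1 + size w2) = size (undup (w1 ++ w2)).
    by rewrite -size_cat -(paired_size pw) mul2n uphalf_double.
  rewrite -[l]mul1n.
  apply: (linked_extend xw1 xw2 FE _ _ b2); last by rewrite sU2 sU1 sw1/=; lia.
  move=> i; rewrite mem_iota => /andP[_ ij].
  case: (leqP i (size u1)) => iu; first by apply/U12/iU1; rewrite mem_iota; lia.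
  by apply/iU2; rewrite mem_iota; lia.
have b0 : budget F E [:: 0] #|V|.
  by apply: (budget_start (k := 0)) => //; rewrite muln1; exact: coverable1.
have [|U1 [[U01 sU1 iU1] b1]] := budget_path_right FE w1E _ b0.
  by rewrite mem_head.
apply: coverable_leq (linked_extend xw1 xw2 FE iU1 _ b1); last by rewrite sU1/=; lia.
have := repeats_size rw npw; rewrite size_cat => r.
move: (D ^ _)%N => A; rewrite -!mulnA mulnCA leq_mul// mulnCA leq_mul// -expnS.
case: (posnP #|V|) => [->|V0]; first by rewrite exp0n.
by apply: leq_pexp2l => //; rewrite gtn_uphalf_double -mul2n.
Qed.

Hypothesis fork_bound :
  (#|[pred z : V * V * V | (col z.1.1 z.1.2 == col z.1.2 z.2)
      && (z.1.1 != z.2)]| <= l * #|V|)%N.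

Lemma fork_coverable F t j :
  (forall f, F f -> [/\ col (f t) (f t.+1) = col (f j) (f j.+1),
     f t.+1 = f j & f t <> f j.+1]) ->
  coverable F [:: t; t.+1; j; j.+1] (l * #|V|).
Proof.
move=> FP; exists [seq [:: z.1.1; z.1.2; z.1.2; z.2] | z : V * V * V in
    [pred z : V * V * V | (col z.1.1 z.1.2 == col z.1.2 z.2) && (z.1.1 != z.2)]].
  by rewrite size_map -cardE.
move=> f /FP[ecol e /eqP ne]; apply/mapP; exists (f t, f t.+1, f j.+1).
  by rewrite mem_enum inE/= ne andbT ecol e.
by rewrite /= e.
Qed.

Lemma nlabels_path E U a w : {subset path_edges a w <= E} ->
  {subset iota a (size w).+1 <= U} -> (size (undup w) <= nlabels E U)%N.
Proof.
move=> wE wU; rewrite -{1}[w](path_edges_labels a).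
apply: leq_trans (nlabels_sub wE wU).
apply: uniq_leq_size; first exact: undup_uniq.
move=> x; rewrite !mem_undup => /mapP[e eE ->]; apply: map_f.
rewrite mem_filter eE andbT; case/mapP: eE => k; rewrite mem_iota => kw ->.
by apply/andP; split; rewrite (mem_iota a (size w).+1) /=; lia.
Qed.

(** A paired word is generically followed by closed walks; those that fail to
    close are the exception to be bounded. *)
Definition open_walk w f :=
  fits col (path_edges 0 w) f /\ f 0 <> f (size w).

(** The last edge, with label [c], and its partner at position [t] are not one
    edge traversed in both directions with closed walks before and in between. *)
Definition unfolded w1 c w2 f :=
  let t := size w1 in let j := (t.+1 + size w2)%N in
  fits col (path_edges 0 (w1 ++ c :: w2 ++ [:: c])) f /\
  ~ [/\ f t = f 0, f t.+1 = f j & f j.+1 = f 0].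

Variable K : nat.
(* One factor [3] for each level of the induction, which distinguishes 3 cases. *)
Let B n := ((3 * D ^ (2 * K).+2) ^ n.+1)%N.

(** If a label has one occurrence between the two edges [c], it crosses [c].
    Otherwise [w1] and [w2] are paired words, and an unfolded walk either is open
    along [w2], or is open along [w1], or has the two edges [c] in a fork. The
    first two cases start from the induction hypothesis for the open part, the
    third from the count of forks. *)
Lemma unfolded_coverable_step w1 c w2 :
  let w := w1 ++ c :: w2 ++ [:: c] in (size w <= K)%N -> paired w ->
  (forall w', (size w' < size w)%N -> paired w' ->
     coverable (open_walk w') (iota 0 (size w').+1)
       (l * B (size w') * #|V| ^ size (undup w'))) ->
  coverable (unfolded w1 c w2) (iota 0 (size w).+1)
    (l * B (size w) * #|V| ^ size (undup w)).
Proof.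
move=> w wK pw IH; set r := size (undup w).
have cw x : count_mem x w = ((count_mem x w1 + count_mem x w2) + (c == x) * 2)%N.
  by rewrite /w count_cat/= count_cat/=; lia.
have [cw1 cw2] : count_mem c w1 = 0 /\ count_mem c w2 = 0.
  have := pw c; rewrite cw eqxx /w mem_cat mem_head orbT => /(_ isT); lia.
pose X := (3 * D ^ (2 * K).+2)%N.
have X0 : (0 < X)%N by rewrite muln_gt0 expn_gt0 D_gt0.
have [[s [sw2 s1]]|nos] := pselect (exists s, s \in w2 /\ count_mem s w2 = 1).
  have cs : c != s by apply: contra_eq_neq cw2 => ->; rewrite s1.
  apply: coverable_imp (coverable_leq _ (crossing_coverable w1 [::] cs s1)).
    by move=> f [].
  rewrite leq_mul// leq_mul//; apply: (@leq_trans X).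
    rewrite /X; apply: leq_trans (leq_pmull _ _) => //.
    by rewrite leq_pexp2l// !ltnS leq_mul2l wK orbT.
  by rewrite -[X in (X <= _)%N]expn1 leq_pexp2l.
have le2 x : (count_mem x w <= 2)%N.
  case: (boolP (x \in w)) => [/pw ->//|]; by rewrite -has_pred1 has_count; lia.
have pw2 : paired w2.
  move=> x xw2; have : (0 < count_mem x w2)%N by rewrite -has_count has_pred1.
  have := le2 x; rewrite cw; case: (eqVneq (count_mem x w2) 1) => [x1|]; last by lia.
  by case: nos; exists x.
have pw1 : paired w1.
  move=> x xw1; have : (0 < count_mem x w1)%N by rewrite -has_count has_pred1.
  have := pw x; rewrite cw /w mem_cat xw1 => /(_ isT).
  case: (boolP (x \in w2)) => [/pw2|]; first by lia.
  rewrite -has_pred1 has_count -leqNgt leqn0 => /eqP ->.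
  by case: eqVneq cw1 => [->|]; lia.
pose t := size w1; pose j := (t.+1 + size w2)%N.
have sw : size w = j.+1 by rewrite /w /j /t; do 4 rewrite ?size_cat /=; rewrite ?add_norm.
pose E := path_edges 0 w.
have w1E : {subset path_edges 0 w1 <= E} by apply: (@path_edges_infix w _ w1 [::]).
have w2E : {subset path_edges t.+1 w2 <= E}.
  apply: (@path_edges_infix w _ w2 (w1 ++ [:: c]) [:: c]) => //.
  - by rewrite /w !(=^~ catA, cat_cons, cat0s).
  - by rewrite /t; do 4 rewrite ?size_cat /=; rewrite ?add_norm.
have w1cE : {subset path_edges 0 (w1 ++ [:: c]) <= E}.
  apply: (@path_edges_infix w _ _ [::] (w2 ++ [:: c])) => //.
  by rewrite /w !(=^~ catA, cat_cons, cat0s).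
have cE : {subset path_edges j [:: c] <= E}.
  apply: (@path_edges_infix w _ [:: c] (w1 ++ c :: w2) [::]) => //.
  - by rewrite /w !(=^~ catA, cat_cons, cat0s).
  - by rewrite /j /t; do 4 rewrite ?size_cat /=; rewrite ?add_norm.
have cwE : {subset path_edges t (c :: w2 ++ [:: c]) <= E}.
  by apply: (@path_edges_infix w _ _ w1 [::]); rewrite ?cats0.
pose F1 f := fits col E f /\ f t.+1 <> f j.
pose F2 f := fits col E f /\ f 0 <> f t.
pose F3 f := [/\ fits col E f, f t.+1 = f j & f t <> f j.+1].
have Bn m : (m < size w)%N -> (B m <= X ^ size w)%N by move=> mw; rewrite leq_pexp2l.
suff [b1 b2 b3] : [/\ coverable F1 (iota 0 (size w).+1)
    (l * X ^ size w * D ^ (2 * K).+2 * #|V| ^ r),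
  coverable F2 (iota 0 (size w).+1)
    (l * X ^ size w * D ^ (2 * K).+2 * #|V| ^ r) &
  coverable F3 (iota 0 (size w).+1)
    (l * X ^ size w * D ^ (2 * K).+2 * #|V| ^ r)].
  have := coverable_or b1 (coverable_or b2 b3); move=> bb; apply: coverable_imp (coverable_leq _ bb).
    move=> f [fE nf]; have [e1|/eqP n1] := eqVneq (f t.+1) (f j); last by left.
    have [e2|/eqP n2] := eqVneq (f 0) (f t); last by right; left.
    right; right; split=> // e3; apply: nf; split=> //; last by rewrite -[(_ + _)%N]/j -e3.
  have -> : B (size w) = (3 * D ^ (2 * K).+2 * X ^ size w)%N by rewrite /B expnS.
  by move: (X ^ _) (D ^ _) (#|V| ^ _) => x y z; lia.
split.
- have b0 : budget F1 E [seq t.+1 + i | i <- iota 0 (size w2).+1] (l * B (size w2)).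
    apply: (budget_start (k := size (undup w2))).
      apply: (nlabels_path (a := t.+1)) => // i; rewrite mem_iota => /andP[ti ij].
      by apply/mapP; exists (i - t.+1)%N; rewrite ?mem_iota; lia.
    apply: coverable_shift (IH w2 _ pw2); last by rewrite sw /j; lia.
    move=> f [fE ne]; split; last by rewrite addn0.
    apply: fits_shift; rewrite -path_edges_shift addn0.
    exact: fits_sub fE.
  have [|U1 [[U01 sU1 iU1] b1]] := budget_path_left (fun f (h : F1 f) => h.1) w1cE _ b0.
    by apply/mapP; exists 0; rewrite ?mem_iota// size_cat /= -/t; lia.
  have [|U2 [[U12 sU2 iU2] b2]] := budget_path_right (fun f (h : F1 f) => h.1) cE _ b1.
    by apply/U01/mapP; exists (size w2); rewrite ?mem_iota//; lia.
  apply: coverable_leq (budget_coverable (n := (2 * K).+2) (r := r) _ _ _ b2).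
  + by rewrite leq_mul// leq_mul// leq_mul// Bn// sw /j; lia.
  + move=> i; rewrite mem_iota sw => /andP[_ ij].
    case: (leqP i t) => it; first by apply/U12/iU1; rewrite mem_iota size_cat/= -/t; lia.
    case: (leqP i j) => ij'; last by apply/iU2; rewrite mem_iota/=; lia.
    by apply/U12/U01/mapP; exists (i - t.+1)%N; rewrite ?mem_iota; lia.
  + rewrite sU2 sU1 size_map size_iota size_cat/= -/t; lia.
  + by rewrite path_edges_labels.
- have b0 : budget F2 E (iota 0 (size w1).+1) (l * B (size w1)).
    apply: (budget_start (k := size (undup w1))).
      exact: (nlabels_path (a := 0)).
    apply: coverable_imp (IH w1 _ pw1); last by rewrite sw /j /t; lia.
    by move=> f [fE ne]; split=> //; apply: fits_sub fE.
  have [|U1 [[U01 sU1 iU1] b1]] := budget_path_right (fun f (h : F2 f) => h.1) cwE _ b0.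
    by rewrite mem_iota /t; lia.
  apply: coverable_leq (budget_coverable (n := (2 * K).+2) (r := r) _ _ _ b1).
  + by rewrite leq_mul// leq_mul// leq_mul// Bn// sw /j /t; lia.
  + move=> i; rewrite mem_iota sw => /andP[_ ij].
    case: (leqP i t) => it; first by apply/U01; rewrite mem_iota; lia.
    by apply/iU1; rewrite mem_iota/= size_cat/=; lia.
  + by rewrite sU1 size_iota/= size_cat/= -/t; lia.
  + by rewrite path_edges_labels.
have FE f : F3 f -> fits col E f by case.
have ecE : (t, t.+1, c) \in E.
  by apply: cwE; rewrite /path_edges/= addn0 mem_head.
have ecE' : (j, j.+1, c) \in E.
  by apply: cE; rewrite /path_edges/= addn0 mem_head.
have b0 : budget F3 E [:: t; t.+1; j; j.+1] l.
  apply: (budget_start (k := 1)).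
    have : {subset [:: (t, t.+1, c)] <= E} by move=> e; rewrite inE => /eqP ->.
    move=> /nlabels_sub sub1.
    have := sub1 [:: t; t.+1; j; j.+1] _ (fun _ h => h).
    by rewrite /nlabels/= /inside !inE !eqxx !orbT.
  rewrite expn1; apply: fork_coverable => f [fE e1 e2]; split=> //.
  exact: fE ecE ecE' erefl.
have [|U1 [[U01 sU1 iU1] b1]] := budget_path_left FE w1E _ b0.
  by rewrite mem_head.
have [|U2 [[U12 sU2 iU2] b2]] := budget_path_right FE w2E _ b1.
  by apply/U01; rewrite !inE eqxx !orbT.
apply: coverable_leq (budget_coverable (n := (2 * K).+2) (r := r) _ _ _ b2).
+ by rewrite leq_mul// leq_mul// leq_pmulr// expn_gt0 X0.
+ move=> i; rewrite mem_iota sw => /andP[_ ij].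
  case: (leqP i t) => it; first by apply/U12/iU1; rewrite mem_iota; lia.
  case: (leqP i j) => ij'; first by apply/iU2; rewrite mem_iota/=; lia.
  by apply/U12/U01; rewrite !inE; lia.
+ by rewrite sU2 sU1/= -/t; lia.
+ by rewrite path_edges_labels.
Qed.

Lemma open_walk_coverable w : (size w <= K)%N -> paired w ->
  coverable (open_walk w) (iota 0 (size w).+1)
    (l * B (size w) * #|V| ^ size (undup w)).
Proof.
have [n] := ubnP (size w); elim: n w => // n IH w; rewrite ltnS => wn wK pw.
case/lastP: w wn wK pw => [|w c] wn wK pw.
  by apply: coverable0 => f [_].
have cw : c \in w.
  have := pw c; rewrite mem_rcons mem_head -cats1 count_cat/= eqxx => /(_ isT).
  by rewrite -has_pred1 has_count; case: (count_mem c w).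
have [w1 [w2 wE]] : exists w1 w2 : seq nat, w = w1 ++ c :: w2.
  by case/splitPr: cw => w1 w2; exists w1, w2.
have wE' : rcons w c = w1 ++ c :: w2 ++ [:: c] by rewrite wE -cats1 -catA.
rewrite wE'; rewrite wE' in wn wK pw.
apply: coverable_imp (unfolded_coverable_step wK pw _).
  move=> f [fE ne]; split=> // -[_ _ e]; apply: ne; rewrite -e; congr f.
  by do 4 rewrite ?size_cat /=; rewrite ?add_norm.
move=> w' w'n pw'; apply: IH => //; first exact: leq_trans w'n wn.
exact: leq_trans (ltnW w'n) wK.
Qed.

Lemma unfolded_coverable w1 c w2 :
  let w := w1 ++ c :: w2 ++ [:: c] in (size w <= K)%N -> paired w ->
  coverable (unfolded w1 c w2) (iota 0 (size w).+1)
    (l * B (size w) * #|V| ^ size (undup w)).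
Proof.
move=> w wK pw; apply: unfolded_coverable_step => // w' w'w pw'.
by apply: open_walk_coverable => //; exact: leq_trans (ltnW w'w) wK.
Qed.

End PathCounting.

(** * Weighted sums over closed walks *)

Section SeqsOver.
Variable T : eqType.
Implicit Types (r s : seq T).

Fixpoint seqs_over r k : seq (seq T) :=
  if k is k'.+1 then [seq x :: s | x <- r, s <- seqs_over r k'] else [:: [::]].

Lemma mem_seqs_over r k s :
  (s \in seqs_over r k) = (size s == k) && all [in r] s.
Proof.
elim: k s => [|k IH] s; first by case: s.
apply/allpairsP/idP => [[[x s'] [xr]]|]; rewrite /=.
  by rewrite IH => /andP[/eqP sk sr] ->; rewrite /= sk eqxx xr.
case: s => [|x s]//= /andP[sk /andP[xr sr]]; exists (x, s); split=> //.
by rewrite IH sr andbT.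
Qed.

Lemma uniq_seqs_over r k : uniq r -> uniq (seqs_over r k).
Proof.
move=> ur; elim: k => //= k IH; apply: allpairs_uniq => //.
by move=> [x s] [y s'] _ _ [-> ->].
Qed.

Lemma big_seqs_overS (R : nmodType) r k (F : seq T -> R) :
  (\sum_(s <- seqs_over r k.+1) F s =
   \sum_(x <- r) \sum_(s <- seqs_over r k) F (x :: s))%R.
Proof. by rewrite /= big_allpairs_dep. Qed.

Lemma big_seqs_over_cat (R : nmodType) r k k' (F : seq T -> R) :
  (\sum_(s <- seqs_over r (k + k')) F s =
   \sum_(s <- seqs_over r k) \sum_(s' <- seqs_over r k') F (s ++ s'))%R.
Proof.
elim: k F => [|k IH] F; first by rewrite big_seq1.
rewrite addSn !big_seqs_overS; apply: eq_bigr => x _.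
by rewrite IH.
Qed.

End SeqsOver.

Arguments seqs_over : simpl never.

Section Patterns.
Variable T : eqType.
Implicit Types (w : seq T) (c : T).

(** The word up to the names of its colours. The number of patterns depends on
    the length alone, however many colours there are. *)
Definition pattern w : seq nat := [seq index c w | c <- w].

Lemma index_inj w : {in w &, injective (index^~ w)}.
Proof.
move=> c c' cw c'w /(congr1 (nth c w)).
by rewrite nth_index// nth_index.
Qed.

Lemma count_pattern w c : c \in w -> count_mem (index c w) (pattern w) = count_mem c w.
Proof.
move=> cw; rewrite count_map; apply: eq_in_count => c' c'w /=.
by apply/eqP/eqP => [/index_inj->|->].
Qed.

Lemma repeats_pattern w : repeats w -> repeats (pattern w).
Proof. by move=> rw _ /mapP[c cw ->]; rewrite count_pattern// rw. Qed.

Lemma paired_pattern w : paired (pattern w) <-> paired w.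
Proof.
split=> pw c; last by move=> /mapP[c' cw ->]; rewrite count_pattern// pw.
move=> cw; rewrite -count_pattern// pw//.
by apply/mapP; exists c.
Qed.

Lemma size_pattern w : size (pattern w) = size w.
Proof. exact: size_map. Qed.

Lemma nth_pattern c0 w i j : (i < size w)%N -> (j < size w)%N ->
  nth 0%N (pattern w) i = nth 0%N (pattern w) j -> nth c0 w i = nth c0 w j.
Proof.
move=> iw jw; rewrite !(nth_map c0)// => /index_inj; apply; exact: mem_nth.
Qed.

Definition patterns k : seq (seq nat) := seqs_over (iota 0 k) k.

Lemma mem_patterns w : pattern w \in patterns (size w).
Proof.
rewrite mem_seqs_over size_pattern eqxx; apply/allP => _ /mapP[c cw ->].
by rewrite /= mem_iota index_mem.
Qed.

End Patterns.

Section Weights.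
Variables (R : realDomainType) (C : eqType) (mu : nat -> R).
Hypothesis mu1 : mu 1 = 0%R.
Hypothesis mu2 : mu 2 = 1%R.
Implicit Types w : seq C.
Local Open Scope ring_scope.

(** The expectation of the product of the variables indexed by the letters of [w],
    when they are independent and [mu i] is their common [i]-th moment. *)
Definition weight w : R := \prod_(c <- undup w) mu (count_mem c w).

Lemma weight_single w c : count_mem c w = 1%N -> weight w = 0.
Proof.
move=> c1; have cw : c \in undup w by rewrite mem_undup -has_pred1 has_count c1.
by rewrite /weight (perm_big _ (perm_to_rem cw))/= big_cons c1 mu1 mul0r.
Qed.

Lemma weight_nonrepeating w : ~ repeats w -> weight w = 0.
Proof.
move=> /existsNP[c /not_implyP[cw c1]]; apply: (@weight_single _ c).
have : (0 < count_mem c w)%N by rewrite -has_count has_pred1.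
by move: c1; case: (count_mem c w) => [|[|n]].
Qed.

Lemma weight_paired w : paired w -> weight w = 1.
Proof.
move=> pw; rewrite /weight big_seq big1// => c; rewrite mem_undup => /pw ->.
exact: mu2.
Qed.

Lemma weight_cat w w' : (forall c, c \in w -> c \notin w') ->
  weight (w ++ w') = weight w * weight w'.
Proof.
move=> dis; rewrite /weight undup_cat big_cat/=; congr (_ * _).
  have -> : [seq c <- undup w | c \notin w'] = undup w.
    by apply/all_filterP/allP => c; rewrite mem_undup => /dis.
  rewrite [LHS]big_seq [RHS]big_seq; apply: eq_bigr => c; rewrite mem_undup => /dis cw'.
  by rewrite count_cat -[X in (_ + X)%N]/(count_mem c w') (count_memPn cw') addn0.
rewrite [LHS]big_seq [RHS]big_seq; apply: eq_bigr => c; rewrite mem_undup => cw'.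
rewrite count_cat; have /count_memPn -> // : c \notin w.
by apply: contraL cw' => /dis.
Qed.

Definition mu_bound k : R := 1 + \sum_(i < k.+1) `|mu i|.

Lemma mu_bound_ge1 k : 1 <= mu_bound k.
Proof. by rewrite lerDl sumr_ge0. Qed.

Lemma weight_bound w k : (size w <= k)%N -> `|weight w| <= mu_bound k ^+ k.
Proof.
move=> wk; rewrite normr_prod.
have mb i : (i <= k)%N -> `|mu i| <= mu_bound k.
  rewrite -ltnS => ik; rewrite /mu_bound (bigD1 (Ordinal ik))//= addrCA lerDl.
  by rewrite addr_ge0// sumr_ge0.
apply: (@le_trans _ _ (mu_bound k ^+ size (undup w))).
  rewrite -sum1_size expr_sum; apply: ler_prod => c _; rewrite expr1 normr_ge0/=.
  exact/mb/(leq_trans (count_size _ _)).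
by rewrite ler_weXn2l ?mu_bound_ge1// (leq_trans (size_undup w)).
Qed.

End Weights.

Section Walks.
Variables (R : realDomainType) (mu : nat -> R).
Hypothesis mu1 : mu 1 = 0%R.
Hypothesis mu2 : mu 2 = 1%R.
Variables (V : finType) (C : eqType) (col : V -> V -> C).
Implicit Types (x y : V) (s u : seq V) (f : nat -> V).

Definition word x s : seq C := pairmap col x s.

Lemma ecol_path_edges f a p x s : size p = size s ->
  map f (iota a (size s).+1) = x :: s ->
  map (ecol col f) (path_edges a p) = word x s.
Proof.
elim: s p a x => [|y s IH] [|l p] a x //= [ps] [fx fy fs].
rewrite /path_edges/= /ecol/= addn0 fx fy; congr (_ :: _).
rewrite -(IH p a.+1 y ps); last by rewrite /= fy fs.
rewrite /path_edges -[1%N]addn0 iotaDl -!map_comp.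
by apply: eq_map => i; rewrite /= /ecol/= addnCA add1n addSn.
Qed.

Lemma fits_colors f (E : seq edge) (w : seq C) :
  map (ecol col f) E = w -> [seq e.2 | e <- E] = pattern w -> fits col E f.
Proof.
move=> cE lE e e' /(nthP e)[i iE <-] /(nthP e)[j jE <-].
have sw : size w = size E by rewrite -cE size_map.
rewrite -!(nth_map e 0 (fun e => e.2))// lE => /(nth_pattern (ecol col f e)).
by rewrite sw -cE => /(_ iE jE); rewrite !(nth_map e).
Qed.

Local Open Scope ring_scope.

Lemma seqs_sum_bound n (H : seq V -> R) M b : (0 < n)%N -> 0 <= M ->
  (forall u, u \in seqs_over (enum V) n -> `|H u| <= M) ->
  coverable (fun f => H (map f (iota 0 n)) != 0) (iota 0 n) b ->
  `|\sum_(u <- seqs_over (enum V) n) H u| <= M *+ b.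
Proof.
move=> n0 M0 HM [B Bb HB].
apply: le_trans (ler_norm_sum _ _ _) _.
apply: (@le_trans _ _ (\sum_(u <- seqs_over (enum V) n | H u != 0) M)).
  rewrite [leRHS]big_mkcond/= big_seq [leRHS]big_seq; apply: ler_sum => u uV.
  by case: eqP => [->|_]; rewrite ?normr0//= HM.
rewrite big_const_seq iter_addr_0 ler_wpMn2l// -size_filter; apply: leq_trans Bb.
apply: uniq_leq_size; first by rewrite filter_uniq// uniq_seqs_over// enum_uniq.
move=> u; rewrite mem_filter mem_seqs_over => /andP[Hu /andP[/eqP un _]].
case: u un Hu => [|x u] un Hu; first by rewrite -un in n0.
have uE : map (nth x (x :: u)) (iota 0 n) = x :: u by rewrite -un; exact: (mkseq_nth x (x :: u)).
by rewrite -uE; apply: HB; rewrite uE.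
Qed.

Lemma coverable_patterns (F : (nat -> V) -> Prop) (G : seq nat -> (nat -> V) -> Prop)
    (P : seq (seq nat)) U b :
  (forall f, F f -> exists2 p, p \in P & G p f) ->
  (forall p, p \in P -> coverable (G p) U b) ->
  coverable F U (size P * b).
Proof.
elim: P F => [|p P IH] F FG Gb.
  by apply: coverable0 => f /FG[].
rewrite /= mulSn; apply: coverable_imp (coverable_or (Gb p (mem_head _ _))
   (IH (fun f => exists2 q, q \in P & G q f) _ _)).
- by move=> f /FG[q]; rewrite inE => /orP[/eqP ->|]; [left|right; exists q].
- by move=> f.
- by move=> q qP; apply: Gb; rewrite inE qP orbT.
Qed.

(** The expected trace of the [k]-th power, in combinatorial form; [closed_sum2]
    is the expected product of two traces. *)
Definition closed_sum k : R :=
  \sum_(x <- enum V) \sum_(s <- seqs_over (enum V) k | last x s == x)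
    weight mu (word x s).

Definition closed_sum2 k k' : R :=
  \sum_(x <- enum V) \sum_(s <- seqs_over (enum V) k | last x s == x)
    \sum_(y <- enum V) \sum_(s' <- seqs_over (enum V) k' | last y s' == y)
      weight mu (word x s ++ word y s').

Variable D : nat.
Hypothesis D_gt0 : (0 < D)%N.
Hypothesis col_sym : forall x y, col x y = col y x.
Hypothesis row_bound : forall x c, (#|[pred y | col x y == c]| <= D)%N.
Variable l : nat.
Hypothesis level_bound :
  forall c, (#|[pred z : V * V | col z.1 z.2 == c]| <= l)%N.

Lemma size_word x s : size (word x s) = size s.
Proof. exact: size_pairmap. Qed.

Definition cov_const k : R :=
  (mu_bound mu k ^+ k + mu_bound mu k ^+ k * mu_bound mu k ^+ k) *+
    (size (patterns k) * D ^ (2 * k).+4).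

(** The weight is multiplicative on words without common colour, and a single
    colour annihilates both terms of the difference. What remains are pairs of
    closed walks that share a colour and whose colours all repeat, which
    [linked_coverable] counts. *)
Lemma closed_sum_cov k k' :
  `|closed_sum2 k k' - closed_sum k * closed_sum k'| <=
  cov_const (k + k') *+ (l * #|V| ^ uphalf (k + k')).
Proof.
pose F x s y s' : R := if (last x s == x) && (last y s' == y) then
  weight mu (word x s ++ word y s') - weight mu (word x s) * weight mu (word y s') else 0.
pose H u : R := if u is x :: v then
   (if drop k v is y :: s' then F x (take k v) y s' else 0) else 0.
have -> : closed_sum2 k k' - closed_sum k * closed_sum k' =
    \sum_(u <- seqs_over (enum V) (k.+1 + k'.+1)) H u.
  rewrite big_seqs_over_cat big_seqs_overS /closed_sum /closed_sum2.
  rewrite mulr_suml -sumrB; apply: eq_bigr => x _.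
  rewrite mulr_suml -sumrB big_mkcond/= big_seq [RHS]big_seq; apply: eq_bigr => s.
  rewrite mem_seqs_over => /andP[/eqP sk _].
  rewrite big_seqs_overS; have Hs y s' : H ((x :: s) ++ y :: s') = F x s y s'.
    by rewrite /H/= -sk drop_size_cat// take_size_cat.
  case: ifPn => xs; last first.
    rewrite big1// => y _; rewrite big1// => s' _.
    by transitivity (F x s y s'); [exact: Hs|rewrite /F (negbTE xs)].
  rewrite mulr_sumr -sumrB; apply: eq_bigr => y _.
  rewrite mulr_sumr -sumrB [LHS]big_mkcond; apply: eq_bigr => s' _ /=.
  by transitivity (F x s y s'); [rewrite /F xs|symmetry; exact: Hs].
set M := mu_bound mu (k + k') ^+ (k + k').
have M0 : 0 <= M by rewrite exprn_ge0// (le_trans ler01)// mu_bound_ge1.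
apply: le_trans (seqs_sum_bound (M := M + M * M) (b := size (patterns (k + k')) *
  (l * D ^ (2 * (k + k')).+4 * #|V| ^ uphalf (k + k'))) _ _ _ _) _ => //.
- by rewrite addr_ge0// mulr_ge0.
- move=> [|x v]; rewrite mem_seqs_over => /andP[/eqP szv _] //=.
  have kv : (k < size v)%N by move: szv; rewrite /= addSn => -[->]; rewrite addnS ltnS leq_addr.
  case dv : (drop k v) => [|y s']; first by rewrite normr0 addr_ge0// mulr_ge0.
  have sz1 : size (take k v) = k by rewrite size_takel// ltnW.
  have sz2 : size s' = k'.
    have := size_drop k v; rewrite dv/=; move: szv; rewrite /= addSn => -[->].
    by rewrite addnS subSn ?leq_addr// addKn => -[].
  rewrite /F; case: ifP => _; last by rewrite normr0 addr_ge0// mulr_ge0.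
  apply: le_trans (ler_normB _ _) _; rewrite lerD//.
    by rewrite weight_bound// size_cat !size_word sz1 sz2.
  rewrite normrM ler_pM// weight_bound// size_word ?sz1 ?sz2 ?leq_addr ?leq_addl//.
- pose G p f := let p1 := take k p in let p2 := drop k p in
    [/\ size p1 = k, size p2 = k', repeats (p1 ++ p2),
        exists2 z, z \in p1 & z \in p2 &
        fits col (path_edges 0 p1 ++ path_edges k.+1 p2) f /\ f 0 = f k].
  apply: (coverable_patterns (G := G)) => [f Hf|p _].
    pose x := f 0; pose s := map f (iota 1 k).
    pose y := f k.+1; pose s' := map f (iota k.+2 k').
    have ik : iota 0 (k.+1 + k'.+1) = (0 :: iota 1 k) ++ (k.+1 :: iota k.+2 k').
      by rewrite iotaD.
    have sk : size s = k by rewrite size_map size_iota.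
    have sk' : size s' = k' by rewrite size_map size_iota.
    move: Hf; rewrite ik map_cat [X in H X](_ : _ = (x :: s) ++ (y :: s'))//.
    rewrite /H /= drop_size_cat// take_size_cat// /F.
    case: ifPn => [/andP[/eqP xs /eqP ys]|_]; last by rewrite eqxx.
    set w := word x s; set w' := word y s' => Hne.
    have sw : size w = k by rewrite size_word.
    have sw' : size w' = k' by rewrite size_word.
    have [z zw zw'] : exists2 z, z \in w & z \in w'.
      apply: contrapT => dis; move/eqP: Hne; apply; rewrite weight_cat ?subrr// => c cw.
      by apply/negP => cw'; apply: dis; exists c.
    have rw : repeats (w ++ w').
      apply: contrapT => /[dup] nr /existsNP[c /not_implyP[cw c1]].
      move/eqP: Hne; apply; rewrite (weight_nonrepeating mu1 nr) sub0r.
      have : count_mem c (w ++ w') = 1%N.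
        have : (0 < count_mem c (w ++ w'))%N by rewrite -has_count has_pred1.
        by move: c1; case: (count_mem c _) => [|[|n]].
      rewrite count_cat; case e1 : (count_mem c w) => [|[|//]] e2.
        by rewrite (@weight_single _ _ _ mu1 w' c)// mulr0 oppr0.
      by rewrite (@weight_single _ _ _ mu1 w c)// mul0r oppr0.
    exists (pattern (w ++ w')); first by rewrite -[in patterns _]sw -sw' -size_cat mem_patterns.
    have st : size (take k (pattern (w ++ w'))) = k.
      by rewrite size_takel// size_pattern size_cat sw leq_addr.
    have sd : size (drop k (pattern (w ++ w'))) = k'.
      by rewrite size_drop size_pattern size_cat sw sw' addKn.
    split=> //.
    + by rewrite cat_take_drop; exact: repeats_pattern.
    + exists (index z (w ++ w')); rewrite /pattern map_cat.
        by rewrite take_size_cat ?size_map//; apply/mapP; exists z.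
      by rewrite drop_size_cat ?size_map//; apply/mapP; exists z.
    + split; last first.
        have lk n m : last m (iota m.+1 n) = (m + n)%N.
          by elim: n m => [|n IH] m /=; rewrite ?addn0// IH addSnnS.
        by rewrite -[k in RHS](lk k 0%N) -(last_map f) -/x -/s xs.
      apply: (@fits_colors _ _ (w ++ w')).
        rewrite map_cat; congr (_ ++ _); apply: ecol_path_edges; rewrite ?st ?sd ?sk ?sk'//.
      by rewrite map_cat !path_edges_labels cat_take_drop.
  have [[s1 s2 r [z z1 z2]]|nG] := pselect [/\ size (take k p) = k,
      size (drop k p) = k', repeats (take k p ++ drop k p) &
      exists2 z, z \in take k p & z \in drop k p]; last first.
    by apply: coverable0 => f [s1 s2 r z _]; apply: nG.
  have := linked_coverable D_gt0 col_sym row_bound level_bound r z1 z2.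
  by rewrite s1 s2 addSn addnS; apply: coverable_imp => f [_ _ _ _ h].
- rewrite -[leRHS]mulrnA ler_wpMn2l//; first by rewrite addr_ge0// mulr_ge0.
  by rewrite leq_eqVlt; apply/orP; left; apply/eqP; lia.
Qed.

(** The closed walk [x :: s], of length [k.+2], returns to [x] after [t] steps and
    traverses its next edge and its last one in opposite directions. *)
Definition folded t k x s : bool :=
  (last x (take t s) == x) &&
  (last (nth x s t) (take (k - t) (drop t.+1 s)) == nth x s t).

(** The weight without the two traversals of the folding edge, whose colour has
    second moment 1. *)
Definition folded_weight t k x s : R :=
  if folded t k x s then
    weight mu (word x (take t s) ++ word (nth x s t) (take (k - t) (drop t.+1 s)))
  else 0.

(** Removing the two traversals turns a folded walk into two closed walks based at
    the ends of the folding edge, with no further constraint. *)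
Lemma folded_sum t k : (t <= k)%N ->
  \sum_(x <- enum V) \sum_(s <- seqs_over (enum V) k.+2 | last x s == x)
    folded_weight t k x s = closed_sum2 t (k - t).
Proof.
move=> tk; apply: eq_bigr => x _.
have -> : k.+2 = (t + ((k - t) + 1).+1)%N by lia.
rewrite big_mkcond big_seqs_over_cat [RHS]big_mkcond/= big_seq [RHS]big_seq.
apply: eq_bigr => s; rewrite mem_seqs_over => /andP[/eqP st _].
rewrite big_seqs_overS; have tE z v : last x (s ++ z :: v) = last z v by rewrite last_cat.
have fE y s' z : size s' = (k - t)%N -> folded_weight t k x (s ++ y :: s' ++ [:: z]) =
    if (last x s == x) && (last y s' == y) then weight mu (word x s ++ word y s') else 0.
  move=> s'k; rewrite /folded_weight /folded take_size_cat// nth_cat st ltnn subnn/=.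
  rewrite drop_cat st ltnNge leqnSn/= subSnn/= drop0 take_size_cat//.
case: ifPn => [/eqP xs|/eqP xs].
  apply: eq_bigr => y _; rewrite big_seqs_over_cat [RHS]big_mkcond/=.
  rewrite big_seq [RHS]big_seq; apply: eq_bigr => s'.
  rewrite mem_seqs_over => /andP[/eqP s'k _].
  rewrite big_seqs_overS (bigD1_seq x) ?mem_enum ?enum_uniq//= !big_seq1.
  rewrite tE last_cat/= eqxx fE// xs eqxx/= big1 ?addr0// => z zx.
  by rewrite big_seq1 tE last_cat/= (negbTE zx).
rewrite big1// => y _; rewrite big_seqs_over_cat big_seq big1// => s'.
rewrite mem_seqs_over => /andP[/eqP s'k _]; rewrite big1_seq// => z /=.
rewrite mem_seqs_over => /andP[/eqP z1 _]; case: z z1 => [|z []]// _.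
by rewrite fE//; move/eqP/negbTE: xs => ->; case: ifP.
Qed.

Hypothesis fork_bound :
  (#|[pred z : V * V * V | (col z.1.1 z.1.2 == col z.1.2 z.2)
      && (z.1.1 != z.2)]| <= l * #|V|)%N.

Lemma folded_word t k x s : size s = k.+2 -> (t <= k)%N -> last x s = x ->
  folded t k x s ->
  let c := col x (nth x s t) in
  word x s = word x (take t s) ++ c ::
    word (nth x s t) (take (k - t) (drop t.+1 s)) ++ [:: c].
Proof.
move=> sk tk xs /andP[/eqP h1 /eqP h2]; set y := nth x s t in h2 *.
have sE : s = take t s ++ y :: take (k - t) (drop t.+1 s) ++ [:: x].
  rewrite -[LHS](cat_take_drop t); congr (_ ++ _).
  rewrite (drop_nth x) ?sk; last by lia.
  congr (_ :: _); rewrite -[LHS](cat_take_drop (k - t)); congr (_ ++ _).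
  have : size (drop (k - t) (drop t.+1 s)) = 1%N by rewrite !size_drop sk; lia.
  case E : (drop (k - t) (drop t.+1 s)) => [|z []]// _; congr (_ :: _).
  rewrite -xs -[s in RHS](cat_take_drop t.+1) last_cat.
  by rewrite -[drop t.+1 s in RHS](cat_take_drop (k - t)) E !last_cat.
rewrite {1}sE /word pairmap_cat/= pairmap_cat/= h1 h2.
by rewrite (col_sym y x).
Qed.

Definition rec_const k : R :=
  (mu_bound mu k.+2 ^+ k.+2 + mu_bound mu k.+2 ^+ k.+2 *+ k.+1) *+
    (size (patterns k.+2) * (3 * D ^ (2 * k.+2).+2) ^ k.+3).

(** A paired walk folded along its last edge is folded at one time only, that of
    the first occurrence of its last colour, and its weight is 1 with and without
    that edge: it cancels. The other walks that matter repeat all their colours,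
    and are either not paired or unfolded. *)
Lemma closed_sum_rec k :
  `|closed_sum k.+2 - \sum_(t < k.+1) closed_sum2 t (k - t)| <=
  rec_const k *+ (#|V| ^ uphalf k.+2 + l * #|V| ^ (k.+2)./2).
Proof.
pose K := k.+2.
pose F x s : R := if last x s == x then
  weight mu (word x s) - \sum_(t < k.+1) folded_weight t k x s else 0.
pose H u : R := if u is x :: s then F x s else 0.
have -> : closed_sum k.+2 - \sum_(t < k.+1) closed_sum2 t (k - t) =
    \sum_(u <- seqs_over (enum V) K.+1) H u.
  rewrite big_seqs_overS.
  under eq_bigr => t _ do rewrite -(folded_sum (ltn_ord t : (t <= k)%N)).
  rewrite exchange_big/= -sumrB; apply: eq_bigr => x _.
  rewrite exchange_big/= -sumrB big_mkcond/=.
  by apply: eq_bigr => s _; rewrite /F; case: ifP.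
set M := mu_bound mu K ^+ K; pose B := ((3 * D ^ (2 * K).+2) ^ K.+1)%N.
have M0 : 0 <= M by rewrite exprn_ge0// (le_trans ler01)// mu_bound_ge1.
apply: le_trans (seqs_sum_bound (M := M + M *+ k.+1) (b := size (patterns K) *
  (D ^ (2 * K).+2 * #|V| ^ uphalf K + l * B * #|V| ^ K./2)) _ _ _ _) _ => //.
- by rewrite addr_ge0// mulrn_wge0.
- move=> [|x s]; rewrite mem_seqs_over => /andP[/eqP szs _] //=.
  have {}szs : size s = K by case: szs.
  rewrite /F; case: ifP => _; last by rewrite normr0 addr_ge0// mulrn_wge0.
  apply: le_trans (ler_normB _ _) _; rewrite lerD//.
    by rewrite weight_bound// size_word szs.
  apply: le_trans (ler_norm_sum _ _ _) _.
  apply: (@le_trans _ _ (\sum_(t < k.+1) M)); last by rewrite sumr_const card_ord.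
  apply: ler_sum => t _; rewrite /folded_weight; case: ifP => _; last by rewrite normr0.
  rewrite weight_bound// size_cat !size_word.
  have tk := ltn_ord t; rewrite !size_takel ?size_drop ?szs /K; lia.
- pose G (p : seq nat) f := [/\ size p = K, repeats p, fits col (path_edges 0 p) f &
    forall w1 c w2, paired p -> p = w1 ++ c :: w2 ++ [:: c] -> unfolded col w1 c w2 f].
  apply: (coverable_patterns (G := G)) => [f Hf|p _].
    pose x := f 0; pose s := map f (iota 1 K).
    have sk : size s = K by rewrite size_map size_iota.
    move: Hf; rewrite [X in H X](_ : _ = x :: s)// /H /F.
    case: ifPn => [/eqP xs|_]; last by rewrite eqxx.
    set w := word x s => Hne.
    have sw : size w = K by rewrite size_word.
    have Fw t : (t <= k)%N -> folded t k x s ->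
        exists c w1 w2, [/\ w = w1 ++ c :: w2 ++ [:: c], size w1 = t &
          folded_weight t k x s = weight mu (w1 ++ w2)].
      move=> tk fo; have wE := folded_word sk tk xs fo.
      exists (col x (nth x s t)), (word x (take t s)),
        (word (nth x s t) (take (k - t) (drop t.+1 s))); split=> //.
        by rewrite size_word size_takel// sk /K; lia.
      by rewrite /folded_weight fo.
    have cE c w1 w2 d : count_mem d (w1 ++ c :: w2 ++ [:: c]) =
        (count_mem d (w1 ++ w2) + (c == d) * 2)%N.
      by rewrite !count_cat/= count_cat/=; lia.
    have rw : repeats w.
      apply: contrapT => /[dup] nr /existsNP[c /not_implyP[cw c1]].
      move/eqP: Hne; apply; rewrite (weight_nonrepeating mu1 nr) sub0r.
      rewrite big1 ?oppr0// => t _.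
      case: (boolP (folded t k x s)) => fo; last by rewrite /folded_weight (negbTE fo).
      have [c' [w1 [w2 [wE _ ->]]]] := Fw _ (ltn_ord t : (t <= k)%N) fo.
      apply: (weight_single mu1 (c := c)).
      have : (0 < count_mem c w)%N by rewrite -has_count has_pred1.
      by move: c1; rewrite wE cE; case: eqP => _; lia.
    have fw : fits col (path_edges 0 (pattern w)) f.
      apply: (@fits_colors _ _ w); last exact: path_edges_labels.
      by apply: ecol_path_edges; rewrite ?size_pattern ?sw ?sk.
    exists (pattern w); first by rewrite -[in patterns _]sw mem_patterns.
    split=> //; [by rewrite size_pattern|exact: repeats_pattern|].
    move=> w1 c w2 pp pE; split; first by rewrite -pE.
    move=> [e1 e2 e3]; move/eqP: Hne; apply.
    have pw : paired w by apply/paired_pattern.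
    have szp : (size w1 + size w2)%N = k.
      have := size_pattern w; rewrite pE sw /K size_cat/= size_cat/= addn1.
      by rewrite !addnS => -[].
    pose t := size w1; have tk : (t <= k)%N by rewrite -szp leq_addr.
    have fv i : (i < K)%N -> nth x s i = f i.+1.
      by move=> iK; rewrite (nth_map 0) ?size_iota// nth_iota.
    clearbody s; have ft : folded t k x s.
      apply/andP; split; apply/eqP.
        rewrite -[RHS]e1 -/t; case tE : t => [|t']; first by rewrite take0.
        rewrite -nth_last size_takel ?sk; last by lia.
        by rewrite nth_take// fv//; lia.
      rewrite fv ?ltnS 1?leqW// e2 -/t.
      have [kt|kt] := posnP (k - t); first by rewrite kt take0.
      rewrite (last_nth x) size_takel ?size_drop ?sk; last by lia.
      rewrite -[(k - t)%N]prednK//= nth_take; last by lia.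
      by rewrite nth_drop fv; [congr f; lia|lia].
    rewrite (weight_paired mu2 pw) (bigD1 (Ordinal (tk : (t < k.+1)%N)))//=.
    have [c1 [v1 [v2 [wE sv1 ->]]]] := Fw t tk ft.
    have c1w : c1 \in w by rewrite wE mem_cat mem_head orbT.
    have c1n : count_mem c1 (v1 ++ v2) = 0%N.
      by have := pw _ c1w; rewrite wE cE eqxx; lia.
    rewrite weight_paired ?big1 ?addr0 ?subrr// => [t' t't|d dv].
      case: (boolP (folded t' k x s)) => fo; last by rewrite /folded_weight (negbTE fo).
      have [c2 [u1 [u2 [wE' su1 _]]]] := Fw _ (ltn_ord t' : (t' <= k)%N) fo.
      have c12 : c2 = c1.
        have : last c1 w = c1 by rewrite wE last_cat/= last_cat.
        by rewrite wE' last_cat/= last_cat.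
      have c1u : c1 \notin u1.
        have := pw _ c1w; rewrite wE' c12 cE eqxx count_cat => h.
        by rewrite -has_pred1 has_count; lia.
      have c1v : c1 \notin v1.
        by move: c1n; rewrite count_cat -has_pred1 has_count; lia.
      have : index c1 w = t by rewrite wE index_cat (negbTE c1v)/= eqxx addn0.
      rewrite wE' c12 index_cat (negbTE c1u)/= eqxx addn0 su1 => tt'.
      by move/eqP: t't; case; apply: val_inj.
    have := pw d; rewrite wE cE mem_cat inE mem_cat => h.
    have : (0 < count_mem d (v1 ++ v2))%N by rewrite -has_count has_pred1.
    case: (eqVneq c1 d) h => [<-|]; first by rewrite c1n.
    rewrite mem_cat in dv => _ h _; rewrite addn0 in h; apply: h.
    by case/orP: dv => ->; rewrite ?orbT.
  have [[sp rp]|np] := pselect (size p = K /\ repeats p); last first.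
    by apply: coverable0 => f [? ? _ _]; apply: np.
  have [pp|npp] := pselect (paired p); last first.
    apply: (@coverable_leq _ _ _ _ _ (leq_addr _ _)).
    have := unpaired_coverable D_gt0 col_sym row_bound rp npp; rewrite sp.
    by apply: coverable_imp => f [].
  apply: (@coverable_leq _ _ _ _ _ (leq_addl _ _)).
  have [w1 [c [w2 pE]]] : exists w1 c w2, p = w1 ++ c :: w2 ++ [:: c].
    case/lastP: p sp pp {rp} => [//|p c] _ pp.
    have cp : c \in p.
      have := pp c; rewrite mem_rcons mem_head -cats1 count_cat/= eqxx => /(_ isT).
      by rewrite -has_pred1 has_count; case: (count_mem c p).
    case/splitPr: cp => v1 v2; exists v1, c, v2.
    by rewrite -cats1 -catA.
  have pK : (size p <= K)%N by rewrite sp.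
  have := unfolded_coverable D_gt0 col_sym row_bound level_bound fork_bound (K := K)
    (w1 := w1) (c := c) (w2 := w2); rewrite -pE => /(_ pK pp).
  have -> : size (undup p) = K./2 by rewrite -sp -(paired_size pp) mul2n doubleK.
  by rewrite sp; apply: coverable_imp => f [_ _ _]; apply.
- rewrite -[leRHS]mulrnA ler_wpMn2l//; first by rewrite addr_ge0// mulrn_wge0.
  rewrite -[X in (_ <= X)%N]mulnA leq_mul2l mulnDr leq_add ?orbT//; last first.
    by rewrite mulnA [(l * B)%N]mulnC.
  rewrite leq_mul// -[X in (X <= _)%N]expn1.
  have DX : (D ^ (2 * K).+2 <= 3 * D ^ (2 * K).+2)%N by rewrite leq_pmull.
  apply: leq_trans (_ : (3 * D ^ (2 * K).+2) ^ 1 <= _)%N; first by rewrite !expn1.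
  by rewrite leq_pexp2l// muln_gt0 expn_gt0 D_gt0.
Qed.

End Walks.

(** * Level sets and forks of polynomial links *)

(** The three properties of a colouring of the pairs of vertices that the walk
    counts rest on; a fork consists of two adjacent pairs of equal colour with
    distinct far ends. *)
Definition sparse_colouring (V : finType) (C : eqType) (col : V -> V -> C)
    (D l : nat) : Prop :=
  [/\ forall x c, (#|[pred y | col x y == c]| <= D)%N,
      forall c, (#|[pred z : V * V | col z.1 z.2 == c]| <= l)%N &
      (#|[pred z : V * V * V | (col z.1.1 z.1.2 == col z.1.2 z.2)
         && (z.1.1 != z.2)]| <= l * #|V|)%N].

Definition link_col (L : nat -> nat -> int) N (x y : 'I_N) : int := L x.+1 y.+1.

Definition sparse_link (R : realType) (L : nat -> nat -> int) (D : nat) (C e : R)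
    : Prop :=
  forall N, (0 < N)%N -> exists2 l : nat,
    sparse_colouring (@link_col L N) D l & (l%:R <= C * N%:R `^ (1 - e))%R.

Section Polynomials.
Local Open Scope ring_scope.
Implicit Types (q r : {poly int}).

(** The leading coefficient, a nonzero integer, is the sum of [n.+1] terms of the
    Lagrange interpolation formula, each at most [B / h ^ n] in absolute value. *)
Lemma spaced_values q n (x : nat -> nat) h B (t : int) :
  size q = n.+1 -> (0 < n)%N -> (0 < h)%N ->
  (forall i j, (i < j)%N -> (x i + h <= x j)%N) ->
  (forall i, (i <= n)%N -> `|q.[(x i)%:Z] - t| <= B%:Z) ->
  (h ^ n <= n.+1 * B)%N.
Proof.
move=> sq n0 h0 xh qB.
pose z i : rat := (x i)%:R; pose Q : {poly rat} := map_poly intr (q - t%:P).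
have zh i j : i != j -> h%:R <= `|z i - z j|.
  have hp : 0 <= h%:R :> rat by [].
  rewrite neq_ltn => /orP[] ij; have := xh _ _ ij; rewrite -(ler_nat rat) natrD /z => e.
    by rewrite distrC ger0_norm; lra.
  by rewrite ger0_norm; lra.
have zinj : injective z.
  move=> i j e; apply/eqP/negPn/negP => /zh; rewrite e subrr normr0 lern0.
  by rewrite eqn0Ngt h0.
have sQ : size Q = n.+1.
  rewrite size_map_inj_poly//; last exact: intr_inj.
  rewrite size_polyDl ?sq// size_polyN (leq_ltn_trans (size_polyC_leq1 _))//.
have lQ : 1 <= `|Q`_n|.
  have -> : Q`_n = (q`_n)%:~R.
    by rewrite coef_map/= coefB coefC gtn_eqF// subr0.
  rewrite -intr_norm -[1]/(1%:~R) ler_int -gtz0_ge1 normr_gt0.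
  have : lead_coef q != 0 by rewrite lead_coef_eq0 -size_poly_eq0 sq.
  by rewrite lead_coefE sq.
have := @lagrange_gen rat n.+1 z isT zinj Q; rewrite sQ => /(_ (leqnn _)) QE.
have : `|Q`_n| <= \sum_(i < n.+1) B%:R / h%:R ^+ n.
  rewrite [in `|_|]QE coef_sum; apply: le_trans (ler_norm_sum _ _ _) _.
  apply: ler_sum => i _; rewrite coefCM lagrangeE//=.
  set p := \prod_(j < n.+1 | _) _.
  have sp : size p = n.+1.
    rewrite /p (eq_bigl (fun j => (j \in predT) && (j != i)))// -big_enum_cond.
    rewrite -big_filter size_prod_XsubC size_filter; congr (_.+1).
    have /eqP := count_predC (pred1 i) (enum 'I_n.+1).
    by rewrite count_uniq_mem ?enum_uniq// mem_enum size_enum_ord add1n eqSS => /eqP.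
  have pn : p`_n = 1.
    have /monicP := monic_prod_XsubC (index_enum 'I_n.+1) (fun j => j != i) (z \o val).
    by rewrite lead_coefE -/p sp.
  rewrite coefCM pn mulr1 normrM ler_pM//.
    have -> : z i = ((x i)%:Z)%:~R by rewrite /z pmulrn.
    rewrite /Q horner_map/= hornerD hornerN hornerC -intr_norm -[B%:R]/(B%:~R) ler_int.
    by apply: qB; rewrite -ltnS.
  rewrite normfV lef_pV2 ?posrE ?exprn_gt0 ?ltr0n//; last first.
    rewrite normr_gt0 horner_prod prodf_seq_neq0; apply/allP => j _.
    by apply/implyP => ji; rewrite hornerXsubC subr_eq0 (inj_eq zinj) eq_sym.
  rewrite horner_prod normr_prod.
  apply: (@le_trans _ _ (\prod_(j < n.+1 | j != i) h%:R)).
    rewrite prodr_const; have -> // : #|[pred j : 'I_n.+1 | j != i]| = n.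
    by have := cardC1 i; rewrite card_ord.
  apply: ler_prod => j ji; rewrite ler0n hornerXsubC zh//.
  by rewrite eq_sym.
rewrite sumr_const card_ord -[_ *+ _]mulr_natr => H.
have := le_trans lQ H; rewrite mulrAC ler_pdivlMr ?exprn_gt0 ?ltr0n// mul1r.
by rewrite -natrX mulrC -natrM ler_nat.
Qed.

(** Every [h]-th element of [S], for [h] about [#|S| / n], provides [n.+1]
    arguments with gaps at least [h]. *)
Lemma card_near q n N B (t : int) (S : pred 'I_N) :
  size q = n.+1 -> (0 < n)%N ->
  (forall y, S y -> `|q.[(y.+1)%:Z] - t| <= B%:Z) ->
  exists2 h, (h ^ n <= n.+1 * B)%N & (#|S| <= n * h.+1)%N.
Proof.
move=> sq n0 SB; pose s := [seq val y | y <- enum S].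
have ss : sorted ltn s.
  rewrite /s sorted_map /enum_mem -enumT; apply: sorted_filter.
    by move=> a b c /=; exact: ltn_trans.
  by rewrite -sorted_map val_enum_ord iota_ltn_sorted.
have szs : size s = #|S| by rewrite size_map -cardE.
have [S0|S1] := posnP #|S|; first by exists 0%N; rewrite ?S0// exp0n.
pose h := ((#|S|.-1) %/ n)%N.
have Sh : (#|S| <= n * h.+1)%N by rewrite -(prednK S1) mulnC ltn_ceil.
exists h => //.
have [->|h0] := posnP h; first by rewrite exp0n.
have nh : (n * h < size s)%N by rewrite szs -(prednK S1) ltnS mulnC leq_trunc_div.
(* Interpolation takes an infinite spaced family of nodes; those after the [n]-th
   lie beyond [N] and are never evaluated. *)
pose x i := if (i <= n)%N then (nth 0%N s (i * h)).+1 else (N + i * h).+1.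
have ih i : (i <= n)%N -> (i * h < size s)%N.
  by move=> i_n; apply: leq_ltn_trans nh; rewrite leq_mul2r i_n orbT.
have sN i : (i < size s)%N -> (nth 0%N s i < N)%N.
  by move=> /(mem_nth 0%N) /mapP[y _ ->]; exact: ltn_ord.
have gap i d : (i + d < size s)%N -> (nth 0%N s i + d <= nth 0%N s (i + d))%N.
  elim: d => [|d IH]; rewrite ?addn0// addnS => id1.
  have := sorted_ltn_nth ltn_trans 0%N ss (i + d)%N (i + d).+1.
  rewrite !inE => /(_ (ltnW id1) id1 (ltnSn _)).
  by have := IH (ltnW id1); lia.
apply: (@spaced_values q n x h B t) => // [i j ij|i i_n].
  have hij : (i * h + h <= j * h)%N by rewrite -mulSnr leq_mul2r ij orbT.
  rewrite /x; case: (leqP j n) => [jn|nj].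
    rewrite (leq_trans (ltnW ij) jn) addSn ltnS.
    have := gap (i * h)%N (j * h - i * h)%N; rewrite subnKC; last by lia.
    by move=> /(_ (ih _ jn)); lia.
  case: (leqP i n) => [i_n|ni]; last by lia.
  by have := sN _ (ih _ i_n); lia.
rewrite /x i_n.
have /(mem_nth 0%N)/mapP[y yS ->] := ih _ i_n.
by apply: SB; rewrite mem_enum in yS.
Qed.

Lemma card_value q N (c : int) : (1 < size q)%N ->
  (#|[pred y : 'I_N | q.[(y.+1)%:Z] == c]| <= size q)%N.
Proof.
move=> sq; rewrite cardE.
pose r := q - c%:P.
have sr : size r = size q.
  by rewrite size_polyDl// size_polyN (leq_ltn_trans (size_polyC_leq1 _)).
have r0 : r != 0 by rewrite -size_poly_gt0 sr; lia.
pose s := [seq (y.+1)%:Z | y : 'I_N <- enum [pred y : 'I_N | q.[(y.+1)%:Z] == c]].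
have : (size s < size r)%N.
  apply: max_poly_roots => //.
    apply/allP => z /mapP[y + ->]; rewrite mem_enum inE => /eqP yc.
    by rewrite /root hornerD hornerN hornerC yc subrr.
  rewrite map_inj_uniq ?enum_uniq// => y y' [] e; exact: val_inj.
by rewrite size_map sr => /ltnW.
Qed.

Definition coef_sum q : nat := (\sum_(i < size q) `|(q`_i)%R|)%N.

Lemma horner_bound q (x N : nat) : (x <= N)%N -> (0 < N)%N ->
  `|q.[x%:Z]| <= (coef_sum q * N ^ (size q).-1)%:Z.
Proof.
move=> xN N0; rewrite horner_coef; apply: le_trans (ler_norm_sum _ _ _) _.
rewrite /coef_sum big_distrl/= -[leRHS]natz natr_sum; apply: ler_sum => i _.
rewrite natrM normrM; apply: ler_pM => //; first by rewrite natz abszE.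
rewrite -[x%:Z]natz -natrX ger0_norm// ler_nat.
apply: (@leq_trans (N ^ i)); first by case: (val i) => // e; rewrite leq_exp2r.
rewrite leq_pexp2l// -ltnS prednK ?ltn_ord//.
exact: leq_ltn_trans (ltn_ord i).
Qed.

(** Dividing [q.[x] = q.[y]] by [x - y] leaves a combination of the sums [S i],
    where [S i] lies between [x ^ i.-1] and [i * x ^ i.-1] for [i > 0]; if [x] is
    large the term of highest degree cannot be balanced. *)
Lemma collision_bound q (x y : nat) : (1 < size q)%N -> (y < x)%N ->
  q.[x%:Z] = q.[y%:Z] -> (x <= size q * coef_sum q)%N.
Proof.
move=> sq yx qxy; pose d := (size q).-1.
have sd : size q = d.+1 by rewrite prednK// ltnW.
have x0 : (0 < x)%N by exact: leq_ltn_trans yx.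
pose S i : int := \sum_(j < i) x%:Z ^+ (i.-1 - j) * y%:Z ^+ j.
have S0 i : 0 <= S i by rewrite sumr_ge0// => j _; rewrite mulr_ge0// exprn_ge0.
have Sle i : S i <= i%:R * x%:Z ^+ i.-1.
  rewrite -[i in i%:R]card_ord mulr_natl -sumr_const; apply: ler_sum => j _.
  have ji : (j <= i.-1)%N by rewrite -ltnS prednK ?ltn_ord// (leq_ltn_trans _ (ltn_ord j)).
  rewrite -{2}(subnK ji) exprD ler_wpM2l ?exprn_ge0//.
  by rewrite lerXn2r ?nnegrE// lez_nat ltnW.
have Sd : x%:Z ^+ d.-1 <= S d.
  have d0 : (0 < d)%N by move: sq; rewrite sd.
  rewrite /S (bigD1 (Ordinal d0))//= subn0 expr0 mulr1 lerDl.
  by rewrite sumr_ge0// => j _; rewrite mulr_ge0// exprn_ge0.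
have : \sum_(i < d.+1) q`_i * S i = 0.
  have xy : x%:Z - y%:Z != 0 by rewrite subr_eq0 gt_eqF// ltz_nat.
  apply: (mulfI xy); rewrite mulr0 mulr_sumr.
  have := qxy; rewrite !horner_coef sd => /eqP; rewrite -subr_eq0 -sumrB => /eqP h.
  by rewrite -[RHS]h; apply: eq_bigr => i _; rewrite -mulrBr subrXX mulrCA.
rewrite big_ord_recr/= => /eqP; rewrite addrC addr_eq0 => /eqP h.
have ad : 1 <= `|q`_d|.
  rewrite -gtz0_ge1 normr_gt0 -[d]/(d.+1.-1) -sd -lead_coefE lead_coef_eq0.
  by rewrite -size_poly_gt0 sd.
have xd0 : 0 < x%:Z ^+ d.-1 by rewrite exprn_gt0.
suff H : x%:Z * x%:Z ^+ d.-1 <= (size q * coef_sum q)%:Z * x%:Z ^+ d.-1.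
  by move: H; rewrite ler_pM2r// lez_nat.
apply: (@le_trans _ _ (x%:Z * `|q`_d * S d|)).
  rewrite ler_wpM2l// normrM (ger0_norm (S0 d)).
  by apply: le_trans Sd _; rewrite ler_peMl.
rewrite h normrN; apply: (@le_trans _ _ (x%:Z * \sum_(i < d) `|q`_i * S i|)).
  by rewrite ler_wpM2l// ler_norm_sum.
have -> : (size q * coef_sum q)%:Z * x%:Z ^+ d.-1 =
    \sum_(i < d.+1) `|q`_i| * ((size q)%:Z * x%:Z ^+ d.-1).
  rewrite -mulr_suml mulrA; congr (_ * _); rewrite mulrC PoszM; congr (_ * _).
  by rewrite /coef_sum -natz natr_sum sd; apply: eq_bigr => i _; rewrite natz abszE.
rewrite big_ord_recr/= mulr_sumr -[leLHS]addr0; apply: lerD; last by rewrite !mulr_ge0// ltW.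
apply: ler_sum => i _; rewrite normrM (ger0_norm (S0 _)) mulrCA ler_wpM2l//.
apply: (@le_trans _ _ (x%:Z * (i%:R * x%:Z ^+ i.-1))); first by rewrite ler_wpM2l.
case: i => [[|i] /= id]; first by rewrite mul0r mulr0 mulr_ge0// ltW.
rewrite mulrCA -exprS ler_pM ?exprn_ge0//; first by rewrite natz lez_nat sd ltnW// ltnW.
by rewrite ler_weXn2l// ; lia.
Qed.

End Polynomials.

Section Levels.
Local Open Scope ring_scope.
Variables (f g : {poly int}).
Hypotheses (f1 : (1 < size f)%N) (g1 : (1 < size g)%N) (fg : size f != size g).

Definition ordered_link (i j : nat) : int := f.[(minn i j)%:Z] + g.[(maxn i j)%:Z].

Lemma card_or_le (T : finType) (P Q S : pred T) :
  (forall z, S z -> P z || Q z) -> (#|S| <= #|P| + #|Q|)%N.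
Proof.
move=> SPQ; rewrite -cardUI; apply: leq_trans (leq_addr _ _).
by apply: subset_leq_card; apply/fintype.subsetP => z; rewrite !inE; exact: SPQ.
Qed.

Lemma card_pairs (T1 T2 : finType) (Q : T1 -> T2 -> bool) :
  #|[pred z : T1 * T2 | Q z.1 z.2]| = (\sum_x #|[pred y | Q x y]|)%N.
Proof.
under eq_bigr do rewrite -sum1_card.
by rewrite pair_big_dep/= -sum1_card; apply: eq_bigl.
Qed.

Lemma card_fiber_le (T1 T2 : finType) (P : pred T1) (Q : T1 -> T2 -> bool) b :
  (forall x y, Q x y -> P x) -> (forall x, (#|[pred y | Q x y]| <= b)%N) ->
  (#|[pred z : T1 * T2 | Q z.1 z.2]| <= #|P| * b)%N.
Proof.
move=> QP Qb; rewrite card_pairs -sum1_card big_distrl/= [X in (_ <= X)%N]big_mkcond/=.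
apply: leq_sum => x _; rewrite mul1n; case: ifPn => Px; first exact: Qb.
by rewrite leqn0 eq_card0// => y; apply/negP => /QP; apply/negP.
Qed.

Lemma card_fiber_le_r (T1 T2 : finType) (P : pred T2) (Q : T1 -> T2 -> bool) b :
  (forall x y, Q x y -> P y) -> (forall y, (#|[pred x | Q x y]| <= b)%N) ->
  (#|[pred z : T1 * T2 | Q z.1 z.2]| <= #|P| * b)%N.
Proof.
move=> QP Qb; have := @card_fiber_le T2 T1 P (fun y x => Q x y) b (fun y x => QP x y) Qb.
apply: leq_trans; rewrite -(fintype.card_image (f := fun z : T1 * T2 => (z.2, z.1))).
  by apply: subset_leq_card; apply/fintype.subsetP => _ /fintype.imageP[[x y] h ->].
by move=> [x y] [x' y'] [-> ->].
Qed.

Definition row_const := (size f + size g)%N.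

Variable N : nat.
Local Notation col := (fun x y : 'I_N => ordered_link x.+1 y.+1).

Lemma ordered_link_sym i j : ordered_link i j = ordered_link j i.
Proof. by rewrite /ordered_link minnC maxnC. Qed.

(** On either side of the diagonal the second vertex is the root of a polynomial
    determined by the first vertex and the colour. *)
Lemma row_level (x : 'I_N) (c : int) : (#|[pred y | col x y == c]| <= row_const)%N.
Proof.
have := leq_add (card_value N (c - g.[(x.+1)%:Z]) f1) (card_value N (c - f.[(x.+1)%:Z]) g1).
apply: leq_trans; rewrite -cardUI; apply: leq_trans (leq_addr _ _).
apply: subset_leq_card; apply/fintype.subsetP => y; rewrite !inE /ordered_link => /eqP <-.
case: (leqP x.+1 y.+1) => xy.
  by apply/orP; right; rewrite addrC addKr.
by apply/orP; left; rewrite addrK.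
Qed.

Definition big_poly := if (size f < size g)%N then g else f.
Definition small_poly := if (size f < size g)%N then f else g.
Definition big_deg := (size big_poly).-1.

Lemma size_big_poly : size big_poly = big_deg.+1.
Proof. by clear fg; rewrite prednK// /big_poly; case: ifP; lia. Qed.

Lemma size_small_poly : ((size small_poly).-1 <= big_deg.-1)%N.
Proof. by rewrite /big_deg /small_poly /big_poly; case: ltnP; lia. Qed.

Lemma big_deg_gt0 : (0 < big_deg)%N.
Proof. by clear fg; rewrite /big_deg /big_poly; case: ifP; lia. Qed.

(** The vertices where the dominant polynomial is [t] up to an error that covers
    the values of the other polynomial. *)
Definition near (t : int) : pred 'I_N :=
  fun y => `|big_poly.[(y.+1)%:Z] - t| <= (coef_sum small_poly * N ^ big_deg.-1)%:Z.

Lemma small_poly_bound (x : 'I_N) :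
  `|small_poly.[(x.+1)%:Z]| <= (coef_sum small_poly * N ^ big_deg.-1)%:Z.
Proof.
have N0 : (0 < N)%N by exact: leq_ltn_trans (ltn_ord x).
apply: le_trans (horner_bound _ (ltn_ord x) N0) _.
by rewrite lez_nat leq_mul2l leq_pexp2l ?size_small_poly ?orbT.
Qed.

Variable l0 : nat.
Hypothesis l0P : forall t, (#|near t| <= l0)%N.

(** The square accounts for the small vertices, at which [f] or [g] need not be
    injective. *)
Definition level_size := (2 * row_const * l0 +
  (size f * coef_sum f + size g * coef_sum g) ^ 2)%N.

(** One vertex of the pair lies near [c], and it determines the other up to
    [row_const] choices. *)
Lemma level_card (c : int) :
  (#|[pred z : 'I_N * 'I_N | col z.1 z.2 == c]| <= level_size)%N.
Proof.
pose Q1 (x y : 'I_N) := (x \in near c) && (col x y == c).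
pose Q2 (x y : 'I_N) := (y \in near c) && (col x y == c).
have q1 : (#|[pred z : 'I_N * 'I_N | Q1 z.1 z.2]| <= #|near c| * row_const)%N.
  apply: (card_fiber_le (P := near c)) => [x y /andP[]//|x].
  apply: leq_trans (row_level x c); apply: subset_leq_card.
  by apply/fintype.subsetP => y; rewrite !inE => /andP[].
have q2 : (#|[pred z : 'I_N * 'I_N | Q2 z.1 z.2]| <= #|near c| * row_const)%N.
  apply: (card_fiber_le_r (P := near c)) => [x y /andP[]//|y].
  apply: leq_trans (row_level y c); apply: subset_leq_card.
  by apply/fintype.subsetP => x; rewrite !inE ordered_link_sym => /andP[].
apply: (@leq_trans (#|near c| * row_const + #|near c| * row_const)); last first.
  by have := l0P c; rewrite /level_size; nia.
apply: leq_trans (leq_add q1 q2); rewrite -cardUI; apply: leq_trans (leq_addr _ _).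
apply: subset_leq_card; apply/fintype.subsetP => -[x y]; rewrite !inE/= /Q1 /Q2 => xy.
rewrite xy !andbT; move/eqP: xy; rewrite /ordered_link !unfold_in /near.
have sx := small_poly_bound x; have sy := small_poly_bound y.
move: sx sy; rewrite /small_poly /big_poly.
case: ifP => _ sx sy; case: (leqP x.+1 y.+1) => _ <-.
- by apply/orP; right; rewrite opprD addrCA subrr addr0 normrN.
- by apply/orP; left; rewrite opprD addrCA subrr addr0 normrN.
- by apply/orP; left; rewrite opprD addNKr normrN.
- by apply/orP; right; rewrite opprD addNKr normrN.
Qed.

(** Let the fork have centre [y] and ends [x < x']. If [y] is not strictly between
    them, [f] or [g] takes one value at [x] and [x'], so both are small. If
    [x < y < x'], then [f x + g y = f y + g x']: the dominant
    polynomial takes at one of the ends a value close to the difference of the two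
    polynomials at [y]. Each centre thus leaves as many choices as a level set. *)
Lemma fork_card :
  (#|[pred z : 'I_N * 'I_N * 'I_N | (col z.1.1 z.1.2 == col z.1.2 z.2)
      && (z.1.1 != z.2)]| <= level_size * N)%N.
Proof.
pose X := (size f * coef_sum f + size g * coef_sum g)%N.
pose t (y : 'I_N) : int := if (size f < size g)%N then
  g.[(y.+1)%:Z] - f.[(y.+1)%:Z] else f.[(y.+1)%:Z] - g.[(y.+1)%:Z].
pose Q1 y (x x' : 'I_N) := (x \in near (t y)) && (col y x == col y x').
pose Q2 y (x x' : 'I_N) := (x' \in near (t y)) && (col y x == col y x').
pose Q3 (x x' : 'I_N) := (x < X)%N && (x' < X)%N.
pose Q y (x x' : 'I_N) := (col x y == col y x') && (x != x').
have q1 y : (#|[pred z : 'I_N * 'I_N | Q1 y z.1 z.2]| <= l0 * row_const)%N.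
  apply: leq_trans (leq_mul (l0P (t y)) (leqnn _)).
  apply: (card_fiber_le (P := near (t y))) => [x x' /andP[]//|x].
  apply: leq_trans (row_level y (col y x)); apply: subset_leq_card.
  by apply/fintype.subsetP => x'; rewrite !inE => /andP[_ /eqP ->].
have q2 y : (#|[pred z : 'I_N * 'I_N | Q2 y z.1 z.2]| <= l0 * row_const)%N.
  apply: leq_trans (leq_mul (l0P (t y)) (leqnn _)).
  apply: (card_fiber_le_r (P := near (t y))) => [x x' /andP[]//|x'].
  apply: leq_trans (row_level y (col y x')); apply: subset_leq_card.
  by apply/fintype.subsetP => x; rewrite !inE => /andP[].
have q3 : (#|[pred z : 'I_N * 'I_N | Q3 z.1 z.2]| <= X * X)%N.
  have cX : (#|[pred x : 'I_N | (x < X)%N]| <= X)%N.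
    rewrite cardE -(size_map val) -[X in (_ <= X)%N](size_iota 0).
    apply: uniq_leq_size; first by rewrite map_inj_uniq ?enum_uniq//; exact: val_inj.
    by move=> _ /mapP[x + ->]; rewrite mem_enum inE mem_iota.
  apply: leq_trans (leq_mul cX (leqnn X)).
  apply: (card_fiber_le (P := [pred x : 'I_N | (x < X)%N])) => [x y /andP[]//|x].
  apply: leq_trans cX; apply: subset_leq_card.
  by apply/fintype.subsetP => y; rewrite !inE => /andP[].
have qy y : (#|[pred z : 'I_N * 'I_N | Q y z.1 z.2]| <= level_size)%N.
  apply: (@leq_trans (l0 * row_const + l0 * row_const + X * X)); last first.
    by rewrite /level_size -/X -mulnn; lia.
  apply: leq_trans (leq_add (leq_add (q1 y) (q2 y)) q3).
  apply: leq_trans (card_or_le (P := [pred z | Q1 y z.1 z.2 || Q2 y z.1 z.2])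
    (Q := [pred z | Q3 z.1 z.2]) _) (leq_add (card_or_le _) (leqnn _)) => [[x x']|//].
  rewrite /= /Q /Q1 /Q2 /Q3 => /andP[]; rewrite (ordered_link_sym x.+1) => e.
  rewrite e !andbT; wlog xx' : x x' e / (x < x')%N.
    move=> H ne; case: (ltngtP x x') => [xx'|x'x|/val_inj xx'].
    - exact: H.
    - rewrite [X in X || _]orbC [X in _ || X]andbC.
      by apply: H; rewrite // 1?eq_sym.
    - by rewrite xx' eqxx in ne.
  move=> _; move/eqP: e; rewrite /ordered_link.
  have sx := small_poly_bound x; have sx' := small_poly_bound x'.
  case: (leqP x' y) => x'y.
    rewrite (_ : maxn y.+1 x.+1 = y.+1) 1?(_ : minn y.+1 x.+1 = x.+1); [|lia..].
    rewrite (_ : maxn y.+1 x'.+1 = y.+1) 1?(_ : minn y.+1 x'.+1 = x'.+1); [|lia..].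
    move=> /addIr /esym/collision_bound; rewrite !ltnS => /(_ f1 xx') xX.
    apply/orP; right; rewrite /X; move: xX xx'; clear; lia.
  case: (leqP y x) => yx.
    rewrite (_ : maxn y.+1 x.+1 = x.+1) 1?(_ : minn y.+1 x.+1 = y.+1); [|lia..].
    rewrite (_ : maxn y.+1 x'.+1 = x'.+1) 1?(_ : minn y.+1 x'.+1 = y.+1); [|lia..].
    move=> /addrI /esym/collision_bound; rewrite !ltnS => /(_ g1 xx') xX.
    apply/orP; right; rewrite /X; move: xX xx'; clear; lia.
  rewrite (_ : maxn y.+1 x.+1 = y.+1) 1?(_ : minn y.+1 x.+1 = x.+1); [|lia..].
  rewrite (_ : maxn y.+1 x'.+1 = x'.+1) 1?(_ : minn y.+1 x'.+1 = y.+1); [|lia..].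
  move=> e; apply/orP; left; apply/orP; move: sx sx'.
  rewrite !unfold_in /near /t /small_poly /big_poly; case: ifP => _ sx sx'.
    by right; rewrite (_ : _ - _ = f.[(x.+1)%:Z])//; lra.
  by left; rewrite (_ : _ - _ = g.[(x'.+1)%:Z])//; lra.
rewrite (card_pairs (fun (z : 'I_N * 'I_N) x' => Q z.2 z.1 x')).
rewrite -(pair_bigA _ (fun x y => #|[pred x' | Q y x x']|))/= exchange_big/=.
apply: (@leq_trans (\sum_(y < N) level_size)); last by rewrite sum_nat_const card_ord mulnC.
by apply: leq_sum => y _; rewrite -card_pairs.
Qed.

End Levels.

Section LevelAsymptotics.
Local Open Scope ring_scope.
Variable R : realType.

Lemma card_near_asymptotic (f g : {poly int}) :
  (1 < size f)%N -> (1 < size g)%N -> size f != size g ->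
  exists C : R, 0 <= C /\ forall N, (0 < N)%N -> exists l0 : nat,
    (forall t, (#|near f g (N := N) t| <= l0)%N) /\
    l0%:R <= C * N%:R `^ (1 - (big_deg f g)%:R^-1).
Proof.
move=> f1 g1 fg; set n := big_deg f g.
have n0 : (0 < n)%N := big_deg_gt0 f1 g1.
have nR : 0 < n%:R :> R by rewrite ltr0n.
pose K := (n.+1 * coef_sum (small_poly f g))%N.
exists (n%:R * (K%:R `^ n%:R^-1 + 1)); split.
  by rewrite mulr_ge0// addr_ge0// powR_ge0.
move=> N N0; pose X : R := (K * N ^ n.-1)%:R `^ n%:R^-1.
have NR : 1 <= N%:R :> R by rewrite ler1n.
exists (n * (Num.trunc X).+1)%N; split.
  move=> t; have := @card_near (big_poly f g) n N (coef_sum (small_poly f g) * N ^ n.-1) t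
    (near f g t) (size_big_poly f1 g1) n0 (fun y h => h).
  move=> [h hX]; move/leq_trans; apply; rewrite leq_mul2l ltnS; apply/orP; right.
  rewrite truncn_ge_nat ?powR_ge0// /X.
  have -> : h%:R = (h%:R `^ n%:R) `^ n%:R^-1 :> R.
    by rewrite -powRrM mulfV ?gt_eqF// powRr1.
  apply: ge0_ler_powR; rewrite ?nnegrE ?invr_ge0 ?powR_ge0//.
  by rewrite powR_mulrn// -natrX ler_nat /K -mulnA.
have XE : X = K%:R `^ n%:R^-1 * N%:R `^ (1 - n%:R^-1).
  rewrite /X natrM powRM//; congr (_ * _).
  rewrite natrX -powR_mulrn// -powRrM; congr (_ `^ _).
  have -> : n.-1%:R = n%:R - 1 :> R by rewrite -{2}(prednK n0) -natr1 addrK.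
  by rewrite mulrBl mulfV ?gt_eqF// mul1r.
rewrite natrM -mulrA ler_wpM2l// -natr1 mulrDl mul1r.
rewrite lerD//; first by rewrite -XE truncn_le ?powR_ge0.
have e0 : 0 <= 1 - n%:R^-1 :> R by rewrite subr_ge0 invf_le1// ler1n.
rewrite -[leLHS](powRr0 N%:R); exact: ler_powR.
Qed.

(** The Toeplitz sign goes into [g]. *)
Lemma link_ordered (p1 p2 : {poly int}) (L : nat -> nat -> int) :
  L = link_PT p1 p2 \/ L = link_PH p1 p2 -> size p1 <> size p2 ->
  (1 < size p2)%N -> exists g : {poly int},
   [/\ L = ordered_link p1 g, size p1 != size g & (1 < size g)%N].
Proof.
move=> LE /eqP s12 s2; case: LE => ->; [exists (- p2)|exists p2]; split;
  rewrite ?size_polyN//; apply/funext => i; apply/funext => j;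
  rewrite /link_PT /link_PH /ordered_link; case: leqP => ij //.
- by rewrite hornerN.
- by rewrite hornerN addrC.
- by rewrite addrC.
Qed.

(** The exponent [e] is the inverse of the larger degree. *)
Lemma link_sparse (p1 p2 : {poly int}) (L : nat -> nat -> int) :
  (1 < size p1)%N -> (1 < size p2)%N -> size p1 <> size p2 ->
  L = link_PT p1 p2 \/ L = link_PH p1 p2 ->
  exists (D : nat) (C e : R),
    [/\ (0 < D)%N, 0 <= C, 0 < e <= 1 & sparse_link L D C e].
Proof.
move=> s1 s2 s12 LE; have [g [-> fg g1]] := link_ordered LE s12 s2.
have [C [C0 CP]] := card_near_asymptotic s1 g1 fg.
set n := big_deg p1 g in CP.
have n0 : (0 < n)%N := big_deg_gt0 s1 g1.
pose A : nat := ((size p1 * coef_sum p1 + size g * coef_sum g) ^ 2)%N.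
exists (row_const p1 g), ((2 * row_const p1 g)%:R * C + A%:R), n%:R^-1; split.
- by rewrite /row_const addn_gt0 ltnW.
- by rewrite addr_ge0// mulr_ge0.
- by rewrite invr_gt0 ltr0n n0/= invf_le1 ?ler1n// ltr0n.
move=> N N0; have [l0 [l0P l0C]] := CP N N0.
exists (level_size p1 g l0).
  split; [exact: row_level|exact: level_card|].
  by rewrite card_ord; exact: fork_card.
rewrite /level_size -/A natrD mulrDl lerD//; first by rewrite natrM -mulrA ler_wpM2l.
have e0 : 0 <= 1 - n%:R^-1 :> R by rewrite subr_ge0 invf_le1 ?ler1n// ltr0n.
rewrite ler_peMr// -[leLHS](powRr0 N%:R); apply: ler_powR => //.
by rewrite ler1n.
Qed.

(** Comparison with the telescoping sum of [(n^(-e) - (n+1)^(-e)) / e]. *)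
Lemma sum_powR_bounded (e : R) : 0 < e -> forall M : nat,
  \sum_(0 <= n < M) n.+1%:R `^ (- (1 + e)) <= 1 + e^-1.
Proof.
move=> e0 M; have step (n : nat) :
    n.+2%:R `^ (- (1 + e)) <= e^-1 * (n.+1%:R `^ (- e) - n.+2%:R `^ (- e)).
  set a : R := n.+1%:R; set b : R := n.+2%:R.
  have a0 : 0 < a by rewrite ltr0n.
  have b0 : 0 < b by rewrite ltr0n.
  have ba : b = a + 1 by rewrite /b -natr1.
  rewrite ler_pdivlMl// opprD powRD ?(gt_eqF b0) ?implybT// powR_inv1 ?(ltW b0)//.
  have -> : a `^ (- e) = (a / b) `^ (- e) * b `^ (- e).
    by rewrite -powRM ?divr_ge0 ?(ltW a0) ?(ltW b0)// divfK// gt_eqF.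
  rewrite -[X in _ <= _ - X]mul1r -mulrBl mulrA ler_wpM2r ?powR_ge0//.
  rewrite lerBrDr /powR gt_eqF ?divr_gt0//.
  apply: le_trans (expR_ge1Dx _); rewrite addrC lerD2l mulNr -mulrN ler_wpM2l ?(ltW e0)//.
  have -> : a / b = 1 + - b^-1 by rewrite -{1}[a](addrK 1) -ba mulrBl mulfV ?gt_eqF// mul1r.
  rewrite lerNr; apply: le_ln1Dx.
  by rewrite ltrNr opprK invf_lt1// ltr1n.
case: M => [|M]; first by rewrite big_geq// addr_ge0// invr_ge0 ltW.
rewrite big_nat_recl// powR1 lerD2l.
apply: (@le_trans _ _ (\sum_(0 <= n < M) e^-1 * (n.+1%:R `^ (- e) - n.+2%:R `^ (- e)))).
  by apply: ler_sum => n _; exact: step.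
rewrite -mulr_sumr ler_piMr ?invr_ge0 ?(ltW e0)//.
under eq_bigr do rewrite -opprB.
by rewrite sumrN telescope_sumr// opprB powR1 lerBlDr lerDl powR_ge0.
Qed.

End LevelAsymptotics.

(** * Expectation of products of independent variables *)

Section Density.
Import HBNNSimple.
Local Open Scope classical_set_scope.
Local Open Scope ring_scope.
Context d d' (T : measurableType d) (T' : measurableType d') (R : realType).
Variables (mu : {measure set T -> \bar R}) (nu : {measure set T' -> \bar R}).
Variables (phi : T -> T') (g : T -> R).
Hypotheses (mphi : measurable_fun setT phi) (mg : measurable_fun setT g).
Hypothesis g0 : forall x, 0 <= g x.
Hypothesis nuE : forall B, measurable B ->
  nu B = (\int[mu]_(x in phi @^-1` B) (g x)%:E)%E.

(** Integration against the image under [phi] of the measure of density [g], first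
    for simple functions and then by monotone limits. It expresses independence
    when [phi] is a random variable and [g] a product of others, and integration
    against a probability density when [phi] is the identity. *)
Lemma ge0_integral_density (f : T' -> \bar R) : (forall y, 0 <= f y)%E ->
  measurable_fun setT f ->
  (\int[nu]_y f y = \int[mu]_x (f (phi x) * (g x)%:E))%E.
Proof.
move=> f0 mf; pose h := nnsfun_approx measurableT mf.
have mh n : measurable_fun setT (EFin \o h n).
  by apply/measurable_EFinP; exact/measurable_funP.
have fE y : f y = lim ((EFin \o h n) y @[n --> \oo]).
  by apply/esym/cvg_lim => //; exact: cvg_nnsfun_approx.
have -> : (\int[nu]_y f y = lim (\int[nu]_y (EFin \o h n) y @[n --> \oo]))%E.
  under eq_integral do rewrite fE.
  apply: monotone_convergence => //.
  - by move=> n x _ /=; rewrite lee_fin.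
  - by move=> x _ a b ab; rewrite lee_fin; exact/lefP/nd_nnsfun_approx.
have mgE : measurable_fun setT (EFin \o g) by exact/measurable_EFinP.
have -> : (\int[mu]_x (f (phi x) * (g x)%:E) =
    lim (\int[mu]_x ((h n (phi x))%:E * (g x)%:E) @[n --> \oo]))%E.
  have fg x : (f (phi x) * (g x)%:E =
      lim ((h n (phi x))%:E * (g x)%:E @[n --> \oo]))%E.
    apply/esym/cvg_lim => //; apply: cvgeZr => //.
    exact: (cvg_nnsfun_approx measurableT mf (fun y _ => f0 y) (x := phi x)).
  under eq_integral do rewrite fg.
  apply: monotone_convergence => //.
  - move=> n; apply: emeasurable_funM => //.
    exact: (measurableT_comp (mh n) mphi).
  - by move=> n x _; rewrite mule_ge0// lee_fin.
  - move=> x _ a b ab /=; rewrite lee_wpmul2r ?lee_fin//.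
    exact/lefP/nd_nnsfun_approx.
suff suf n : (\int[nu]_y (EFin \o h n) y = \int[mu]_x ((h n (phi x))%:E * (g x)%:E))%E.
  by under eq_fun do rewrite suf.
under eq_integral => y _ do rewrite /= fimfunE -fsumEFin//.
rewrite ge0_integral_fsum//; last 2 first.
- by move=> r; apply/measurable_EFinP; exact: measurable_funM.
- by move=> r y _; exact: nnfun_muleindic_ge0.
under [RHS]eq_integral => x _.
  rewrite [X in (X%:E * _)%E]fimfunE -fsumEFin// ge0_mule_fsuml; last first.
    by move=> r; exact: nnfun_muleindic_ge0.
  over.
rewrite ge0_integral_fsum//; last 2 first.
- move=> r; apply: emeasurable_funM => //.
  apply/measurable_EFinP; apply: measurable_funM => //.
  exact: (measurableT_comp _ mphi).
- by move=> r x _; rewrite mule_ge0 ?lee_fin// -lee_fin; exact: nnfun_muleindic_ge0.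
apply: eq_fsbigr => r; rewrite inE => -[y _ <-].
have r0 : 0 <= h n y by [].
have mB : measurable (h n @^-1` [set h n y]) by exact: measurable_sfunP.
under eq_integral do rewrite EFinM.
rewrite ge0_integralZl//; last exact/measurable_EFinP.
rewrite integral_indic// setIT nuE//.
under [RHS]eq_integral do rewrite EFinM -muleA.
rewrite ge0_integralZl//; last 2 first.
- apply: emeasurable_funM => //; apply/measurable_EFinP.
  exact: (measurableT_comp _ mphi).
- by move=> x _; rewrite mule_ge0 ?lee_fin.
congr (_ * _)%E; rewrite [LHS]integral_mkcond; apply: eq_integral => x _.
rewrite patchE indicE.
have -> : (phi x \in h n @^-1` [set h n y]) = (x \in phi @^-1` (h n @^-1` [set h n y])).
  by [].
by case: ifP => _; rewrite ?mul1e ?mul0e.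
Qed.

End Density.

Section Independence.
Local Open Scope classical_set_scope.
Local Open Scope ring_scope.
Context d (T : measurableType d) (R : realType) (P : probability T R).
Context (I : eqType) (X : I -> {RV P >-> R}) (p : probability R R).
Hypothesis iidX : iid X p.

Lemma prod_indic (s : seq I) (B : I -> set R) w :
  \prod_(i <- s) \1_(B i) (X i w) = \1_(\big[setI/setT]_(i <- s) (X i @^-1` B i)) w :> R.
Proof.
elim: s => [|i s IH]; first by rewrite !big_nil indicE in_setT.
rewrite !big_cons IH !indicE in_setI.
have -> : (X i w \in B i) = (w \in X i @^-1` B i) by [].
by case: (w \in X i @^-1` B i); rewrite ?mul1r ?mul0r.
Qed.

Lemma measurable_bigsetI (s : seq I) (B : I -> set R) :
  (forall i, measurable (B i)) -> measurable (\big[setI/setT]_(i <- s) (X i @^-1` B i)).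
Proof.
move=> mB; elim: s => [|i s IH]; first by rewrite big_nil.
rewrite big_cons; apply: measurableI => //.
by rewrite -[X in measurable X]setTI; exact: measurable_funPT.
Qed.

(** Independence is given for indicators, and the indicators are exchanged for the
    functions [h i] one at a time. With the other factors [G] fixed, the induction
    hypothesis for indicators of [X j] says that the image under [X j] of the
    measure of density [G] is a multiple of [p]. *)
Lemma ge0_integral_prod (h : I -> R -> R) (c : I -> R) :
  (forall i x, 0 <= h i x) -> (forall i, measurable_fun setT (h i)) ->
  (forall i, (\int[p]_x (h i x)%:E = (c i)%:E)%E) ->
  forall s1 s2 (B : I -> set R), uniq (s1 ++ s2) -> (forall i, measurable (B i)) ->
  (\int[P]_w (\prod_(i <- s1) h i (X i w) * \prod_(i <- s2) \1_(B i) (X i w))%:E =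
   (\prod_(i <- s1) c i * \prod_(i <- s2) fine (p (B i)))%:E)%E.
Proof.
move=> h0 mh hc; elim=> [|j s1 IH] s2 B us mB.
  under eq_integral do rewrite big_nil mul1r prod_indic.
  rewrite integral_indic//; last exact: measurable_bigsetI.
  rewrite setIT big_nil mul1r; move: (iidX.1 s2 B us mB) => /= ->.
  elim: (s2) => [|i s IH].
    by rewrite !big_nil.
  rewrite !big_cons IH EFinM; congr (_ * _)%E.
  rewrite -[LHS]/(distribution P (X i) (B i)) iidX.2// fineK//.
  exact: fin_num_measure.
have mX i : measurable_fun setT (X i) by exact: measurable_funPT.
have mXh i : measurable_fun setT (fun w => h i (X i w)).
  exact: (measurableT_comp (mh i)).
have mX1 (D : I -> set R) i : (forall i, measurable (D i)) ->
    measurable_fun setT (fun w => \1_(D i) (X i w) : R).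
  by move=> mD; apply: measurableT_comp => //; exact: measurable_indic.
pose G w := \prod_(i <- s1) h i (X i w) * \prod_(i <- s2) \1_(B i) (X i w).
have mG : measurable_fun setT G.
  by apply: measurable_funM; apply: measurable_prod => // i _; exact: mX1.
have G0 w : 0 <= G w.
  by rewrite mulr_ge0// prodr_ge0.
pose k := \prod_(i <- s1) c i * \prod_(i <- s2) fine (p (B i)).
have c0 i : 0 <= c i.
  by rewrite -lee_fin -hc; apply: integral_ge0 => x _; rewrite lee_fin.
have k0 : 0 <= k.
  by rewrite mulr_ge0// prodr_ge0// => i _; rewrite fine_ge0.
move: us => /= /andP[js us].
have nuE D : measurable D -> (mscale (NngNum k0) p D = \int[P]_(w in X j @^-1` D) (G w)%:E)%E.
  move=> mD; pose B' i := if i == j then D else B i.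
  have mB' i : measurable (B' i) by rewrite /B'; case: ifP.
  have B'E i : i != j -> B' i = B i by rewrite /B' => /negbTE ->.
  have js1 : j \notin s1 by apply: contra js; rewrite mem_cat => ->.
  have js2 : j \notin s2 by apply: contra js; rewrite mem_cat => ->; rewrite orbT.
  have eqB F : \prod_(i <- s2) F i (B' i) = \prod_(i <- s2) F i (B i) :> R.
    rewrite big_seq [RHS]big_seq; apply: eq_bigr => i i2; rewrite B'E//.
    by apply: contraNneq js2 => <-.
  have us' : uniq (s1 ++ j :: s2) by rewrite (perm_uniq (permEl (perm_catCA s1 [:: j] s2)))/= js.
  have := IH (j :: s2) B' us' mB'.
  rewrite !big_cons (eqB (fun i D => fine (p D))) {2}/B' eqxx => H.
  rewrite [RHS]integral_mkcond /mscale/= -[p D]fineK ?fin_num_measure//.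
  rewrite -EFinM /k -mulrA [(_ * fine (p D))]mulrC -H; apply: eq_integral => w _.
  rewrite big_cons (eqB (fun i D => \1_D (X i w))) {1}/B' eqxx patchE indicE.
  have -> : (X j w \in D) = (w \in X j @^-1` D) by [].
  by case: ifP => _; rewrite ?mul0r ?mulr0 ?mul1r.
have -> : (\int[P]_w (\prod_(i <- j :: s1) h i (X i w) *
    \prod_(i <- s2) \1_(B i) (X i w))%:E = \int[P]_w ((h j (X j w))%:E * (G w)%:E))%E.
  by apply: eq_integral => w _; rewrite big_cons -EFinM mulrA.
rewrite -(ge0_integral_density (mX j) mG G0 nuE (f := fun x => (h j x)%:E)); last 2 first.
- by move=> x; rewrite lee_fin.
- exact/measurable_EFinP.
rewrite ge0_integral_mscale//=; last 2 first.
- exact/measurable_EFinP.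
- by move=> x _; rewrite lee_fin.
by rewrite hc -EFinM big_cons /k mulrC mulrA.
Qed.

Lemma prod_update_sub (s : seq I) (F Fp Fn : I -> R) j :
  uniq s -> j \in s -> F j = Fp j - Fn j ->
  (forall i, i != j -> Fp i = F i) -> (forall i, i != j -> Fn i = F i) ->
  \prod_(i <- s) F i = \prod_(i <- s) Fp i - \prod_(i <- s) Fn i.
Proof.
move=> us js Fj Fpi Fni; rewrite !(big_rem j js)/= Fj mulrBl.
by congr (_ * _ - _ * _); rewrite big_seq [RHS]big_seq; apply: eq_bigr => i;
  rewrite mem_rem_uniq// inE => /andP[ij _]; rewrite ?Fpi ?Fni.
Qed.

(** A product over [s] of integrable functions is reduced to nonnegative ones by
    splitting one factor at a time into positive and negative parts: only the
    factors listed in [r] may change sign. *)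
Lemma integral_prod (s : seq I) (h : I -> R -> R) : uniq s ->
  (forall i, p.-integrable setT (EFin \o h i)) ->
  P.-integrable setT (fun w => (\prod_(i <- s) h i (X i w))%:E) /\
  \int[P]_w \prod_(i <- s) h i (X i w) = \prod_(i <- s) \int[p]_x h i x.
Proof.
move=> us.
have mh_ g : (forall i, p.-integrable setT (EFin \o g i)) ->
    forall i, measurable_fun setT (g i).
  by move=> ig i; apply/measurable_EFinP; exact: measurable_int (ig i).
have mprod g : (forall i, p.-integrable setT (EFin \o g i)) ->
    measurable_fun setT (fun w => \prod_(i <- s) g i (X i w)).
  move=> ig; apply: measurable_prod => i _.
  by apply: measurableT_comp; [exact: mh_|exact: measurable_funPT].
suff main (r : seq I) : forall g, (forall i, p.-integrable setT (EFin \o g i)) ->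
    (forall i, i \notin r -> forall x, 0 <= g i x) ->
    P.-integrable setT (fun w => (\prod_(i <- s) g i (X i w))%:E) /\
    \int[P]_w \prod_(i <- s) g i (X i w) = \prod_(i <- s) \int[p]_x g i x.
(* Off [s] the functions are replaced by 0, hence nonnegative there. *)
  move=> ih; suff : P.-integrable setT (fun w =>
      (\prod_(i <- s) (fun i => if i \in s then h i else fun=> 0) i (X i w))%:E) /\
    \int[P]_w \prod_(i <- s) (fun i => if i \in s then h i else fun=> 0) i (X i w) =
    \prod_(i <- s) \int[p]_x (fun i => if i \in s then h i else fun=> 0) i x.
    have E w : \prod_(i <- s) (if i \in s then h i else fun=> 0) (X i w) =
        \prod_(i <- s) h i (X i w).
      by rewrite big_seq [RHS]big_seq; apply: eq_bigr => i ->.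
    under eq_fun do rewrite E; under eq_Rintegral do rewrite E.
    rewrite [X in _ /\ _ = X]big_seq [X in _ -> _ /\ _ = X]big_seq.
    by move=> [? ->]; split=> //; apply: eq_bigr => i ->.
  apply: (main s) => i; last by move/negbTE => ->.
  by case: ifP => _ //; exact: (integrable0 p setT).
elim: r => [|j r IH] g ig g0.
  have gc i : (\int[p]_x (g i x)%:E = (\int[p]_x g i x)%:E)%E.
    by rewrite /Rintegral fineK//; exact: integrable_fin_num (ig i).
  have ge i x : 0 <= g i x by exact: g0.
  have := ge0_integral_prod ge (mh_ _ _ ig) gc (s1 := s) (s2 := [::]) (B := fun=> setT).
  rewrite cats0 => /(_ us (fun=> measurableT)).
  under eq_integral do rewrite big_nil mulr1.
  rewrite big_nil mulr1 => E; split; last by rewrite /Rintegral E.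
  apply/integrableP; split; first by apply/measurable_EFinP; exact: mprod.
  under eq_integral do rewrite gee0_abs ?lee_fin ?prodr_ge0//.
  by rewrite E ltry.
pose gp i := if i == j then (g j)^\+ else g i.
pose gn i := if i == j then (g j)^\- else g i.
have igp i : p.-integrable setT (EFin \o gp i).
  by rewrite /gp; case: eqP => // _; exact: integrable_funrpos.
have ign i : p.-integrable setT (EFin \o gn i).
  by rewrite /gn; case: eqP => // _; exact: integrable_funrneg.
have [ip cp] : P.-integrable setT (fun w => (\prod_(i <- s) gp i (X i w))%:E) /\
    \int[P]_w \prod_(i <- s) gp i (X i w) = \prod_(i <- s) \int[p]_x gp i x.
  apply: IH => // i ir x; rewrite /gp; case: eqP => [_|/eqP ij]; first exact: funrpos_ge0.
  by apply: g0; rewrite inE negb_or ij.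
have [in_ cn] : P.-integrable setT (fun w => (\prod_(i <- s) gn i (X i w))%:E) /\
    \int[P]_w \prod_(i <- s) gn i (X i w) = \prod_(i <- s) \int[p]_x gn i x.
  apply: IH => // i ir x; rewrite /gn; case: eqP => [_|/eqP ij]; first exact: funrneg_ge0.
  by apply: g0; rewrite inE negb_or ij.
have [js|js] := boolP (j \in s); last first.
  have E (F : (R -> R) -> I -> R) : \prod_(i <- s) F (g i) i = \prod_(i <- s) F (gp i) i.
    rewrite big_seq [RHS]big_seq; apply: eq_bigr => i si; rewrite /gp; case: eqP => // ij.
    by rewrite -ij si in js.
  rewrite (E (fun k _ => \int[p]_x k x)).
  under eq_fun do rewrite (E (fun k i => k (X i _))).
  by under eq_Rintegral do rewrite (E (fun k i => k (X i _))).
have gjE x : g j x = gp j x - gn j x.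
  by rewrite /gp /gn eqxx -[in LHS](funrposBneg (g j)).
have gpE i : i != j -> gp i = g i by rewrite /gp => /negbTE ->.
have gnE i : i != j -> gn i = g i by rewrite /gn => /negbTE ->.
have prodE w : \prod_(i <- s) g i (X i w) =
    \prod_(i <- s) gp i (X i w) - \prod_(i <- s) gn i (X i w).
  by apply: prod_update_sub js _ _ _ => // i ij; rewrite ?gpE ?gnE.
split.
  by under eq_fun do rewrite prodE EFinB; exact: integrableB.
under eq_Rintegral do rewrite prodE.
rewrite RintegralB// cp cn; apply/esym; apply: prod_update_sub js _ _ _ => //.
- by rewrite -RintegralB//; apply: eq_Rintegral => x _; rewrite gjE.
- by move=> i ij; rewrite gpE.
- by move=> i ij; rewrite gnE.
Qed.

Hypothesis pX : forall k : nat, p.-integrable setT (fun x : R => (x ^+ k)%:E).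

Definition law_moment k : R := \int[p]_x (x ^+ k).

Lemma integral_word (w : seq I) :
  P.-integrable setT (fun t => (\prod_(i <- w) X i t)%:E) /\
  \int[P]_t \prod_(i <- w) X i t = \prod_(i <- undup w) law_moment (count_mem i w).
Proof.
have E t : \prod_(i <- w) X i t = \prod_(i <- undup w) (X i t) ^+ count_mem i w.
  by rewrite prodr_undup_exp_count.
under eq_fun do rewrite E; under eq_Rintegral do rewrite E.
exact: (@integral_prod (undup w) (fun i x => x ^+ count_mem i w) (undup_uniq w)
  (fun i => pX _)).
Qed.

End Independence.

(** * Powers of eigenvalues as sums over walks *)

Section SpectralTrace.
Local Open Scope ring_scope.

Lemma mulmx_pow_conj (F : fieldType) n (Q B : 'M[F]_n) k : Q \in unitmx ->
  (invmx Q *m B *m Q) ^+ k = invmx Q *m B ^+ k *m Q.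
Proof.
move=> uQ; elim: k => [|k IH]; first by rewrite !expr0 mulmx1 mulVmx.
rewrite !exprS IH -![_ * _]/(_ *m _) !mulmxA; congr (_ *m _ *m _).
by rewrite -[in LHS](mulmxA (invmx Q *m B)) mulmxV// mulmx1.
Qed.

Lemma diag_mx_pow (F : fieldType) n (D : 'rV[F]_n) k :
  diag_mx D ^+ k = diag_mx (\row_j D 0 j ^+ k).
Proof.
elim: k => [|k IH].
  by apply/matrixP => i j; rewrite !mxE; case: eqP => // _; rewrite expr0.
rewrite exprS IH -[_ * _]/(_ *m _) mulmx_diag; congr diag_mx.
by apply/rowP => j; rewrite !mxE exprS.
Qed.

(** Compared inside the complex numbers, where the matrix is unitarily similar to
    a diagonal one; by unique factorisation of the characteristic polynomial its
    diagonal is a permutation of the list of eigenvalues. *)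
Lemma sum_eigenvalues_pow (R : realType) N (A : 'M[R]_N) k : A^T = A ->
  \sum_(i < N) (eigenvalues A)`_i ^+ k = \tr (A ^+ k).
Proof.
move=> symA; have [_ chA sz] := eigenvaluesP symA.
pose B : 'M[R[i]]_N := map_mx (real_complex R) A.
have Bherm : B \is hermsymmx.
  apply: realsym_hermsym.
    apply/is_hermitianmxP; rewrite expr0 scale1r map_mx_id//.
    by apply/matrixP => i j; rewrite !mxE -[in LHS]symA mxE.
  by apply/mxOverP => i j; rewrite mxE; apply/complex_realP; exists (A i j).
have /orthomx_spectralP BE := hermitian_normalmx Bherm.
have chB : char_poly B = \prod_(j < N) ('X - (spectral_diag B 0 j)%:P).
  rewrite [in LHS]BE char_poly_conj ?spectral_unit//.
  rewrite char_poly_trig ?diag_mx_is_trig//; apply: eq_bigr => j _.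
  by rewrite !mxE eqxx mulr1n.
have perm : perm_eq [seq real_complex R x | x <- eigenvalues A]
    [seq spectral_diag B 0 j | j <- enum 'I_N].
  apply: prod_XsubC_eq; rewrite big_map [RHS]big_map [RHS]big_enum/= -chB -map_char_poly chA.
  by rewrite rmorph_prod; apply: eq_bigr => x _; rewrite rmorphB/= map_polyX map_polyC.
have trB : \tr (B ^+ k) = \sum_(j < N) spectral_diag B 0 j ^+ k.
  rewrite [in LHS]BE mulmx_pow_conj ?spectral_unit// mxtrace_mulC mulmxA.
  rewrite mulmxV ?spectral_unit// mul1mx diag_mx_pow mxtrace_diag.
  by apply: eq_bigr => j _; rewrite mxE.
have BA : \tr (B ^+ k) = real_complex R (\tr (A ^+ k)).
  rewrite -trace_map_mx; congr (\tr _); rewrite /B; elim: (k) => [|m IH].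
    by rewrite !expr0 map_mx1.
  by rewrite !exprS IH -![_ * _]/(_ *m _) map_mxM.
apply: (@complexI R); rewrite -[RHS]BA trB.
have -> : \sum_(i < N) (eigenvalues A)`_i ^+ k = \sum_(x <- eigenvalues A) x ^+ k.
  by rewrite (big_nth 0) big_mkord sz.
rewrite rmorph_sum -[RHS]big_enum/=.
rewrite -(big_map (fun j => spectral_diag B 0 j) predT (fun y => y ^+ k)).
rewrite -(perm_big _ perm)/= big_map; apply: eq_bigr => x _.
exact: rmorphXn.
Qed.

End SpectralTrace.

Section TraceWalks.
Local Open Scope ring_scope.
Variables (R : comNzRingType) (C : eqType) (X : C -> R) (N : nat).
Variable col : 'I_N -> 'I_N -> C.

Lemma matrix_pow_walks k i j :
  ((\matrix_(x, y) X (col x y)) ^+ k) i j =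
  \sum_(s <- seqs_over (enum 'I_N) k | last i s == j)
     \prod_(c <- word col i s) X c.
Proof.
elim: k i => [|k IH] i.
  rewrite expr0 mxE big_mkcond big_seq1 /= big_nil.
  by case: eqP.
rewrite exprS -[_ * _]/(_ *m _) mxE [RHS]big_mkcond [RHS]big_seqs_overS -[LHS]big_enum/=.
apply: eq_bigr => y _; rewrite IH mxE mulr_sumr big_mkcond/=.
by apply: eq_bigr => s _; rewrite /word/= big_cons; case: ifP.
Qed.

Lemma trace_walks k :
  \tr ((\matrix_(x, y) X (col x y)) ^+ k) =
  \sum_(x <- enum 'I_N) \sum_(s <- seqs_over (enum 'I_N) k | last x s == x)
     \prod_(c <- word col x s) X c.
Proof.
by rewrite /mxtrace -[LHS]big_enum/=; apply: eq_bigr => x _; exact: matrix_pow_walks.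
Qed.

End TraceWalks.

(** * Moments of the semicircle law *)

Section SemicircleMoments.
Local Open Scope classical_set_scope.
Local Open Scope ring_scope.
Variable R : realType.
Local Notation mu := (@lebesgue_measure R).
Local Notation hpi := (pi / 2 : R)%R.
Local Notation mhpi := (- (pi / 2) : R)%R.

Lemma FTC_trig (f F : R -> R) : continuous f ->
  (forall x : R, is_derive x 1 F (f x)) ->
  (\int[mu]_(x in `[mhpi, hpi]) (f x)%:E = (F hpi - F mhpi)%R%:E)%E.
Proof.
move=> cf dF; have hpi0 : 0 < hpi by rewrite divr_gt0// pi_gt0.
have cF : continuous F.
  by move=> x; apply/differentiable_continuous/derivable1_diffP; case: (dF x).
rewrite (@continuous_FTC2 _ f F).
- by rewrite EFinB.
- by rewrite (lt_trans _ hpi0)// oppr_lt0.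
- exact: continuous_subspaceT.
- split.
  + by move=> x _; case: (dF x).
  + exact/cvg_at_right_filter/cF.
  + exact/cvg_at_left_filter/cF.
- by move=> x _; rewrite derive1E; case: (dF x).
Qed.

(** The substitution [x = 2 sin t] turns [x ^ k] times the semicircle density into
    this function divided by [2 pi]. *)
Definition trig_integrand k (x : R) : R := (2 * sin x) ^+ k * (2 * cos x) ^+ 2.

Lemma continuous_trig_integrand k : continuous (trig_integrand k).
Proof.
move=> x; rewrite /trig_integrand; apply: cvgM.
  apply: (@continuous_comp _ _ _ (fun x => 2 * sin x) (fun y : R => y ^+ k)).
    by apply: cvgM; [exact: cvg_cst|exact: continuous_sin].
  exact: exprn_continuous.
apply: (@continuous_comp _ _ _ (fun x => 2 * cos x) (fun y : R => y ^+ 2)).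
  by apply: cvgM; [exact: cvg_cst|exact: continuous_cos].
exact: exprn_continuous.
Qed.

Definition trig_moment k : R := fine (\int[mu]_(x in `[mhpi, hpi]) (trig_integrand k x)%:E).

Lemma trig_integrable k : mu.-integrable `[mhpi, hpi] (EFin \o trig_integrand k).
Proof.
apply: continuous_compact_integrable; first exact: segment_compact.
by apply: continuous_subspaceT; exact: continuous_trig_integrand.
Qed.

Lemma trig_momentE k :
  (\int[mu]_(x in `[mhpi, hpi]) (trig_integrand k x)%:E = (trig_moment k)%:E)%E.
Proof. by rewrite fineK//; apply: integrable_fin_num (trig_integrable k). Qed.

Lemma trig_moment0 : trig_moment 0 = 2 * pi.
Proof.
have dF (x : R) : is_derive x 1 (fun x : R => 2 * x + 2 * (sin x * cos x)) (trig_integrand 0 x).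
  rewrite /trig_integrand expr0 mul1r.
  apply: is_derive_eq; rewrite /GRing.scale/=.
  have := cos2Dsin2 x; nra.
rewrite /trig_moment (FTC_trig (@continuous_trig_integrand 0) dF)/=.
by rewrite cosN cos_pihalf !mulr0; lra.
Qed.

Lemma trig_moment1 : trig_moment 1 = 0.
Proof.
have dF (x : R) : is_derive x 1 (fun x : R => - 3^-1 * (2 * cos x) ^+ 3) (trig_integrand 1 x).
  rewrite /trig_integrand expr1.
  apply: is_derive_eq; rewrite /GRing.scale/=.
  by field.
rewrite /trig_moment (FTC_trig (@continuous_trig_integrand 1) dF)/=.
by rewrite cosN cos_pihalf !mulr0 expr0n/= mulr0 subrr.
Qed.

(** The function [(2 sin) ^ k.+1 * (2 cos) ^ 3] vanishes at both ends of the
    interval, and its derivative combines the two integrands. *)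
Lemma trig_moment_rec k : (k%:R + 4) * trig_moment k.+2 = 4 * (k%:R + 1) * trig_moment k.
Proof.
pose f x := 4 * (k%:R + 1) * trig_integrand k x - (k%:R + 4) * trig_integrand k.+2 x.
have cf : continuous f.
  by move=> x; apply: cvgB; apply: cvgM; [exact: cvg_cst|exact: continuous_trig_integrand
    |exact: cvg_cst|exact: continuous_trig_integrand].
have dF (x : R) : is_derive x 1 (fun x : R => (2 * sin x) ^+ k.+1 * (2 * cos x) ^+ 3) (f x).
  have du : is_derive x 1 (fun x : R => 2 * sin x) (2 * cos x).
    by apply: is_derive_eq; rewrite /GRing.scale/=; ring.
  have dv : is_derive x 1 (fun x : R => 2 * cos x) (- (2 * sin x)).
    by apply: is_derive_eq; rewrite /GRing.scale/=; ring.
  have -> : (fun x : R => (2 * sin x) ^+ k.+1 * (2 * cos x) ^+ 3) =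
      (fun x : R => 2 * sin x) ^+ k.+1 * (fun x : R => 2 * cos x) ^+ 3.
    by apply/funext => y; rewrite !fctE.
  have := is_deriveM (is_deriveX k.+1 du) (is_deriveX 3 dv).
  move=> H; apply: is_derive_eq H _; rewrite /GRing.scale/= /f /trig_integrand.
  rewrite !fctE !exprS expr0 -[k.+1%:R]natr1.
  have sc : (2 * sin x) ^+ 2 + (2 * cos x) ^+ 2 - 4 = 0.
    by have := cos2Dsin2 x; rewrite !expr2; nra.
  move: (2 * sin x) (2 * cos x) sc => s c sc.
  apply/eqP; rewrite -subr_eq0.
  set lhs := (X in X == 0).
  have -> : lhs = s ^+ k * c ^+ 2 * (k%:R + 1) * (s ^+ 2 + c ^+ 2 - 4) by rewrite /lhs; ring.
  by rewrite sc mulr0.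
have := FTC_trig cf dF; rewrite /= cosN cos_pihalf !mulr0 expr0n/= !mulr0 subrr.
have -> : (\int[mu]_(x in `[mhpi, hpi]) (f x)%:E =
    (4 * (k%:R + 1) * trig_moment k - (k%:R + 4) * trig_moment k.+2)%:E)%E.
  have iZ (c : R) j : mu.-integrable `[mhpi, hpi] (fun x => (c * trig_integrand j x)%:E).
    exact: (integrableZl _ _ (trig_integrable j)).
  under eq_integral do rewrite /f EFinB.
  rewrite integralB//.
  under eq_integral do rewrite EFinM.
  under [X in (_ - X)%E]eq_integral do rewrite EFinM.
  rewrite !integralZl//; try exact: trig_integrable.
  by rewrite !trig_momentE -!EFinM -EFinB.
by move=> [/eqP]; rewrite subr_eq0 => /eqP.
Qed.

Lemma integral_semicircle (f : R -> R) : measurable_fun setT f ->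
  (\int[@semicircle R]_x (f x)%:E = \int[mu]_x (f x * semicircle_pdf x)%:E)%E.
Proof.
move=> mf; have dens (g : R -> \bar R) : (forall x, 0 <= g x)%E -> measurable_fun setT g ->
    (\int[@semicircle R]_x g x = \int[mu]_x (g x * (semicircle_pdf x)%:E))%E.
  move=> g0 mg.
  exact: (@ge0_integral_density _ _ _ _ _ mu (@semicircle R) idfun (@semicircle_pdf R)
    (@measurable_id _ _ _) (@measurable_semicircle_pdf R) (@semicircle_pdf_ge0 R)).
rewrite integralE [RHS]integralE !dens//; last 2 first.
- by apply: measurable_funeneg; exact/measurable_EFinP.
- by apply: measurable_funepos; exact/measurable_EFinP.
congr (_ - _)%E; apply: eq_integral => x _.
- rewrite !funeposE -!EFin_max -EFinM; congr EFin.
  by rewrite maxr_pMl ?semicircle_pdf_ge0// mul0r.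
- rewrite !funenegE -!EFinN -!EFin_max -EFinM; congr EFin.
  by rewrite maxr_pMl ?semicircle_pdf_ge0// mul0r mulNr.
Qed.

Lemma moment_semicircle k : moment (@semicircle R) k = trig_moment k / (2 * pi).
Proof.
rewrite /moment /Rintegral integral_semicircle//.
have pi0 := pi_gt0 R.
pose g (y : R) := y ^+ k * Num.sqrt (4 - y ^+ 2).
have -> : (\int[mu]_x (x ^+ k * semicircle_pdf x)%:E =
    \int[mu]_(x in `[(-2)%R, 2%R]) ((2 * pi)^-1%:E * (g x)%:E))%E.
  rewrite [RHS]integral_mkcond; apply: eq_integral => x _.
  rewrite patchE /semicircle_pdf mem_setE in_itv/=; case: ifP => _; last by rewrite mulr0.
  by rewrite -EFinM /g mulrCA.
have cg : continuous g.
  move=> y; apply: cvgM; first exact: exprn_continuous.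
  apply: (@continuous_comp _ _ _ (fun y : R => 4 - y ^+ 2) Num.sqrt).
    by apply: cvgB; [exact: cvg_cst|exact: exprn_continuous].
  exact: sqrt_continuous.
have ig : mu.-integrable `[(-2)%R, 2%R] (EFin \o g).
  apply: continuous_compact_integrable; first exact: segment_compact.
  exact: continuous_subspaceT.
rewrite integralZl//.
suff -> : (\int[mu]_(x in `[(-2)%R, 2%R]) (g x)%:E = (trig_moment k)%:E)%E.
  by rewrite -EFinM/= mulrC.
have dsin (x : R) : is_derive x 1 (fun x : R => 2 * sin x) (2 * cos x).
  by apply: is_derive_eq; rewrite /GRing.scale/=; ring.
have D1 : derive1 (fun x : R => 2 * sin x) = (fun x => 2 * cos x).
  by apply/funext => x; rewrite derive1E; case: (dsin x).
have c2cos : continuous (fun x : R => 2 * cos x).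
  by move=> x; apply: cvgM; [exact: cvg_cst|exact: continuous_cos].
have c2sin : continuous (fun x : R => 2 * sin x).
  by move=> x; apply: cvgM; [exact: cvg_cst|exact: continuous_sin].
have := @integration_by_substitution_increasing R (fun x => 2 * sin x) g mhpi hpi.
rewrite D1 sinN sin_pihalf mulr1 mulrN1 => -> //.
- rewrite -trig_momentE; apply: eq_integral => x; rewrite inE/= in_itv/= => xI.
  congr EFin; rewrite /trig_integrand fctE /g/= -mulrA; congr (_ * _).
  have -> : 4 - (2 * sin x) ^+ 2 = (2 * cos x) ^+ 2.
    by have := cos2Dsin2 x; rewrite !expr2; nra.
  by rewrite sqrtr_sqr ger0_norm -?expr2// mulr_ge0// cos_ge0_pihalf.
- by lra.
- move=> x y xI yI xy; rewrite ltr_pM2l// ltr_sin//.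
- have H : 2 * cos x @[x --> mhpi^'+] --> 2 * cos mhpi.
    by apply: cvg_at_right_filter; exact: c2cos.
  exact: cvgP H.
- have H : 2 * cos x @[x --> hpi^'-] --> 2 * cos hpi.
    by apply: cvg_at_left_filter; exact: c2cos.
  exact: cvgP H.
- split.
  + by move=> x _; case: (dsin x).
  + exact/cvg_at_right_filter/c2sin.
  + exact/cvg_at_left_filter/c2sin.
- exact: continuous_subspaceT.
Qed.

(** The two-term recursion of the Catalan numbers, interleaved with zeros, implies
    their convolution formula. In the convolution [S k] the symmetry exchanging
    [t] and [k - t] gives the weight [t] the average [k / 2]; inserting the
    recursion of [m] into the convolution weighted by [t + 2] then yields for [S]
    the recursion of [m] with the index shifted by 2. *)
Lemma catalan_convolution (m : nat -> R) : m 0 = 1 -> m 1 = 0 ->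
  (forall k, (k%:R + 4) * m k.+2 = 4 * (k%:R + 1) * m k) ->
  forall k, m k.+2 = \sum_(t < k.+1) m t * m (k - t)%N.
Proof.
move=> m0 m1 mrec; pose S k := \sum_(t < k.+1) m t * m (k - t)%N.
have Srev k : \sum_(t < k.+1) t%:R * (m t * m (k - t)%N) = k%:R / 2 * S k.
  suff H : \sum_(t < k.+1) t%:R * (m t * m (k - t)%N) =
      \sum_(t < k.+1) (k%:R - t%:R) * (m t * m (k - t)%N).
    have E : \sum_(t < k.+1) (k%:R - t%:R) * (m t * m (k - t)%N) =
        k%:R * S k - \sum_(t < k.+1) t%:R * (m t * m (k - t)%N).
      by rewrite /S mulr_sumr -sumrB; apply: eq_bigr => t _; rewrite mulrBl.
    move: H; rewrite E; move: (\sum_(t < k.+1) _) (S k) => x y; lra.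
  rewrite (reindex_inj rev_ord_inj)/=; apply: eq_bigr => t _.
  have tk : (t <= k)%N by rewrite -ltnS.
  rewrite subSS subKn// natrB//.
  by rewrite [m (k - t)%N * _]mulrC.
have Srec k : (k%:R + 6) * S k.+2 = 4 * m k.+2 + (4 * k%:R + 8) * S k.
  have E1 : \sum_(t < k.+3) (t%:R + 2) * (m t * m (k.+2 - t)%N) =
      (k%:R + 2) / 2 * S k.+2 + 2 * S k.+2.
    rewrite -[k%:R + 2]/(k%:R + 2%:R) -natrD addn2 -Srev [2 * S _]mulr_sumr -big_split/=.
    by apply: eq_bigr => t _; rewrite mulrDl.
  have E2 : \sum_(t < k.+3) (t%:R + 2) * (m t * m (k.+2 - t)%N) =
      2 * m k.+2 + 4 * (k%:R / 2 * S k) + 4 * S k.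
    rewrite big_ord_recl big_ord_recl/= subn0 m0 m1 mul0r mulr0 !add0r mul1r -addrA.
    congr (_ + _); rewrite -Srev [4 * \sum_(_ < _) _]mulr_sumr [4 * S k]mulr_sumr -big_split/=.
    apply: eq_bigr => t _; rewrite /bump/= !add1n !subSS.
    have := mrec t; rewrite -[t.+2]addn2 natrD => h.
    have -> : (t%:R + 2%:R + 2) * (m (t + 2)%N * m (k - t)%N) =
      ((t%:R + 4) * m (t + 2)%N) * m (k - t)%N :> R by ring.
    by rewrite h; ring.
  by have := etrans (esym E1) E2; lra.
suff main k : m k.+2 = S k /\ m k.+3 = S k.+1 by move=> k; case: (main k).
elim: k => [|k [IH1 IH2]].
  rewrite /S !big_ord_recl !big_ord0/= /bump/= !subn0 subnn m0 m1.
  have := mrec 0%N; have := mrec 1%N; rewrite m0 m1 => ? ?.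
  by split; lra.
split=> //; have := Srec k; have := mrec k.+2; rewrite -IH1 -[in X in X -> _]addn2 natrD => h1 h2.
have k6 : k%:R + 6 != 0 :> R by rewrite gt_eqF// ltr_wpDl.
by apply: (mulfI k6); rewrite h2; move: h1; rewrite addn2; lra.
Qed.

Lemma moment_semicircle0 : moment (@semicircle R) 0 = 1.
Proof. by rewrite moment_semicircle trig_moment0 divff// mulf_neq0// gt_eqF// pi_gt0. Qed.

Lemma moment_semicircle1 : moment (@semicircle R) 1 = 0.
Proof. by rewrite moment_semicircle trig_moment1 mul0r. Qed.

Lemma moment_semicircle_rec k : moment (@semicircle R) k.+2 =
  \sum_(t < k.+1) moment (@semicircle R) t * moment (@semicircle R) (k - t)%N.
Proof.
apply: (catalan_convolution moment_semicircle0 moment_semicircle1) => j.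
by rewrite !moment_semicircle !mulrA trig_moment_rec.
Qed.

End SemicircleMoments.

(** * Limits of the mean moments *)

Section MomentAsymptotics.
Local Open Scope classical_set_scope.
Local Open Scope ring_scope.
Variables (R : realType) (mu : nat -> R).
Hypotheses (mu1 : mu 1 = 0) (mu2 : mu 2 = 1).
Variable L : nat -> nat -> int.
Hypothesis symL : forall i j, L i j = L j i.

Definition moment_scale N k : R := N%:R * Num.sqrt N%:R ^+ k.

Definition mean_moment k N : R := closed_sum mu (@link_col L N) k / moment_scale N k.
Definition mean_product k k' N : R :=
  closed_sum2 mu (@link_col L N) k k' / (moment_scale N k * moment_scale N k').

Variables (D : nat) (C e : R).
Hypotheses (D0 : (0 < D)%N) (C0 : 0 <= C) (e01 : 0 < e <= 1).
Hypothesis sparseL : sparse_link L D C e.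

Lemma natr_pow_sqrt N j : N%:R ^+ j = Num.sqrt N%:R ^+ (2 * j) :> R.
Proof. by rewrite exprM sqr_sqrtr. Qed.

Lemma sqrt_natr_ge1 N : (0 < N)%N -> 1 <= Num.sqrt N%:R :> R.
Proof. by move=> N0; rewrite -[leLHS]sqrtr1 ler_wsqrtr// ler1n. Qed.

Lemma mean_product_cov k k' : exists2 B : R, 0 <= B & forall N, (0 < N)%N ->
  `|mean_product k k' N - mean_moment k N * mean_moment k' N| <=
    B * N%:R `^ (1 - e) * N%:R ^+ uphalf (k + k') /
      (N%:R ^+ 2 * Num.sqrt N%:R ^+ (k + k')).
Proof.
have B0 : 0 <= cov_const mu D (k + k').
  by rewrite mulrn_wge0// addr_ge0// ?mulr_ge0// exprn_ge0// (le_trans ler01)// mu_bound_ge1.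
exists (cov_const mu D (k + k') * C); first by rewrite mulr_ge0.
move=> N N0; have [l [row lev fork] lC] := sparseL N0.
have N1 : 0 < N%:R :> R by rewrite ltr0n.
have s0 : 0 < Num.sqrt N%:R :> R by rewrite sqrtr_gt0.
rewrite /mean_product /mean_moment [X in _ - X]mulrACA -invfM -mulrBl normrM.
rewrite [X in _ * X]ger0_norm; last by rewrite invr_ge0 !mulr_ge0 ?exprn_ge0 ?sqrtr_ge0.
have -> : moment_scale N k * moment_scale N k' = N%:R ^+ 2 * Num.sqrt N%:R ^+ (k + k').
  by rewrite /moment_scale exprD expr2; ring.
rewrite ler_pM2r ?invr_gt0 ?mulr_gt0 ?exprn_gt0//.
have := closed_sum_cov mu1 D0 (fun x y => symL _ _) row lev k k'.
rewrite card_ord => /le_trans; apply.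
rewrite -[leLHS]mulr_natr natrM natrX !mulrA ler_wpM2r ?exprn_ge0//.
by rewrite -mulrA ler_wpM2l.
Qed.

Lemma mean_moment_rec k : exists2 B : R, 0 <= B & forall N, (0 < N)%N ->
  `|mean_moment k.+2 N - \sum_(t < k.+1) mean_product t (k - t) N| <=
    B * (N%:R ^+ uphalf k.+2 + N%:R `^ (1 - e) * N%:R ^+ (k.+2)./2) /
      (N%:R * Num.sqrt N%:R ^+ k.+2).
Proof.
have M0 j : 0 <= mu_bound mu j ^+ j.
  by rewrite exprn_ge0// (le_trans ler01)// mu_bound_ge1.
have B0 : 0 <= rec_const mu D k by rewrite mulrn_wge0// addr_ge0// mulrn_wge0.
exists (rec_const mu D k * (1 + C)); first by rewrite mulr_ge0// addr_ge0.
move=> N N0; have [l [row lev fork] lC] := sparseL N0.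
have N1 : 0 < N%:R :> R by rewrite ltr0n.
have s0 : 0 < Num.sqrt N%:R :> R by rewrite sqrtr_gt0.
have sc (t : 'I_k.+1) : moment_scale N t * moment_scale N (k - t) = moment_scale N k.+2.
  have kE : k.+2 = (2 + (t + (k - t)))%N by rewrite subnKC// -ltnS.
  by rewrite /moment_scale kE !exprD sqr_sqrtr//; ring.
under eq_bigr do rewrite /mean_product sc.
have sc0 : 0 < N%:R * Num.sqrt N%:R ^+ k.+2 :> R by rewrite mulr_gt0// exprn_gt0.
rewrite -mulr_suml /mean_moment -mulrBl normrM normfV /moment_scale (gtr0_norm sc0).
rewrite ler_pM2r ?invr_gt0//.
have := closed_sum_rec mu1 mu2 D0 (fun x y => symL _ _) row lev fork k.
rewrite card_ord => /le_trans; apply.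
rewrite -[leLHS]mulr_natr natrD natrX natrM natrX -mulrA ler_wpM2l//.
rewrite mulrDl mul1r -[leLHS]addr0 -addrA; apply: lerD.
  by rewrite lerDl mulr_ge0// powR_ge0.
rewrite addr0 mulrDr; apply: (@le_trans _ _ (C * (N%:R `^ (1 - e) * N%:R ^+ (k.+2)./2))).
  by rewrite mulrA ler_wpM2r// exprn_ge0.
by rewrite lerDr mulr_ge0// exprn_ge0.
Qed.

Lemma powR_sub N a b : (0 < N)%N -> N%:R `^ (a - b) = N%:R `^ a * N%:R `^ (- b) :> R.
Proof. by move=> N0; rewrite powRD// pnatr_eq0 -lt0n N0 implybT. Qed.

(** The pairs of walks that contribute are [O(l * N ^ k)] in number, and the
    normalisation is [N ^ (k + 2)]. *)
Lemma mean_product_variance k : exists2 B : R, 0 <= B & forall N, (0 < N)%N ->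
  `|mean_product k k N - mean_moment k N ^+ 2| <= B * N%:R `^ (- (1 + e)).
Proof.
have [B B0 H] := mean_product_cov k k; exists B => // N N0.
have N1 : 0 < N%:R :> R by rewrite ltr0n.
have s0 : 0 < Num.sqrt N%:R :> R by rewrite sqrtr_gt0.
rewrite expr2; apply: le_trans (H N N0) _; rewrite addnn uphalf_double.
rewrite natr_pow_sqrt mul2n invfM mulrACA mulfV ?gt_eqF ?exprn_gt0// mulr1.
rewrite -mulrA ler_wpM2l// powR_sub// powRr1// opprD powR_sub//.
by rewrite powR_inv1// expr2 invfM mulrACA mulfV ?gt_eqF// mul1r mulrC.
Qed.

Lemma mean_product_cov_le k k' : exists2 B : R, 0 <= B & forall N, (0 < N)%N ->
  `|mean_product k k' N - mean_moment k N * mean_moment k' N| <= B * N%:R `^ (- 2^-1).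
Proof.
have [B B0 H] := mean_product_cov k k'; exists B => // N N0.
have N1 : 0 < N%:R :> R by rewrite ltr0n.
have s0 : 0 < Num.sqrt N%:R :> R by rewrite sqrtr_gt0.
have s1 := sqrt_natr_ge1 N0.
apply: le_trans (H N N0) _; rewrite -[in leLHS]mulrA -[in leLHS]mulrA ler_wpM2l// powRN powR12_sqrt//.
have P1 : N%:R `^ (1 - e) <= N%:R.
  rewrite -[leRHS]powRr1// ler_powR ?ler1n// gerDl oppr_le0.
  by case/andP: e01 => /ltW.
have P2 : N%:R ^+ uphalf (k + k') <= Num.sqrt N%:R ^+ (k + k').+1 :> R.
  by rewrite natr_pow_sqrt ler_weXn2l//; lia.
apply: le_trans (ler_pM _ _ P1 (ler_pM _ _ P2 (lexx _))) _.
- exact: powR_ge0.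
- by rewrite mulr_ge0 ?invr_ge0 ?mulr_ge0 ?exprn_ge0 ?(ltW s0).
- by rewrite exprn_ge0 ?(ltW s0).
- by rewrite invr_ge0 mulr_ge0 ?exprn_ge0 ?(ltW s0).
move: s0 N1 (sqr_sqrtr (ltW N1)).
move: (N%:R : R) (Num.sqrt (N%:R : R)) => n s s0 n0 <-; rewrite le_eqVlt; apply/orP; left; apply/eqP.
rewrite (exprS s (k + k')); have := exprn_gt0 (k + k') s0; move: (s ^+ (k + k')) => z z0.
by field; rewrite !gt_eqF.
Qed.

Lemma mean_moment_rec_le k : exists2 B : R, 0 <= B & forall N, (0 < N)%N ->
  `|mean_moment k.+2 N - \sum_(t < k.+1) mean_product t (k - t) N| <=
    B * (N%:R `^ (- 2^-1) + N%:R `^ (- e)).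
Proof.
have [B B0 H] := mean_moment_rec k; exists B => // N N0.
have N1 : 0 < N%:R :> R by rewrite ltr0n.
have s0 : 0 < Num.sqrt N%:R :> R by rewrite sqrtr_gt0.
have s1 := sqrt_natr_ge1 N0.
apply: le_trans (H N N0) _; rewrite -!mulrA ler_wpM2l// mulrDl lerD//.
  rewrite powRN powR12_sqrt//.
  have P2 : N%:R ^+ uphalf k.+2 <= Num.sqrt N%:R ^+ k.+3 :> R.
    by rewrite natr_pow_sqrt ler_weXn2l//; lia.
  apply: le_trans (ler_pM _ _ P2 (lexx _)) _.
  - by rewrite exprn_ge0 ?(ltW s0).
  - by rewrite invr_ge0 mulr_ge0 ?exprn_ge0 ?(ltW s0).
  move: s0 N1 (sqr_sqrtr (ltW N1)).
  move: (N%:R : R) (Num.sqrt (N%:R : R)) => n s s0 n0 <-; rewrite le_eqVlt; apply/orP; left; apply/eqP.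
  rewrite (exprS s k.+2); have := exprn_gt0 k.+2 s0; move: (s ^+ k.+2) => z z0.
  by field; rewrite !gt_eqF.
have P2 : N%:R ^+ k.+2./2 <= Num.sqrt N%:R ^+ k.+2 :> R.
  by rewrite natr_pow_sqrt ler_weXn2l//; lia.
have sc0 : 0 < N%:R * Num.sqrt N%:R ^+ k.+2 :> R by rewrite mulr_gt0// exprn_gt0.
rewrite powR_sub// powRr1// ler_pdivrMr//.
by rewrite -[leLHS]mulrA mulrCA ler_wpM2l ?powR_ge0// ler_wpM2l.
Qed.

Lemma cvg_powR_neg (b : R) : 0 < b -> (fun n => n.+1%:R `^ (- b) : R) @ \oo --> (0 : R).
Proof.
move=> b0; apply/cvgrPdist_le => eps eps0; near=> n.
rewrite sub0r normrN ger0_norm ?powR_ge0//.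
have epsn : eps `^ (- b^-1) <= n.+1%:R.
  apply: (@le_trans _ _ n%:R); last by rewrite ler_nat.
  by near: n; exact: nbhs_infty_ger.
have -> : eps = (eps `^ (- b^-1)) `^ (- b).
  by rewrite -powRrM mulrNN mulVf ?gt_eqF// powRr1// ltW.
rewrite [leLHS]powRN [leRHS]powRN lef_pV2 ?posrE ?powR_gt0//.
by apply: ge0_ler_powR; rewrite ?(ltW b0)// nnegrE ?powR_ge0.
Unshelve. all: by end_near. Qed.

Lemma cvg_sum_ord m (u : nat -> nat -> R) (v : nat -> R) :
  (forall t, (t < m)%N -> u t @ \oo --> v t) ->
  (fun n => \sum_(t < m) u t n) @ \oo --> \sum_(t < m) v t.
Proof.
move=> uv; elim: m uv => [|m IH] uv.
  by under eq_fun do rewrite big_ord0; rewrite big_ord0; exact: cvg_cst.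
under eq_fun do rewrite big_ord_recr/=; rewrite big_ord_recr/=.
by apply: cvgD; [apply: IH => t tm; apply: uv; exact: ltnW|exact: uv].
Qed.

Lemma cvg_of_dist (u v : nat -> R) (b : nat -> R) (B l : R) :
  (forall n, `|u n - v n| <= B * b n) -> b @ \oo --> 0 ->
  v @ \oo --> l -> u @ \oo --> l.
Proof.
move=> uv b0 vl; have -> : u = (fun n => (u n - v n) + v n).
  by apply/funext => n; rewrite subrK.
rewrite -[l]add0r; apply: cvgD vl; apply/norm_cvg0P.
have Bb : (fun n => B * b n) @ \oo --> 0.
  by rewrite -[X in _ --> X](mulr0 B); apply: cvgM => //; exact: cvg_cst.
apply: (@squeeze_cvgr _ _ _ _ (cst 0) (fun n => B * b n)) => //; last exact: cvg_cst.
by near=> n; rewrite normr_ge0 uv.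
Unshelve. all: by end_near. Qed.

Lemma mean_moment0 N : (0 < N)%N -> mean_moment 0 N = 1.
Proof.
move=> N0; rewrite /mean_moment /closed_sum /moment_scale expr0 mulr1.
under eq_bigr => x _.
  rewrite big_mkcond big_seq1/= eqxx /weight/= big_nil; over.
by rewrite big_enum/= sumr_const card_ord divff// pnatr_eq0 -lt0n.
Qed.

Lemma mean_moment1 N : mean_moment 1 N = 0.
Proof.
rewrite /mean_moment /closed_sum big1 ?mul0r// => x _.
rewrite big_seq_cond big1// => s /andP[]; rewrite mem_seqs_over => /andP[/eqP s1 _] _.
apply: (weight_nonrepeating mu1); case: s s1 => [|y []]// _ rep.
by have := rep _ (mem_head _ _); rewrite /= eqxx.
Qed.

(** The recursion determines the limits, and the semicircle moments obey it. *)
Lemma mean_moment_cvg k : (fun n => mean_moment k n.+1) @ \oo --> moment (@semicircle R) k.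
Proof.
have [n] := ubnP k; elim: n k => // n IH [|[|k]] kn.
- rewrite moment_semicircle0; under eq_fun do rewrite mean_moment0//; exact: cvg_cst.
- rewrite moment_semicircle1; under eq_fun do rewrite mean_moment1; exact: cvg_cst.
have e0 : 0 < e by case/andP: e01.
have half0 : 0 < 2^-1 :> R by rewrite invr_gt0.
have [B B0 H] := mean_moment_rec_le k.
apply: (cvg_of_dist (fun n => H n.+1 isT)).
  by rewrite -[X in _ --> X]addr0; apply: cvgD; exact: cvg_powR_neg.
rewrite moment_semicircle_rec.
apply: (@cvg_sum_ord k.+1 (fun t n => mean_product t (k - t) n.+1)
   (fun t => moment (@semicircle R) t * moment (@semicircle R) (k - t))) => t tk.
have [B' B'0 H'] := mean_product_cov_le t (k - t).
apply: (cvg_of_dist (fun n => H' n.+1 isT)); first exact: cvg_powR_neg.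
by apply: cvgM; apply: IH; move: kn tk; rewrite !ltnS; lia.
Qed.

End MomentAsymptotics.

(** * Convergence of the random moments *)

Section Expectation.
Local Open Scope classical_set_scope.
Local Open Scope ring_scope.
Context d (T : measurableType d) (R : realType) (P : probability T R).

Definition integrableR (f : T -> R) := P.-integrable setT (EFin \o f).

Lemma integrableR_D f g : integrableR f -> integrableR g ->
  integrableR (fun w => f w + g w).
Proof. by move=> fi gi; exact: (@integrableD _ _ _ P setT measurableT _ _ fi gi). Qed.

Lemma integrableR_Z (k : R) f : integrableR f -> integrableR (fun w => k * f w).
Proof. by move=> fi; exact: (@integrableZl _ _ _ P setT measurableT k _ fi). Qed.

Lemma RintegralT_D f g : integrableR f -> integrableR g ->
  \int[P]_w (f w + g w) = \int[P]_w f w + \int[P]_w g w.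
Proof. by move=> fi gi; apply: RintegralD. Qed.

Lemma RintegralT_Z (k : R) f : integrableR f ->
  \int[P]_w (k * f w) = k * \int[P]_w f w.
Proof. by move=> fi; apply: RintegralZl. Qed.

Lemma integrableR_eq f g : f =1 g -> integrableR f -> integrableR g.
Proof. by move=> /funext ->. Qed.

Lemma integrableR_sum (J : Type) (s : seq J) (Q : pred J) (F : J -> T -> R) :
  (forall j, integrableR (F j)) ->
  integrableR (fun w => \sum_(j <- s | Q j) F j w) /\
  \int[P]_w (\sum_(j <- s | Q j) F j w) = \sum_(j <- s | Q j) \int[P]_w F j w.
Proof.
move=> iF; elim: s => [|j s [IH1 IH2]].
  rewrite big_nil; under eq_Rintegral do rewrite big_nil.
  rewrite Rintegral_cst// mul0r; split=> //.
  apply: (@integrableR_eq (fun=> 0)) => [w|]; first by rewrite big_nil.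
  exact: integrable0.
rewrite big_cons; case: ifPn => Qj; last first.
  rewrite -IH2; split.
    by apply: integrableR_eq IH1 => w; rewrite big_cons (negbTE Qj).
  by apply: eq_Rintegral => w _; rewrite big_cons (negbTE Qj).
rewrite -IH2 -RintegralT_D//; split.
  by apply: integrableR_eq (integrableR_D (iF j) IH1) => w; rewrite big_cons Qj.
by apply: eq_Rintegral => w _; rewrite big_cons Qj.
Qed.

(** The series of the [Y n] has finite expectation, so it converges almost surely
    and its terms tend to 0. *)
Lemma ae_cvg0 (Y : nat -> T -> R) (c : nat -> R) (B : R) :
  (forall n, integrableR (Y n)) -> (forall n w, 0 <= Y n w) ->
  (forall n, \int[P]_w Y n w <= c n) ->
  (forall M, \sum_(0 <= n < M) c n <= B) ->
  {ae P, forall w, Y n w @[n --> \oo] --> 0}.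
Proof.
move=> iY Y0 Yc cB.
have mY n : measurable_fun setT (EFin \o Y n) by exact: measurable_int (iY n).
pose S w := (\sum_(0 <= n <oo) (Y n w)%:E)%E.
have S0 w : (0 <= S w)%E by apply: nneseries_ge0 => n _ _; rewrite lee_fin.
have iS : P.-integrable setT S.
  apply/integrableP; split.
    apply: ge0_emeasurable_sum => [n w _ _|n _]; last exact: mY.
    by rewrite lee_fin.
  under eq_integral do rewrite gee0_abs//.
  rewrite integral_nneseries//; last by move=> n w _; rewrite lee_fin.
  apply: (@le_lt_trans _ _ B%:E); last by rewrite ltry.
  apply: lime_le.
    by apply: is_cvg_nneseries => n _ _; apply: integral_ge0 => w _; rewrite lee_fin.
  near=> M; apply: le_trans (_ : ((\sum_(0 <= n < M) c n)%:E <= _)%E); last by rewrite lee_fin.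
  rewrite -sumEFin; apply: lee_sum => n _.
  rewrite -[X in (X <= _)%E]fineK; first by rewrite lee_fin; exact: Yc.
  exact: integrable_fin_num (iY n).
have := integrable_ae measurableT iS; apply: filterS => w /(_ Logic.I) Sw.
apply: cvg_series_cvg_0.
apply: nondecreasing_is_cvgn.
  by apply/nondecreasing_seqP => n; rewrite seriesSr lerDl.
exists (fine (S w)) => _ [n _ <-].
rewrite -lee_fin fineK// /series /= -sumEFin.
by apply: nneseries_lim_ge => i _ _; rewrite lee_fin.
Unshelve. all: by end_near. Qed.

End Expectation.

Section RandomMoments.
Local Open Scope classical_set_scope.
Local Open Scope ring_scope.
Context d (T : measurableType d) (R : realType) (P : probability T R).
Variables (p : probability R R) (a : int -> {RV P >-> R}).
Hypotheses (lawp : standard_law p) (iida : iid a p).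
Variable L : nat -> nat -> int.
Hypothesis symL : forall i j, L i j = L j i.

Local Notation mom := (law_moment p).

Lemma law_moment1 : mom 1 = 0.
Proof.
have [_ E0 _] := lawp; rewrite /law_moment /Rintegral.
by under eq_integral do rewrite expr1; move: E0; rewrite unlock => ->.
Qed.

Lemma law_moment2 : mom 2 = 1.
Proof.
have [_ E0 V1] := lawp; rewrite /law_moment /Rintegral.
move: V1; rewrite /variance unlock E0/= => V1.
have -> : (\int[p]_x (x ^+ 2)%:E = 1)%E.
  rewrite -V1 unlock; apply: eq_integral => x _ /=.
  by rewrite -[RHS]/(((x - 0) * (x - 0))%:E) !subr0 expr2.
by [].
Qed.

Definition trace_pow N k (w : T) : R := \tr (link_matrix (fun i => a i w) L N ^+ k).

Local Notation col N := (@link_col L N).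

Lemma trace_pow_walks N k w : trace_pow N k w =
  \sum_(x <- enum 'I_N) \sum_(s <- seqs_over (enum 'I_N) k | last x s == x)
     \prod_(c <- word (col N) x s) a c w.
Proof. exact: (trace_walks (fun i => a i w) (col N)). Qed.

Lemma prod_word (u : seq int) :
  integrableR P (fun w => \prod_(c <- u) a c w) /\
  \int[P]_w (\prod_(c <- u) a c w) = weight mom u.
Proof.
have [pX _ _] := lawp; exact: (integral_word iida pX u).
Qed.

Lemma trace_pow_expectation N k :
  integrableR P (trace_pow N k) /\ \int[P]_w trace_pow N k w = closed_sum mom (col N) k.
Proof.
have inner x := @integrableR_sum _ _ _ P _ (seqs_over (enum 'I_N) k) (fun s => last x s == x)
  (fun s w => \prod_(c <- word (col N) x s) a c w) (fun s => (prod_word _).1).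
have [outer1 outer2] := @integrableR_sum _ _ _ P _ (enum 'I_N) xpredT _ (fun x => (inner x).1).
split.
  by apply: integrableR_eq outer1 => w; rewrite trace_pow_walks.
under eq_Rintegral do rewrite trace_pow_walks.
rewrite outer2; apply: eq_bigr => x _; rewrite (inner x).2.
by apply: eq_bigr => s _; rewrite (prod_word _).2.
Qed.

Lemma trace_pow_mul_expectation N k k' :
  integrableR P (fun w => trace_pow N k w * trace_pow N k' w) /\
  \int[P]_w (trace_pow N k w * trace_pow N k' w) = closed_sum2 mom (col N) k k'.
Proof.
pose F x s y s' w := \prod_(c <- word (col N) x s ++ word (col N) y s') a c w.
have I1 x s y := @integrableR_sum _ _ _ P _ (seqs_over (enum 'I_N) k')
  (fun s' => last y s' == y) (fun s' => F x s y s') (fun s' => (prod_word _).1).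
have I2 x s := @integrableR_sum _ _ _ P _ (enum 'I_N) xpredT _ (fun y => (I1 x s y).1).
have I3 x := @integrableR_sum _ _ _ P _ (seqs_over (enum 'I_N) k)
  (fun s => last x s == x) _ (fun s => (I2 x s).1).
have [r1 r2] := @integrableR_sum _ _ _ P _ (enum 'I_N) xpredT _ (fun x => (I3 x).1).
have E w : \sum_(x <- enum 'I_N) \sum_(s <- seqs_over (enum 'I_N) k | last x s == x)
    \sum_(y <- enum 'I_N) \sum_(s' <- seqs_over (enum 'I_N) k' | last y s' == y) F x s y s' w =
    trace_pow N k w * trace_pow N k' w.
  rewrite !trace_pow_walks mulr_suml; apply: eq_bigr => x _.
  rewrite mulr_suml; apply: eq_bigr => s _.
  rewrite mulr_sumr; apply: eq_bigr => y _.
  by rewrite mulr_sumr; apply: eq_bigr => s' _; rewrite /F big_cat.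
split; first exact: integrableR_eq r1.
under eq_Rintegral do rewrite -E.
rewrite r2; apply: eq_bigr => x _; rewrite (I3 x).2; apply: eq_bigr => s _.
rewrite (I2 x s).2; apply: eq_bigr => y _; rewrite (I1 x s y).2.
by apply: eq_bigr => s' _; rewrite (prod_word _).2.
Qed.

Definition random_moment k N w : R :=
  moment (empirical_spectral_measure (link_matrix (fun i => a i w) L N)) k.

Lemma random_momentE k N w : random_moment k N w = (moment_scale R N k)^-1 * trace_pow N k w.
Proof.
rewrite /random_moment moment_empirical sum_eigenvalues_pow//.
exact: trmx_link_matrix.
Qed.

Definition sq_deviation k N w : R := (random_moment k N w - mean_moment mom L k N) ^+ 2.

Lemma sq_deviation_expectation k N :
  integrableR P (sq_deviation k N) /\
  \int[P]_w sq_deviation k N w = mean_product mom L k k N - mean_moment mom L k N ^+ 2.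
Proof.
set c := (moment_scale R N k)^-1; set m := mean_moment mom L k N.
have [i1 E1] := trace_pow_expectation N k.
have [i2 E2] := trace_pow_mul_expectation N k k.
have i0 : integrableR P (fun=> m ^+ 2 : R).
  exact: (@finite_measure_integrable_cst _ _ _ P setT).
have E w : c ^+ 2 * (trace_pow N k w * trace_pow N k w) +
    (- (2 * m * c) * trace_pow N k w + m ^+ 2) = sq_deviation k N w.
  by rewrite /sq_deviation random_momentE -/c -/m; ring.
have j2 := integrableR_Z (c ^+ 2) i2; have j1 := integrableR_Z (- (2 * m * c)) i1.
split; first exact: integrableR_eq E (integrableR_D j2 (integrableR_D j1 i0)).
under eq_Rintegral do rewrite -E.
rewrite (RintegralT_D j2 (integrableR_D j1 i0)) (RintegralT_D j1 i0).
rewrite (RintegralT_Z _ i2) (RintegralT_Z _ i1) E1 E2.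
rewrite Rintegral_cst// /= probability_setT mulr1.
have -> : mean_product mom L k k N = c ^+ 2 * closed_sum2 mom (col N) k k.
  by rewrite /mean_product invfM -/c mulrC expr2.
have mE : m = closed_sum mom (col N) k * c by [].
by rewrite mE; congr (_ + _); ring.
Qed.

Variables (D : nat) (C e : R).
Hypotheses (D0 : (0 < D)%N) (C0 : 0 <= C) (e01 : 0 < e <= 1).
Hypothesis sparseL : sparse_link L D C e.

Lemma sq_deviation_bound k : exists2 B : R, 0 <= B & forall N,
  \int[P]_w sq_deviation k N.+1 w <= B * N.+1%:R `^ (- (1 + e)).
Proof.
have [B B0 H] := mean_product_variance law_moment1 symL D0 C0 sparseL k.
exists B => // N; rewrite (sq_deviation_expectation _ _).2.
apply: le_trans (H N.+1 isT); exact: ler_norm.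
Qed.

(** The squared deviations from the mean have summable expectations. *)
Lemma random_moment_ae k :
  {ae P, forall w, random_moment k N w @[N --> \oo] --> moment (@semicircle R) k}.
Proof.
have [B B0 H] := sq_deviation_bound k.
have e0 : 0 < e by case/andP: e01.
have : {ae P, forall w, sq_deviation k n.+1 w @[n --> \oo] --> 0}.
  apply: (ae_cvg0 (fun n => (sq_deviation_expectation k n.+1).1) _ H).
    by move=> n w; exact: sqr_ge0.
  move=> M; rewrite -mulr_sumr; apply: ler_wpM2l => //.
  exact: (sum_powR_bounded e0 M).
apply: filterS => w Hw; rewrite -cvg_shiftS.
have mc := mean_moment_cvg law_moment1 law_moment2 symL D0 C0 e01 sparseL (k := k).
have -> : (fun n => random_moment k n.+1 w) = (fun n =>
    (random_moment k n.+1 w - mean_moment mom L k n.+1) + mean_moment mom L k n.+1).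
  by apply/funext => n; rewrite subrK.
rewrite -[moment (@semicircle R) k]add0r; apply: cvgD (mc).
apply/norm_cvg0P.
have -> : (fun n => `|random_moment k n.+1 w - mean_moment mom L k n.+1|) =
    (fun n => Num.sqrt (sq_deviation k n.+1 w)).
  by apply/funext => n; rewrite /sq_deviation sqrtr_sqr.
rewrite -(@sqrtr0 R).
exact: (@continuous_cvg _ _ _ _ _ (fun n => sq_deviation k n.+1 w) Num.sqrt 0
  (@sqrt_continuous R 0) Hw).
Qed.

(** Chebyshev's inequality for the deviation from the mean, once the mean is
    within [eps / 2] of its limit. *)
Lemma random_moment_prob k eps : 0 < eps ->
  P [set w | eps <= `|random_moment k N w - moment (@semicircle R) k|] @[N --> \oo] --> 0%E.
Proof.
move=> eps0; suff shifted : (fun n => P [set w | eps <=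
    `|random_moment k n.+1 w - moment (@semicircle R) k|]) @ \oo --> (0 : \bar R)%E.
  by rewrite -cvg_shiftS; exact: shifted.
have [B B0 H] := sq_deviation_bound k.
have e0 : 0 < e by case/andP: e01.
have mc := mean_moment_cvg law_moment1 law_moment2 symL D0 C0 e01 sparseL (k := k).
pose b n : R := B * n.+1%:R `^ (- (1 + e)) / (eps / 2) ^+ 2.
have b_cvg : b @ \oo --> (0 : R).
  rewrite -[X in _ --> X](mul0r ((eps / 2) ^+ 2)^-1); apply: cvgMl.
  rewrite -[X in _ --> X](mulr0 B); apply: cvgMr.
  by apply: cvg_powR_neg; rewrite addr_gt0.
suff H' : \forall n \near \oo, (0 <= P [set w | (eps <=
    `|random_moment k n.+1 w - moment (@semicircle R) k|)%R] <= (b n)%:E)%E.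
  apply: (squeeze_cvge H'); first exact: cvg_cst.
  by apply: cvg_EFin => //; near=> n.
near=> n; rewrite measure_ge0/=.
have mdist : `|mean_moment mom L k n.+1 - moment (@semicircle R) k| <= eps / 2.
  near: n; move/cvgrPdist_le : mc => /(_ (eps / 2)); rewrite divr_gt0// => /(_ isT).
  by apply: filterS => n; rewrite distrC.
have [id Ed] := sq_deviation_expectation k n.+1.
have md : measurable_fun setT (EFin \o sq_deviation k n.+1) by exact: measurable_int id.
pose A := [set w | (((eps / 2) ^+ 2)%:E <= `|(EFin \o sq_deviation k n.+1) w|)%E].
have half0 : 0 < (eps / 2) ^+ 2 by rewrite exprn_gt0// divr_gt0.
have mA : measurable A.
  by rewrite -[A]setTI; apply: emeasurable_fun_c_infty => //; exact: measurableT_comp.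
have markovA : (((eps / 2) ^+ 2)%:E * P A <= (\int[P]_w sq_deviation k n.+1 w)%:E)%E.
  have := @le_integral_comp_abse _ _ _ P _ measurableT (EFin \o sq_deviation k n.+1)
    ((eps / 2) ^+ 2) idfun (@measurable_id _ _ _) (fun r h => h) (fun r s _ _ h => h) md half0.
  rewrite setTI => /le_trans; apply; rewrite /Rintegral fineK; last first.
    exact: integrable_fin_num id.
  by rewrite le_eqVlt; apply/orP; left; apply/eqP; apply: eq_integral => w _ /=;
    rewrite ger0_norm// sqr_ge0.
apply: (@le_trans _ _ (P A)).
  apply: le_measure; rewrite ?inE//.
    rewrite -[X in measurable X]setTI.
    pose g w : R := `|random_moment k n.+1 w - moment (@semicircle R) k|.
    have -> : [set w | eps <= `|random_moment k n.+1 w - moment (@semicircle R) k|] =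
        [set w | (eps%:E <= (EFin \o g) w)%E] by apply/seteqP; split=> w.
    apply: emeasurable_fun_c_infty => //; apply/measurable_EFinP.
    apply: measurableT_comp => //; apply: measurable_funB => //.
    rewrite (_ : random_moment k n.+1 = fun w =>
      (moment_scale R n.+1 k)^-1 * trace_pow n.+1 k w); last first.
      by apply/funext => w; exact: random_momentE.
    apply: measurable_funM => //; apply/measurable_EFinP.
    exact: measurable_int (trace_pow_expectation n.+1 k).1.
  move=> w /= epsw; rewrite /A /= lee_fin ger0_norm ?sqr_ge0// /sq_deviation -[leRHS]real_normK ?num_real//.
  rewrite lerXn2r ?nnegrE// ?divr_ge0 ?(ltW eps0)//.
  have := ler_normD (random_moment k n.+1 w - mean_moment mom L k n.+1)
    (mean_moment mom L k n.+1 - moment (@semicircle R) k).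
  by rewrite subrKA; move: epsw mdist; lra.
rewrite /b mulrC EFinM lee_pdivlMl//; apply: le_trans markovA _.
by rewrite lee_fin H.
Unshelve. all: by end_near. Qed.

End RandomMoments.

(** * Universality of the semicircle law *)

Local Open Scope ring_scope.

Theorem theorem1p4 (R : realType) (d : measure_display) (T : measurableType d)
    (P : probability T R) (p : probability R R)
    (a : int -> {RV P >-> R})
    (p1 p2 : {poly int}) (L : nat -> nat -> int) :
  standard_law p ->
  iid a p ->
  (1 < size p1)%N -> (1 < size p2)%N -> size p1 <> size p2 ->
  L = link_PT p1 p2 \/ L = link_PH p1 p2 ->
  let mu (N : nat) (w : T) :=
    empirical_spectral_measure (link_matrix (fun i => a i w) L N) in
  cvg_moments_in_probability P mu (@semicircle R) /\
  cvg_moments_almost_surely P mu (@semicircle R).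
Proof.
move=> lawp iida s1 s2 s12 LE.
have symL i j : L i j = L j i.
  by case: LE => ->; [exact: link_PT_sym|exact: link_PH_sym].
have [D [C [e [D0 C0 e01 sparseL]]]] := link_sparse R s1 s2 s12 LE.
split.
  by move=> k eps eps0; exact: (random_moment_prob lawp iida symL D0 C0 e01 sparseL k eps0).
by move=> k; exact: (random_moment_ae lawp iida symL D0 C0 e01 sparseL k).
Qed.
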